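(* Let $(M,g)$ be a $3$-dimensional $pp$-wave, let $h$ be a positive smooth function on $M$ which is not constant on any nonempty open subset, and let $\Lambda\in\mathbb{R}$. If $(M,g,h\,dvol_g)$ is a non-flat solution of $$h\rho-\operatorname{Hes}_h+(\Delta h+\Lambda)g=0,$$ then $\Lambda=0$ and one of the following possibilities holds: (1) $\nabla h$ is lightlike and $(M,g)$ is a plane wave which in local coordinates $(u,v,x)$ can be written as $$g(u,v,x)=dv\left(2du-\frac{\alpha''(v)}{\alpha(v)}x^2dv\right)+dx^2,$$ where $h(u,v,x)=\alpha(v)$ is an arbitrary function with $\alpha''(v)\neq 0$. (2) $\nabla h$ is spacelike and $(M,g)$ can be written in local coordinates $(u,v,x)$ as $g=dv\left(2du+F(v,x)dv\right)+dx^2$ with $$F(v,x)=\frac{\left(\gamma_1\alpha(v)+2\gamma_0(v)\gamma_0''(v)\right)\log(\gamma_0(v)+\gamma_1x)}{\gamma_1^2}-\frac{2x\gamma_0''(v)}{\gamma_1}+\beta(v),$$ where $h(u,v,x)=\gamma_1x+\gamma_0(v)$, $\gamma_1\in\mathbb{R}\setminus\{0\}$, and $\gamma_0,\alpha,\beta$ are arbitrary functions such that $\gamma_1\alpha(v)+2\gamma_0(v)\gamma_0''(v)\neq 0$.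
   Context: A spacetime is a connected smooth Lorentzian manifold. $\rho$ is the Ricci tensor, $\nabla h$ the gradient of $h$, $\operatorname{Hes}_h(X,Y)=g(\nabla_X\nabla h,Y)$ the Hessian, and $\Delta h=\operatorname{tr}_g\operatorname{Hes}_h$. Products of $1$-forms in a metric are symmetric products, so for $g=dv(2du+F\,dv)+dx^2$ the nonzero components are $g(\partial_u,\partial_v)=1$, $g(\partial_v,\partial_v)=F$, $g(\partial_x,\partial_x)=1$. A $pp$-wave is a spacetime admitting a parallel lightlike (nowhere zero null) vector field $V$ such that $R(X,Y)=0$ for all $X,Y\in V^\perp$. In dimension three, $pp$-waves are characterized by local coordinates $(u,v,x)$ in which $g=dv(2du+F(v,x)dv)+dx^2$, with $V=\partial_u$. A plane wave is a $pp$-wave with $\nabla_XR=0$ for all $X\in V^\perp$. The classification is local: non-flatness ($R\ne0$) is understood at the points under consideration, and the causal character of $\nabla h$ (lightlike: $g(\nabla h,\nabla h)=0$; spacelike: $g(\nabla h,\nabla h)>0$) is understood at points where $\nabla h\neq 0$. *)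

(* Defs.v *)
From HB Require Import structures.
From mathcomp Require Import all_boot all_order all_algebra.
From mathcomp Require Import all_classical all_reals all_analysis.
Set Implicit Arguments.
Unset Strict Implicit.
Unset Printing Implicit Defensive.
Import Order.TTheory GRing.Theory Num.Theory.
Import numFieldNormedType.Exports.
Local Open Scope ring_scope.
Local Open Scope classical_set_scope.

Notation coords R := 'rV[R]_3.
Notation vfield R := ('rV[R]_3 -> 'rV[R]_3).
Notation tensor2 R := ('rV[R]_3 -> 'M[R]_3).

(** * Smooth functions of three and of one real variables *)

Definition partial (R : realType) (i : 'I_3) (f : coords R -> R) :
    coords R -> R :=
  fun x => 'D_(delta_mx 0 i) f x.

(* C^infinity on the open set U: all iterated partial derivatives exist and
   are continuous at every point of U. *)
Definition smooth_on (R : realType) (U : set (coords R)) (f : coords R -> R) :=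
  forall (s : seq 'I_3) (x : coords R), U x ->
    {for x, continuous (foldr (@partial R) f s)} /\
    forall i : 'I_3, derivable (foldr (@partial R) f s) x (delta_mx 0 i).

Definition smooth1_on (R : realType) (D : set R) (f : R -> R) :=
  forall (n : nat) (t : R), D t -> derivable (f^`(n)) t 1.

(** * Pseudo-Riemannian geometry in one coordinate system

   [G x] is the Gram matrix of the metric in the coordinate frame at [x];
   vectors are rows of components. *)

Section Coordinates.
Variables (R : realType) (G : tensor2 R).
Implicit Types (x : coords R) (i j k l m : 'I_3).

Definition inner x (X Y : coords R) : R := (X *m G x *m Y^T) 0 0.

(* signature (-,+,+): there is a pseudo-orthonormal basis (the rows of P) *)
Definition lorentzian_at x : Prop :=
  exists2 P : 'M[R]_3, P \in unitmx &
    P *m G x *m P^T = diag_mx (\row_i (if i == 0 then -1 else 1)).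

(* Gamma^k_{ij} *)
Definition christoffel k i j x : R :=
  2^-1 * \sum_l invmx (G x) k l *
    (partial i (fun y => G y j l) x + partial j (fun y => G y i l) x
     - partial l (fun y => G y i j) x).

(* k-th component of the covariant derivative of X along the i-th
   coordinate field *)
Definition covd (X : vfield R) i k x : R :=
  partial i (fun y => X y 0 k) x + \sum_j christoffel k i j x * X x 0 j.

(* R(d_i, d_j) d_k = \sum_l riemann l i j k *: d_l, with
   R(X, Y) = [nabla_X, nabla_Y] - nabla_[X, Y] *)
Definition riemann l i j k x : R :=
  partial i (christoffel l j k) x - partial j (christoffel l i k) x
  + \sum_m (christoffel l i m x * christoffel m j k x
            - christoffel l j m x * christoffel m i k x).

(* rho(Y, Z) = tr (X |-> R(X, Y) Z), positive on round spheres *)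
Definition ricci j k x : R := \sum_i riemann i i j k x.

(* (nabla_{d_m} R)^l for the arguments d_i, d_j, d_k *)
Definition nabla_riemann m l i j k x : R :=
  partial m (riemann l i j k) x
  + \sum_a (christoffel l m a x * riemann a i j k x
            - christoffel a m i x * riemann l a j k x
            - christoffel a m j x * riemann l i a k x
            - christoffel a m k x * riemann l i j a x).

Definition grad (f : coords R -> R) : vfield R :=
  fun x => \row_k \sum_l invmx (G x) k l * partial l f x.

Definition hess (f : coords R -> R) i j x : R :=
  \sum_k covd (grad f) i k x * G x k j.

Definition laplacian (f : coords R -> R) x : R :=
  \sum_i \sum_j invmx (G x) i j * hess f i j x.

Definition parallel_at (X : vfield R) x : Prop :=
  forall i k, covd X i k x = 0.

Definition curv_at x (X Y Z : coords R) : coords R :=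
  \row_l \sum_i \sum_j \sum_k riemann l i j k x * X 0 i * Y 0 j * Z 0 k.

Definition nabla_curv_at x (W X Y Z : coords R) : coords R :=
  \row_l \sum_m \sum_i \sum_j \sum_k
    nabla_riemann m l i j k x * W 0 m * X 0 i * Y 0 j * Z 0 k.

End Coordinates.

(** * Smooth 3-manifolds *)

(* [cmap] is meaningful on [cdom] only, and [cinv] on the image of [cdom]. *)
Record chart (R : realType) (M : topologicalType) := Chart {
  cdom : set M;
  cmap : M -> coords R;
  cinv : coords R -> M;
  open_cdom : open cdom;
  open_cimg : open (cmap @` cdom);
  cmapK : forall p, cdom p -> cinv (cmap p) = p;
  continuous_cmap : forall p, cdom p -> {for p, continuous cmap};
  continuous_cinv :
    forall x, (cmap @` cdom) x -> {for x, continuous cinv} }.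

Definition cimg (R : realType) (M : topologicalType) (c : chart R M) :
    set (coords R) :=
  cmap c @` cdom c.

Definition overlap (R : realType) (M : topologicalType) (c d : chart R M) :
    set (coords R) :=
  cmap c @` (cdom c `&` cdom d).

Definition transition (R : realType) (M : topologicalType) (c d : chart R M) :
    vfield R :=
  fun x => cmap d (cinv c x).

Definition smooth_transition (R : realType) (M : topologicalType)
    (c d : chart R M) : Prop :=
  forall j : 'I_3, smooth_on (overlap c d) (fun x => transition c d x 0 j).

(* maximal smooth atlas: its members are the local coordinate systems of M *)
Record smooth_structure (R : realType) (M : topologicalType) := SmoothStr {
  atlas : set (chart R M);
  atlas_cover : forall p : M, exists2 c, atlas c & cdom c p;
  atlas_compat : forall c d, atlas c -> atlas d -> smooth_transition c d;
  atlas_max : forall c : chart R M,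
    (forall d, atlas d -> smooth_transition c d /\ smooth_transition d c) ->
    atlas c }.

(* row-vector convention: components transform by v |-> v *m jac c d x *)
Definition jac (R : realType) (M : topologicalType) (c d : chart R M)
    (x : coords R) : 'M[R]_3 :=
  \matrix_(i, j) partial i (fun y => transition c d y 0 j) x.

Section Manifold.
Variables (R : realType) (M : topologicalType) (S : smooth_structure R M).

(* Pointwise conditions on tensors are imposed in every local coordinate
   system around the point; the ones used below are invariant under changes
   of coordinates, so that a single system around each point would do. *)
Definition in_charts_at (p : M) (P : chart R M -> coords R -> Prop) : Prop :=
  forall c, atlas S c -> cdom c p -> P c (cmap c p).

Definition in_charts (P : chart R M -> coords R -> Prop) : Prop :=
  forall p, in_charts_at p P.

Definition local_expr (h : M -> R) (c : chart R M) : coords R -> R :=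
  fun x => h (cinv c x).

Definition smooth_function (h : M -> R) : Prop :=
  forall c, atlas S c -> smooth_on (cimg c) (local_expr h c).

(* A tensor field is the family of its components in the charts of M, related
   on overlaps by the tensor transformation law. *)
Definition smooth_vfield (X : chart R M -> vfield R) : Prop :=
  (forall c, atlas S c ->
     forall j : 'I_3, smooth_on (cimg c) (fun x => X c x 0 j)) /\
  (forall c d, atlas S c -> atlas S d -> forall x, overlap c d x ->
     X d (transition c d x) = X c x *m jac c d x).

Definition lorentz_metric (g : chart R M -> tensor2 R) : Prop :=
  [/\ forall c, atlas S c ->
        forall i j : 'I_3, smooth_on (cimg c) (fun x => g c x i j),
      forall c d, atlas S c -> atlas S d -> forall x, overlap c d x ->
        g c x = jac c d x *m g d (transition c d x) *m (jac c d x)^T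
    & in_charts (fun c x => lorentzian_at (g c) x)].

Definition spacetime (g : chart R M -> tensor2 R) : Prop :=
  [/\ hausdorff_space M, @second_countable M, connected [set: M]
    & lorentz_metric g].

Section Waves.
Variable g : chart R M -> tensor2 R.

Definition orth (V : chart R M -> vfield R) (c : chart R M) (x X : coords R) :
    Prop :=
  inner (g c) x (V c x) X = 0.

Definition pp_field (V : chart R M -> vfield R) : Prop :=
  smooth_vfield V /\
  in_charts (fun c x =>
    [/\ V c x != 0, inner (g c) x (V c x) (V c x) = 0,
        parallel_at (g c) (V c) x
      & forall X Y Z, orth V c x X -> orth V c x Y ->
          curv_at (g c) x X Y Z = 0]).

Definition pp_wave : Prop := spacetime g /\ exists V, pp_field V.

Definition plane_wave : Prop :=
  spacetime g /\
  exists2 V, pp_field V &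
    in_charts (fun c x => forall W X Y Z, orth V c x W ->
      nabla_curv_at (g c) x W X Y Z = 0).

Definition nonflat_at (p : M) : Prop :=
  in_charts_at p (fun c x => exists X Y Z, curv_at (g c) x X Y Z != 0).

(* h rho - Hes_h + (Delta h + Lambda) g = 0 *)
Definition field_equation (h : M -> R) (Lambda : R) : Prop :=
  in_charts (fun c x => forall i j : 'I_3,
    local_expr h c x * ricci (g c) i j x - hess (g c) (local_expr h c) i j x
    + (laplacian (g c) (local_expr h c) x + Lambda) * g c x i j = 0).

Definition grad_norm2 (h : M -> R) (c : chart R M) (x : coords R) : R :=
  inner (g c) x (grad (g c) (local_expr h c) x) (grad (g c) (local_expr h c) x).

(* the causal character is that of the nonzero values of the gradient *)
Definition lightlike_grad (h : M -> R) : Prop :=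
  in_charts (fun c x =>
    grad (g c) (local_expr h c) x != 0 -> grad_norm2 h c x = 0).

Definition spacelike_grad (h : M -> R) : Prop :=
  in_charts (fun c x =>
    grad (g c) (local_expr h c) x != 0 -> 0 < grad_norm2 h c x).

End Waves.
End Manifold.

Definition nowhere_locally_constant (R : realType) (M : topologicalType)
    (h : M -> R) : Prop :=
  forall O : set M, open O -> O !=set0 ->
    ~ exists a : R, forall p, O p -> h p = a.

(** * The metrics dv (2 du + F dv) + dx^2 in coordinates (u, v, x) *)

Definition vc (R : realType) (y : coords R) : R := y 0 1.
Definition xc (R : realType) (y : coords R) : R := y 0 2%:R.

Definition brinkmann (R : realType) (F : R) : 'M[R]_3 :=
  \matrix_(i, j) nth 0 (nth [::] [:: [:: 0; 1; 0];
                                     [:: 1; F; 0];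
                                     [:: 0; 0; 1]] i) j.

Section NormalForms.
Variables (R : realType) (M : topologicalType).
Variables (g : chart R M -> tensor2 R) (h : M -> R) (c : chart R M).

Definition lightlike_form : Prop :=
  exists alpha : R -> R,
    smooth1_on (@vc R @` cimg c) alpha /\
    let alpha'' := derive1n 2 alpha in
    forall y, cimg c y ->
      let v := vc y in let x := xc y in
      [/\ alpha'' v != 0, local_expr h c y = alpha v
        & g c y = brinkmann (- (alpha'' v / alpha v) * x ^+ 2)].

Definition spacelike_form : Prop :=
  exists (gamma1 : R) (gamma0 alpha beta : R -> R),
    [/\ gamma1 != 0,
        smooth1_on (@vc R @` cimg c) gamma0,
        smooth1_on (@vc R @` cimg c) alpha,
        smooth1_on (@vc R @` cimg c) beta
      & let gamma0'' := derive1n 2 gamma0 in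
        forall y, cimg c y ->
          let v := vc y in let x := xc y in
          [/\ gamma1 * alpha v + 2 * gamma0 v * gamma0'' v != 0,
              local_expr h c y = gamma1 * x + gamma0 v
            & g c y = brinkmann
                ((gamma1 * alpha v + 2 * gamma0 v * gamma0'' v)
                   * ln (gamma0 v + gamma1 * x) / gamma1 ^+ 2
                 - 2 * x * gamma0'' v / gamma1 + beta v)]].

End NormalForms.

(* Main.v *)
Require Import Defs.
From HB Require Import structures.
From mathcomp Require Import all_boot all_order all_algebra fingroup perm.
From mathcomp Require Import all_classical all_reals all_analysis.
From mathcomp Require Import ring lra.
Import Order.TTheory GRing.Theory Num.Theory.
Import numFieldNormedType.Exports.
Local Open Scope classical_set_scope.
Local Open Scope ring_scope.

Set Implicit Arguments.
Unset Strict Implicit.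
Unset Printing Implicit Defensive.


(** Around each point a pp-wave has Brinkmann coordinates, in which V is d/du and
    g = dv (2 du + F dv) + dx^2 with F independent of u ([brinkmann_chart]).  They
    come from two consequences of the equation nabla V = 0: the 1-form theta dual to
    V is closed, and V is Killing.  A primitive of theta is the coordinate v; on the
    leaves of v the degenerate metric is the square of a closed 1-form, whose
    primitive is x; and u is adjusted by quadratures.

    In these coordinates the only curvature is F_xx, and the field equation says
    h_uu = h_ux = 0, h_uv = h_xx = - Lambda / 2, h_vx = F_x h_u / 2 together with one
    equation for h_vv ([field_brinkmann]).  Differentiating the formula for h_vx in x
    gives F_xx h_u = 0.  Hence h_u = 0 on an open set around a non-flat point, so that
    h_uv = 0 and Lambda = 0 ([Lambda0]).  Now h_u = dh(V) and then h_x have vanishing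
    derivatives in each Brinkmann chart; both dh(V) and g(grad h, grad h) = h_x^2 do
    not depend on the chart, and M is connected, so that dh(V) = 0 everywhere and
    g(grad h, grad h) is a nonnegative constant ([hV0], [grad_norm2_const]).  The sign
    of this constant separates the two cases; what remains of the field equation is
    h_vv + F_x h_x / 2 = - h F_xx / 2.

    If the constant is positive, h = gamma1 x + gamma0(v) with gamma1 <> 0, and the
    remaining equation says that the x-derivative of h F_x + 2 gamma0'' x is zero.
    Calling this function of v alpha and integrating once more in x yields the
    logarithm ([spacelike_normal_form]).

    If the constant is zero, h = alpha(v) and F is a quadratic polynomial in x with
    leading coefficient - alpha'' / alpha.  The substitution x -> x - xi(v),
    followed by u -> u + xi'(v) x - mu(v), removes the lower order terms, when xi
    solves a linear second order equation and mu is a quadrature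
    ([shear_functions], [lightlike_chart]).

    That the metric is then a plane wave is a statement about all charts, and it is
    proved in an arbitrary one.  The curvature annihilates V, which makes it a
    multiple f of a tensor built algebraically from g and V; the Ricci tensor, known
    from the field equation, identifies the factor ([curvature_of_ricci]).  As g and V
    are parallel, the covariant derivative of the curvature is df times this tensor
    ([nabla_wave]), and df is a multiple of theta because f is a function of v
    ([local_curvature]). *)

(** * Coordinate lines and cubes *)

Section Coordinates.
Variable R : realType.
Implicit Types (x y p : coords R) (i j : 'I_3) (f : coords R -> R).

Lemma sum3 (V : nmodType) (F : 'I_3 -> V) :
  \sum_i F i = F 0 + F 1 + F 2%:R.
Proof.
rewrite !big_ord_recr big_ord0 /= add0r.
by congr (F _ + F _ + F _); apply/val_inj.
Qed.

Lemma all3 (P : 'I_3 -> Prop) : P 0 -> P 1 -> P 2%:R -> forall i, P i.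
Proof.
move=> P0 P1 P2 [[|[|[|//]]] ?].
- by rewrite (_ : Ordinal _ = 0) //; apply/val_inj.
- by rewrite (_ : Ordinal _ = 1) //; apply/val_inj.
- by rewrite (_ : Ordinal _ = 2%:R) //; apply/val_inj.
Qed.

Definition setc i (t : R) x : coords R := \row_j (if j == i then t else x 0 j).

Lemma setcE i t x j : setc i t x 0 j = if j == i then t else x 0 j.
Proof. by rewrite mxE. Qed.

Lemma setc_same i t x : setc i t x 0 i = t.
Proof. by rewrite setcE eqxx. Qed.

Lemma setc_id i x : setc i (x 0 i) x = x.
Proof. by apply/rowP => j; rewrite setcE; case: eqP => // ->. Qed.

Lemma setc_setc i s t x : setc i s (setc i t x) = setc i s x.
Proof. by apply/rowP => j; rewrite !setcE; case: eqP. Qed.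

Lemma setcC i j s t x : i != j ->
  setc i s (setc j t x) = setc j t (setc i s x).
Proof.
move=> ij; apply/rowP => k; rewrite !setcE.
by case: eqP => // ->; rewrite (negbTE ij).
Qed.

Lemma setc_shift i t h x :
  setc i (h + t) x = h *: delta_mx 0 i + setc i t x.
Proof.
apply/rowP => j; rewrite !mxE; case: eqP => _ /=.
  by rewrite mulr1.
by rewrite mulr0 add0r.
Qed.

Lemma slice_quotient f i t x :
  (fun h => h^-1 *: (((fun s => f (setc i s x)) \o shift t) (h *: 1) -
     f (setc i t x)))
  = (fun h => h^-1 *: ((f \o shift (setc i t x)) (h *: delta_mx 0 i) -
     f (setc i t x))).
Proof. by apply/funext => h; rewrite /= -setc_shift /GRing.scale /= mulr1. Qed.

(** Restriction to coordinate lines brings one-variable calculus to bear on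
    [partial]. *)
Lemma derivable_slice f i t x :
  derivable f (setc i t x) (delta_mx 0 i) <->
  derivable (fun s => f (setc i s x)) t 1.
Proof. by rewrite /derivable -slice_quotient. Qed.

Lemma derive_slice f i t x :
  'D_1 (fun s => f (setc i s x)) t = partial i f (setc i t x).
Proof. by rewrite /partial /derive -slice_quotient. Qed.

Lemma is_derive_slice f i t x :
  derivable f (setc i t x) (delta_mx 0 i) ->
  is_derive t 1 (fun s => f (setc i s x)) (partial i f (setc i t x)).
Proof.
move=> /derivable_slice df; apply: DeriveDef => //; exact: derive_slice.
Qed.

(** Cubes serve as neighbourhoods because they contain the segments along which
    the coordinates of a point are moved one at a time. *)
Definition cube p (r : R) : set (coords R) :=
  [set x | forall j, `|x 0 j - p 0 j| < r].

Lemma cube_ball p r : 0 < r -> cube p r = ball p r.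
Proof.
move=> r0; apply/seteqP; split => x /=.
  by move=> xp; split=> // i j; rewrite ord1 /ball /= distrC.
by move=> [_ xp] j; have := xp 0 j; rewrite /ball /= distrC.
Qed.

Lemma cube_center p r : 0 < r -> cube p r p.
Proof. by move=> r0 j; rewrite subrr normr0. Qed.

Lemma open_cube p r : open (cube p r).
Proof.
have [r0|r0] := ltP 0 r; first by rewrite cube_ball //; exact: ball_open.
rewrite (_ : cube p r = set0); first exact: open0.
apply/seteqP; split => x //= /(_ 0) h.
by have := le_lt_trans (normr_ge0 _) h; rewrite ltNge r0.
Qed.

Lemma nbhs_cube p r : 0 < r -> nbhs p (cube p r).
Proof. by move=> r0; rewrite cube_ball //; exact: nbhsx_ballx. Qed.

Lemma nbhs_sub_cube p (U : set (coords R)) : nbhs p U ->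
  exists2 r, 0 < r & cube p r `<=` U.
Proof.
by move=> /nbhs_ballP[r /= r0 rU]; exists r => //; rewrite cube_ball.
Qed.

Lemma open_sub_cube p (U : set (coords R)) : open U -> U p ->
  exists2 r, 0 < r & cube p r `<=` U.
Proof. by move=> oU Up; apply: nbhs_sub_cube; exact: open_nbhs_nbhs. Qed.

Lemma subcube p r r' : r <= r' -> cube p r `<=` cube p r'.
Proof. by move=> rr x xp j; exact: lt_le_trans (xp j) rr. Qed.

Lemma cube_setc p r i t x : cube p r x -> `|t - p 0 i| < r ->
  cube p r (setc i t x).
Proof. by move=> xp tp j; rewrite setcE; case: eqP => [->|]. Qed.

Lemma continuous_coord j x : {for x, continuous (fun y : coords R => y 0 j)}.
Proof. exact: coord_continuous. Qed.

Lemma continuous_coordsP (T : topologicalType) (F : set_system T)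
    {FF : Filter F} (g : T -> coords R) p :
  (forall j, (fun t => g t 0 j) @ F --> p 0 j) <-> (g @ F --> p).
Proof.
split=> [gj|gp j].
  apply/cvgrPdist_lt => e e0; near=> t.
  have : cube p e (g t).
    move=> j; move: j; near: t; apply: filter_forall => /= j.
    have /cvgrPdist_lt/(_ _ e0) := gj j.
    by apply: filterS => t; rewrite distrC.
  by rewrite cube_ball // -ball_normE.
by apply: (cvg_comp g (fun y : coords R => y 0 j) gp); exact: coord_continuous.
Unshelve. all: by end_near. Qed.

Lemma continuous_setc i (g : coords R -> R) x :
  {for x, continuous g} -> {for x, continuous (fun y => setc i (g y) y)}.
Proof.
move=> gx; apply/(@continuous_coordsP _ (nbhs x)) => j; rewrite setcE.
rewrite (_ : (fun t => _) = (fun t => if j == i then g t else t 0 j)); last first.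
  by apply/funext => t; rewrite setcE.
by case: eqP => // _; exact: continuous_coord.
Qed.

Lemma continuous_setc1 i x t : {for t, continuous (fun s => setc i s x)}.
Proof.
apply/(@continuous_coordsP _ (nbhs t)) => j; rewrite setcE.
rewrite (_ : (fun t => _) = (fun t => if j == i then t else x 0 j)); last first.
  by apply/funext => s; rewrite setcE.
by case: eqP => // _; exact: cvg_cst.
Qed.

End Coordinates.

(** * Mean values *)

Section MeanValue.
Variable R : realType.
Implicit Types (x y p : coords R) (i j : 'I_3) (f : coords R -> R).

Lemma derivable_cont (f : R -> R) t : derivable f t 1 -> {for t, continuous f}.
Proof. by move=> /derivable1_diffP; exact: differentiable_continuous. Qed.

Lemma between_ball (a r s t xi : R) : `|s - a| < r -> `|t - a| < r ->
  Num.min s t <= xi <= Num.max s t -> `|xi - a| < r.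
Proof.
rewrite !ltr_distl => /andP[s1 s2] /andP[t1 t2] /andP[].
rewrite ge_min le_max.
by move=> /orP[] h1 /orP[] h2; apply/andP; split; lra.
Qed.

Lemma mvt_between (f : R -> R) (s t : R) :
  (forall u, Num.min s t <= u <= Num.max s t -> derivable f u 1) ->
  exists2 xi, Num.min s t <= xi <= Num.max s t &
    f t - f s = 'D_1 f xi * (t - s).
Proof.
move=> df.
have aux (a b : R) : a <= b -> (forall u, a <= u <= b -> derivable f u 1) ->
    exists2 xi, a <= xi <= b & f b - f a = 'D_1 f xi * (b - a).
  move=> ab dfab.
  have [|u uab|xi] := @MVT_segment R f (fun u => 'D_1 f u) a b ab.
  - move=> u; rewrite in_itv /= => /andP[au ub].
    by apply/derivableP/dfab; rewrite !ltW.
  - apply: continuous_in_subspaceT uab => z.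
    by rewrite inE /= in_itv /= => /dfab/derivable_cont.
  by rewrite in_itv /= => xiab ->; exists xi.
have [st|ts] := leP s t.
  have [|xi xist ->] := aux s t st.
    by move=> u; rewrite -{1}(min_l st) -{2}(max_r st); exact: df.
  by exists xi.
have [|xi xist e] := aux t s (ltW ts).
  by move=> u; rewrite -{1}(min_r (ltW ts)) -{2}(max_l (ltW ts)); exact: df.
exists xi => //.
by rewrite -(opprB (f s)) e; ring.
Qed.

Lemma cube_line p r i (s t xi : R) x :
  cube p r (setc i s x) -> cube p r (setc i t x) ->
  Num.min s t <= xi <= Num.max s t -> cube p r (setc i xi x).
Proof.
move=> ps pt h.
have := ps i; rewrite setc_same => ps'; have := pt i; rewrite setc_same => pt'.
rewrite -(setc_setc i xi t); apply: cube_setc => //.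
exact: between_ball ps' pt' h.
Qed.

Lemma mvt_line f p r i (s t : R) x :
  (forall y, cube p r y -> derivable f y (delta_mx 0 i)) ->
  cube p r (setc i s x) -> cube p r (setc i t x) ->
  exists2 xi, Num.min s t <= xi <= Num.max s t &
    f (setc i t x) - f (setc i s x) = partial i f (setc i xi x) * (t - s).
Proof.
move=> df ps pt.
have [|xi hxi ->] := @mvt_between (fun s => f (setc i s x)) s t.
  by move=> u hu; apply/derivable_slice/df; exact: cube_line hu.
by exists xi => //; rewrite derive_slice.
Qed.

Lemma indep_line f p r i : 
  (forall y, cube p r y -> derivable f y (delta_mx 0 i)) ->
  (forall y, cube p r y -> partial i f y = 0) ->
  forall s t x, cube p r (setc i s x) -> cube p r (setc i t x) ->
  f (setc i s x) = f (setc i t x).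
Proof.
move=> df d0 s t x ps pt.
have [xi hxi] := mvt_line df ps pt.
rewrite d0 ?mul0r; last exact: cube_line hxi.
by move=> /subr0_eq.
Qed.

Lemma indep_cube f p r i x t : 
  (forall y, cube p r y -> derivable f y (delta_mx 0 i)) ->
  (forall y, cube p r y -> partial i f y = 0) ->
  cube p r x -> `|t - p 0 i| < r -> f (setc i t x) = f x.
Proof.
move=> df d0 px tr; rewrite -[in RHS](setc_id i x).
by apply: (indep_line df d0); rewrite ?setc_id //; exact: cube_setc.
Qed.

End MeanValue.
(** * Functions of class C^n *)

Section Ck.
Variable R : realType.
Implicit Types (x y p : coords R) (i j : 'I_3) (f g : coords R -> R).
Implicit Types (U W : set (coords R)).

Fixpoint ck (n : nat) U f : Prop :=
  match n with
  | 0 => forall x, U x -> {for x, continuous f}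
  | n'.+1 => [/\ forall x, U x -> {for x, continuous f},
      forall i x, U x -> derivable f x (delta_mx 0 i)
      & forall i, ck n' U (partial i f)]
  end.

Lemma ck_cont n U f x : ck n U f -> U x -> {for x, continuous f}.
Proof. by case: n => [|n] /= => [h|[h _ _]]; exact: h. Qed.

Lemma ck_le m n U f : (m <= n)%N -> ck n U f -> ck m U f.
Proof.
elim: m n f => [|m IH] [|n] f //= mn; first by case.
by case=> h1 h2 h3; split=> // i; exact: IH (h3 i).
Qed.

(** [smooth_on] quantifies over all iterated partial derivatives at once;
    [ck] peels them off one at a time, which is what inductions need. *)
Lemma smooth_onP U f : smooth_on U f <-> forall n, ck n U f.
Proof.
split=> [+ n|].
  elim: n f => [|n IH] f sf /=; first by move=> x Ux; case: (sf [::] x Ux).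
  split=> [x Ux|i x Ux|i].
  - by case: (sf [::] x Ux).
  - by case: (sf [::] x Ux).
  - apply: IH => s x Ux.
    by have := sf (rcons s i) x Ux; rewrite foldr_rcons.
move=> h s; elim/last_ind: s f h => [|s i IH] f h x Ux /=.
  by have [/= h1 h2 _] := h 1%N; split=> [|i]; [exact: h1 | exact: h2].
rewrite foldr_rcons; apply: IH => // n.
by have [_ _ /(_ i)] := h n.+1.
Qed.

Lemma smooth_ck n U f : smooth_on U f -> ck n U f.
Proof. by move=> /smooth_onP. Qed.

Lemma smooth_cont U f x : smooth_on U f -> U x -> {for x, continuous f}.
Proof. by move=> sf; apply: (@ck_cont 0); exact: smooth_ck. Qed.

Lemma smooth_derivable U f i x : smooth_on U f -> U x ->
  derivable f x (delta_mx 0 i).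
Proof. by move=> sf; have [_ h _] := smooth_ck 1 sf; exact: h. Qed.

Lemma smooth_partial U f i : smooth_on U f -> smooth_on U (partial i f).
Proof.
by move=> sf; apply/smooth_onP => n; have [_ _] := smooth_ck n.+1 sf; apply.
Qed.

Lemma smooth_sub U W f : W `<=` U -> smooth_on U f -> smooth_on W f.
Proof. by move=> WU sf s x /WU; exact: sf. Qed.

Lemma near_open U x (P : coords R -> Prop) : open U -> U x ->
  (forall y, U y -> P y) -> \forall y \near x, P y.
Proof. by move=> oU Ux UP; apply: (filterS UP); exact: open_nbhs_nbhs. Qed.

Lemma eq_partial U f g i : open U -> (forall x, U x -> f x = g x) ->
  forall x, U x -> partial i f x = partial i g x.
Proof. by move=> oU fg x Ux; apply: near_eq_derive;
  exact: (@near_open U x (fun y => f y = g y)). Qed.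

Lemma eq_derivable U f g i : open U -> (forall x, U x -> f x = g x) ->
  forall x, U x -> derivable f x (delta_mx 0 i) ->
  derivable g x (delta_mx 0 i).
Proof. by move=> oU fg x Ux; apply: near_eq_derivable;
  exact: (@near_open U x (fun y => f y = g y)). Qed.

Lemma eq_cont U f g : open U -> (forall x, U x -> f x = g x) ->
  forall x, U x -> {for x, continuous f} -> {for x, continuous g}.
Proof.
move=> oU fg x Ux; rewrite /prop_for /continuous_at -(fg x Ux) => fx.
have h : {near x, f =1 g} by exact: (@near_open U x (fun y => f y = g y)).
exact: cvg_trans (near_eq_cvg h) fx.
Qed.

Lemma eq_ck n U f g : open U -> (forall x, U x -> f x = g x) ->
  ck n U f -> ck n U g.
Proof.
move=> oU; elim: n f g => [|n IH] f g fg /=.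
  by move=> h x Ux; apply: (eq_cont oU fg Ux); exact: h.
move=> [h1 h2 h3]; split=> [x Ux|i x Ux|i].
- by apply: (eq_cont oU fg Ux); exact: h1.
- by apply: (eq_derivable oU fg Ux); exact: h2.
- by apply: IH (h3 i); exact: eq_partial.
Qed.

Lemma eq_smooth U f g : open U -> (forall x, U x -> f x = g x) ->
  smooth_on U f -> smooth_on U g.
Proof.
by move=> oU fg /smooth_onP sf; apply/smooth_onP => n; exact: eq_ck (sf n).
Qed.

Lemma partialD f g i x : derivable f x (delta_mx 0 i) ->
  derivable g x (delta_mx 0 i) ->
  partial i (fun y => f y + g y) x = partial i f x + partial i g x.
Proof. exact: deriveD. Qed.

Lemma partialN f i x : derivable f x (delta_mx 0 i) ->
  partial i (fun y => - f y) x = - partial i f x.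
Proof. exact: deriveN. Qed.

Lemma partialB f g i x : derivable f x (delta_mx 0 i) ->
  derivable g x (delta_mx 0 i) ->
  partial i (fun y => f y - g y) x = partial i f x - partial i g x.
Proof. exact: deriveB. Qed.

Lemma partialM f g i x : derivable f x (delta_mx 0 i) ->
  derivable g x (delta_mx 0 i) ->
  partial i (fun y => f y * g y) x = f x * partial i g x + g x * partial i f x.
Proof. exact: deriveM. Qed.

Lemma partial_cst (a : R) i x : partial i (fun=> a) x = 0.
Proof. exact: derive_cst. Qed.

Lemma partialV f i x : f x != 0 -> derivable f x (delta_mx 0 i) ->
  partial i (fun y => (f y)^-1) x = - (f x)^-2 * partial i f x.
Proof. exact: deriveV. Qed.

Lemma is_derive_coord i j x :
  is_derive x (delta_mx 0 i) (fun y : coords R => y 0 j) (i == j)%:R.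
Proof.
have e : (fun s => setc i s x 0 j) = (if j == i then id else cst (x 0 j)).
  by apply/funext => s; rewrite setcE; case: eqP.
have h1 := @derivable_slice _ (fun y => y 0 j) i (x 0 i) x.
have h2 := @derive_slice _ (fun y => y 0 j) i (x 0 i) x.
rewrite setc_id e in h1 h2.
split.
  by apply/h1; case: eqP => _; [exact: derivable_id | exact: derivable_cst].
rewrite -[LHS]h2 eq_sym; case: eqP => _; first by rewrite derive_id.
by rewrite derive_cst.
Qed.

Lemma partial_coord i j x : partial i (fun y : coords R => y 0 j) x = (i == j)%:R.
Proof. by have [] := is_derive_coord i j x. Qed.

Lemma derivable_coord i j x :
  derivable (fun y : coords R => y 0 j) x (delta_mx 0 i).
Proof. by have [] := is_derive_coord i j x. Qed.

Lemma ck_cst n U (a : R) : ck n U (fun=> a).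
Proof.
elim: n a => [|n IH] a /=; first by move=> x _; exact: cst_continuous.
split=> [x _|i x _|i]; [exact: cst_continuous | exact: (derivable_cst a) |].
by rewrite (_ : partial i _ = fun=> 0) //; apply/funext => x; exact: partial_cst.
Qed.

Lemma ck_coord n U j : ck n U (fun y : coords R => y 0 j).
Proof.
case: n => [|n] /=; first by move=> x _; exact: continuous_coord.
split=> [x _|i x _|i]; [exact: continuous_coord | exact: derivable_coord |].
rewrite (_ : partial i _ = fun=> (i == j)%:R); first exact: ck_cst.
by apply/funext => x; exact: partial_coord.
Qed.

Lemma ckD n U f g : open U -> ck n U f -> ck n U g -> ck n U (fun x => f x + g x).
Proof.
move=> oU; elim: n f g => [|n IH] f g /=.
  by move=> cf cg x Ux; apply: continuousD; [exact: cf | exact: cg].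
move=> [cf df pf] [cg dg pg]; split=> [x Ux|i x Ux|i].
- by apply: continuousD; [exact: cf | exact: cg].
- by apply: derivableD; [exact: df | exact: dg].
- apply: eq_ck oU _ (IH _ _ (pf i) (pg i)) => x Ux.
  by rewrite partialD //; [exact: df | exact: dg].
Qed.

Lemma ckM n U f g : open U -> ck n U f -> ck n U g -> ck n U (fun x => f x * g x).
Proof.
move=> oU; elim: n f g => [|n IH] f g /=.
  by move=> cf cg x Ux; apply: continuousM; [exact: cf | exact: cg].
move=> sf sg.
have [cf df pf] := sf; have [cg dg pg] := sg; split=> [x Ux|i x Ux|i].
- by apply: continuousM; [exact: cf | exact: cg].
- by apply: derivableM; [exact: df | exact: dg].
- have cf' : ck n U f by apply: (@ck_le n n.+1).
  have cg' : ck n U g by apply: (@ck_le n n.+1).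
  apply: eq_ck oU _ (ckD oU (IH _ _ cf' (pg i)) (IH _ _ cg' (pf i))) => x Ux.
  by rewrite partialM //; [exact: df | exact: dg].
Qed.

Lemma ckN n U f : open U -> ck n U f -> ck n U (fun x => - f x).
Proof.
move=> oU cf; apply: eq_ck oU _ (ckM oU (ck_cst n U (-1)) cf) => x _.
by rewrite mulN1r.
Qed.

Lemma ckV n U f : open U -> (forall x, U x -> f x != 0) -> ck n U f ->
  ck n U (fun x => (f x)^-1).
Proof.
move=> oU f0; elim: n => [|n IH] /=.
  by move=> cf x Ux; apply: continuousV; [exact: f0 | exact: cf].
move=> sf.
have [cf df pf] := sf; split=> [x Ux|i x Ux|i].
- by apply: continuousV; [exact: f0 | exact: cf].
- by apply: derivableV; [exact: f0 | exact: df].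
- have IH' : ck n U (fun x => (f x)^-1) by apply: IH; apply: (@ck_le n n.+1).
  apply: eq_ck oU _ (ckN oU (ckM oU (ckM oU IH' IH') (pf i))) => x Ux.
  rewrite partialV //; [| exact: f0 | exact: df].
  by rewrite mulNr -invfM -expr2.
Qed.

Lemma smooth_cst U (a : R) : smooth_on U (fun=> a).
Proof. by apply/smooth_onP => n; exact: ck_cst. Qed.

Lemma smooth_coord U j : smooth_on U (fun y : coords R => y 0 j).
Proof. by apply/smooth_onP => n; exact: ck_coord. Qed.

Lemma smoothD U f g : open U -> smooth_on U f -> smooth_on U g ->
  smooth_on U (fun x => f x + g x).
Proof.
by move=> oU /smooth_onP sf /smooth_onP sg; apply/smooth_onP => n; exact: ckD.
Qed.

Lemma smoothM U f g : open U -> smooth_on U f -> smooth_on U g ->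
  smooth_on U (fun x => f x * g x).
Proof.
by move=> oU /smooth_onP sf /smooth_onP sg; apply/smooth_onP => n; exact: ckM.
Qed.

Lemma smoothN U f : open U -> smooth_on U f -> smooth_on U (fun x => - f x).
Proof. by move=> oU /smooth_onP sf; apply/smooth_onP => n; exact: ckN. Qed.

Lemma smoothB U f g : open U -> smooth_on U f -> smooth_on U g ->
  smooth_on U (fun x => f x - g x).
Proof. by move=> oU sf sg; apply: smoothD => //; exact: smoothN. Qed.

Lemma smoothV U f : open U -> (forall x, U x -> f x != 0) -> smooth_on U f ->
  smooth_on U (fun x => (f x)^-1).
Proof. by move=> oU f0 /smooth_onP sf; apply/smooth_onP => n; exact: ckV. Qed.

Lemma smooth_sum U (I : Type) (s : seq I) (F : I -> coords R -> R) : open U ->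
  (forall a, smooth_on U (F a)) -> smooth_on U (fun x => \sum_(a <- s) F a x).
Proof.
move=> oU sF; elim: s => [|a s IH].
  rewrite (_ : (fun x => _) = fun=> 0); first exact: smooth_cst.
  by apply/funext => x; rewrite big_nil.
rewrite (_ : (fun x => _) = fun x => F a x + \sum_(b <- s) F b x).
  exact: (smoothD oU (sF a) IH).
by apply/funext => x; rewrite big_cons.
Qed.

Lemma partial_val f i x (D : R) :
  is_derive x (delta_mx 0 i) f D -> partial i f x = D.
Proof. by case. Qed.

Lemma smooth_partialD U f g i x : smooth_on U f ->
  smooth_on U g -> U x ->
  partial i (fun y => f y + g y) x = partial i f x + partial i g x.
Proof.
move=> sf sg px.
exact: partialD (smooth_derivable sf px) (smooth_derivable sg px).
Qed.

Lemma smooth_partialB U f g i x : smooth_on U f ->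
  smooth_on U g -> U x ->
  partial i (fun y => f y - g y) x = partial i f x - partial i g x.
Proof.
move=> sf sg px.
exact: partialB (smooth_derivable sf px) (smooth_derivable sg px).
Qed.

Lemma smooth_partialM U f (k : coords R -> R) i x :
  smooth_on U f -> smooth_on U k -> U x ->
  partial i (fun y => f y * k y) x = f x * partial i k x + k x * partial i f x.
Proof.
move=> sf sk Ux.
exact: partialM (smooth_derivable sf Ux) (smooth_derivable sk Ux).
Qed.

Lemma smoothZ U (a : R) f :
  open U -> smooth_on U f -> smooth_on U (fun y => a * f y).
Proof. by move=> oU sf; apply: (smoothM oU _ sf); exact: smooth_cst. Qed.

Lemma smooth_partialZ U (a : R) f i x :
  smooth_on U f -> U x -> partial i (fun y => a * f y) x = a * partial i f x.
Proof.
move=> sf Ux; rewrite (smooth_partialM (f := fun=> a) i (@smooth_cst U a) sf Ux).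
by rewrite partial_cst mulr0 addr0.
Qed.

End Ck.

(** * Increments and the chain rule *)

Section Chain.
Variable R : realType.
Implicit Types (x y p : coords R) (i j : 'I_3) (f g : coords R -> R).
Implicit Types (U W : set (coords R)).

Lemma cont_cubeP f x : {for x, continuous f} <->
  forall e, 0 < e -> exists2 d, 0 < d & forall y, cube x d y -> `|f x - f y| < e.
Proof.
split=> [cf e e0|h].
  by have /(@cvgrPdist_lt _ _ _ (nbhs x))/(_ _ e0)/nbhs_sub_cube := cf.
apply/(@cvgrPdist_lt _ _ _ (nbhs x)) => e /h[d d0 dP].
by apply: filterS dP _; exact: nbhs_cube.
Qed.

(** The value on the hyperplane through x makes the quotient continuous at x. *)
Definition dquot f x i y : R :=
  if y 0 i == x 0 i then partial i f x
  else (f y - f (setc i (x 0 i) y)) / (y 0 i - x 0 i).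

Lemma dquotE f x i y :
  f y - f (setc i (x 0 i) y) = dquot f x i y * (y 0 i - x 0 i).
Proof.
rewrite /dquot; case: eqP => [e|/eqP ne]; last by rewrite divfK // subr_eq0.
by rewrite -e setc_id !subrr mulr0.
Qed.

Lemma dquot_id f x i : dquot f x i x = partial i f x.
Proof. by rewrite /dquot eqxx. Qed.

Lemma dquot_cont U f x i : open U -> ck 1 U f -> U x ->
  {for x, continuous (dquot f x i)}.
Proof.
move=> oU [_ df cf] Ux; apply/cont_cubeP => e e0; rewrite dquot_id.
have /cont_cubeP/(_ _ e0)[d d0 dP] := cf i x Ux.
have [r r0 rU] := open_sub_cube oU Ux.
have m0 : 0 < Num.min d r by rewrite lt_min d0.
exists (Num.min d r) => // y xy; rewrite /dquot.
case: eqP => [_|/eqP ne]; first by rewrite subrr normr0.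
have y1 : cube x (Num.min d r) (setc i (x 0 i) y).
  by apply: cube_setc => //; rewrite subrr normr0.
have y2 : cube x (Num.min d r) (setc i (y 0 i) y) by rewrite setc_id.
have dfc z : cube x (Num.min d r) z -> derivable f z (delta_mx 0 i).
  by move=> xz; apply: df; apply: rU; apply: subcube xz; rewrite ge_min lexx orbT.
have [xi hxi] := mvt_line dfc y1 y2.
rewrite setc_id => ->; rewrite mulfK ?subr_eq0 //.
apply: dP; apply: subcube (cube_line y1 y2 hxi).
by rewrite ge_min lexx.
Qed.

(** A C^1 function has increments [\sum_j q_j y * (y_j - x_j)] with
    coefficients continuous at the base point: change one coordinate at a time
    and use the mean value theorem.  This replaces Frechet differentiability
    in what follows. *)
Lemma C1_increment U f x : open U -> ck 1 U f -> U x ->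
  exists q : 'I_3 -> coords R -> R,
    [/\ forall y, f y - f x = \sum_j q j y * (y 0 j - x 0 j),
        forall j, {for x, continuous (q j)}
      & forall j, q j x = partial j f x].
Proof.
move=> oU cf Ux.
pose m1 y := setc 0 (x 0 0) y; pose m2 y := setc 1 (x 0 1) (m1 y).
have m1x : m1 x = x by rewrite /m1 setc_id.
have m2x : m2 x = x by rewrite /m2 m1x setc_id.
have cm1 : {for x, continuous m1}.
  by apply: (@continuous_setc _ _ (fun=> x 0 0)); exact: cst_continuous.
have cm2 : {for x, continuous m2}.
  apply: (@continuous_comp _ _ _ m1 (fun y => setc 1 (x 0 1) y)) => //.
  by rewrite m1x; apply: (@continuous_setc _ _ (fun=> x 0 1)); exact: cst_continuous.
pose q (j : 'I_3) y := if j == 0 then dquot f x 0 y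
  else if j == 1 then dquot f x 1 (m1 y) else dquot f x 2%:R (m2 y).
exists q; split=> [y||].
- rewrite sum3 /q /=.
  have e0 := dquotE f x 0 y; have e1 := dquotE f x 1 (m1 y).
  have e2 := dquotE f x 2%:R (m2 y).
  have e1' : m1 y 0 1 = y 0 1 by rewrite /m1 setcE.
  have e2' : m2 y 0 2%:R = y 0 2%:R by rewrite /m2 /m1 !setcE.
  have e3 : setc 2%:R (x 0 2%:R) (m2 y) = x.
    by apply/rowP; apply: all3; rewrite /m2 /m1 !setcE.
  rewrite e1' in e1; rewrite e2' e3 in e2.
  by rewrite -e0 -e1 -e2 -/(m1 y) -/(m2 y); ring.
- apply: all3; rewrite /q /=.
  + exact: dquot_cont oU cf Ux.
  + apply: (@continuous_comp _ _ _ m1 (dquot f x 1)) => //.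
    by rewrite m1x; exact: dquot_cont oU cf Ux.
  + apply: (@continuous_comp _ _ _ m2 (dquot f x 2%:R)) => //.
    by rewrite m2x; exact: dquot_cont oU cf Ux.
- by apply: all3; rewrite /q /= ?m1x ?m2x dquot_id.
Qed.

(** Primitives are shown to be continuous in all variables from bounds on their
    partial derivatives. *)
Lemma ck1_cont U f x : open U -> 
  (forall i y, U y -> derivable f y (delta_mx 0 i)) ->
  (exists M, forall i y, U y -> `|partial i f y| <= M) ->
  U x -> {for x, continuous f}.
Proof.
move=> oU df [M pM] Ux; apply/cont_cubeP => e e0.
have [r r0 rU] := open_sub_cube oU Ux.
pose M1 := Num.max M 1.
have M10 : 0 < M1 by rewrite lt_max ltr01 orbT.
pose d := Num.min r (e / (3 * M1)).
have d0 : 0 < d by rewrite lt_min r0 divr_gt0 // mulr_gt0.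
have dfc i z : cube x d z -> derivable f z (delta_mx 0 i).
  by move=> xz; apply/df/rU; apply: subcube xz; rewrite ge_min lexx.
have step i y : cube x d y -> `|f y - f (setc i (x 0 i) y)| < e / 3.
  move=> xy.
  have y1 : cube x d (setc i (x 0 i) y).
    by apply: cube_setc => //; rewrite subrr normr0.
  have y2 : cube x d (setc i (y 0 i) y) by rewrite setc_id.
  have [xi hxi] := mvt_line (dfc i) y1 y2.
  rewrite setc_id => ->; rewrite normrM.
  have : `|partial i f (setc i xi y)| <= M1.
    rewrite le_max pM //; apply: rU; apply: subcube (cube_line y1 y2 hxi).
    by rewrite ge_min lexx.
  move=> h; apply: (@le_lt_trans _ _ (M1 * `|y 0 i - x 0 i|)).
    by rewrite ler_wpM2r.
  rewrite -ltr_pdivlMl //; apply: lt_le_trans (xy i) _.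
  rewrite /d ge_min; apply/orP; right.
  by rewrite invfM mulrC -!mulrA mulrC -!mulrA [e * _]mulrC.
exists d => // y xy.
pose y1 := setc 0 (x 0 0) y; pose y2 := setc 1 (x 0 1) y1.
have xy1 : cube x d y1 by apply: cube_setc => //; rewrite subrr normr0.
have xy2 : cube x d y2 by apply: cube_setc => //; rewrite subrr normr0.
have e3 : setc 2%:R (x 0 2%:R) y2 = x.
  by apply/rowP; apply: all3; rewrite /y2 /y1 !setcE.
have := step 0 y xy; have := step 1 y1 xy1; have := step 2%:R y2 xy2.
rewrite e3 -/y1 -/y2 distrC => h1 h2 h3.
rewrite -opprB normrN.
rewrite (_ : f y - f x = (f y - f y1) + (f y1 - f y2) + (f y2 - f x)); last by ring.
apply: le_lt_trans (ler_normD _ _) _; rewrite distrC in h1.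
have := ler_normD (f y - f y1) (f y1 - f y2).
by move=> h4; lra.
Qed.

(** Divide [C1_increment] by the time step. *)
Lemma is_derive_curve U f (c : R -> coords R) (t : R) (c' : 'I_3 -> R) :
  open U -> ck 1 U f -> U (c t) ->
  (forall j, is_derive t 1 (fun s => c s 0 j) (c' j)) ->
  is_derive t 1 (fun s => f (c s)) (\sum_j c' j * partial j f (c t)).
Proof.
move=> oU cf Ut dc.
have [q [eq cq q0]] := C1_increment oU cf Ut.
have ct : {for t, continuous c}.
  apply/(@continuous_coordsP _ _ (nbhs t)) => j.
  by apply: derivable_cont; case: (dc j).
have /all_sig[k hk] : forall j, {k : R -> R |
    [/\ forall z, c z 0 j - c t 0 j = k z * (z - t), {for t, continuous k}
      & k t = c' j]}.
  by move=> j; apply/cid/is_derive1_caratheodory.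
apply/is_derive1_caratheodory.
exists (fun z => \sum_j q j (c z) * k j z); split.
- move=> z; rewrite eq mulr_suml; apply: eq_bigr => j _.
  by case: (hk j) => -> _ _; rewrite mulrA.
- rewrite (_ : (fun z => _) = fun z => q 0 (c z) * k 0 z + q 1 (c z) * k 1 z
     + q 2%:R (c z) * k 2%:R z); last by apply/funext => z; rewrite sum3.
  have h j : {for t, continuous (fun z => q j (c z) * k j z)}.
    apply: continuousM; last by case: (hk j).
    by apply: (@continuous_comp _ _ _ c (q j)) => //; exact: cq.
  by apply: continuousD; first apply: continuousD.
- by apply: eq_bigr => j _; rewrite q0 mulrC; case: (hk j) => _ _ ->.
Qed.

Lemma is_derive_comp U f (T : coords R -> coords R) i x :
  open U -> ck 1 U f -> U (T x) ->
  (forall j, derivable (fun y => T y 0 j) x (delta_mx 0 i)) ->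
  is_derive x (delta_mx 0 i) (fun y => f (T y))
    (\sum_j partial i (fun y => T y 0 j) x * partial j f (T x)).
Proof.
move=> oU cf Ux dT.
have := @is_derive_curve U f (fun s => T (setc i s x)) (x 0 i)
  (fun j => partial i (fun y => T y 0 j) x) oU cf.
rewrite setc_id => /(_ Ux).
case.
  move=> j; rewrite -[X in partial i _ X](setc_id i x).
  by apply: is_derive_slice; rewrite setc_id.
move=> h1 h2; split.
  by rewrite -[X in derivable _ X](setc_id i x); apply/(@derivable_slice _ (fun y => f (T y))).
rewrite -[X in 'D__ _ X](setc_id i x) -/(partial i _ _).
by rewrite -(@derive_slice _ (fun y => f (T y))) h2.
Qed.

Lemma partial_comp U f (T : coords R -> coords R) i x :
  open U -> ck 1 U f -> U (T x) ->
  (forall j, derivable (fun y => T y 0 j) x (delta_mx 0 i)) ->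
  partial i (fun y => f (T y)) x =
  \sum_j partial i (fun y => T y 0 j) x * partial j f (T x).
Proof. by move=> oU cf Ux dT; case: (is_derive_comp oU cf Ux dT). Qed.

Lemma ck_comp n U W f (T : coords R -> coords R) : open U -> open W ->
  (forall x, W x -> U (T x)) -> (forall j, ck n W (fun y => T y 0 j)) ->
  ck n U f -> ck n W (fun y => f (T y)).
Proof.
move=> oU oW WU; elim: n f => [|n IH] f /= cT.
  move=> cf x Wx; apply: (@continuous_comp _ _ _ T f); last exact/cf/WU.
  by apply/(@continuous_coordsP _ _ (nbhs x)) => j; exact: cT.
move=> sf; have [cf df pf] := sf.
have cT1 : forall j, ck n W (fun y => T y 0 j).
  by move=> j; apply: (@ck_le _ n n.+1) => //; exact: cT.
have c1 : ck 1 U f by apply: (@ck_le _ 1 n.+1).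
have dT i x : W x -> forall j, derivable (fun y => T y 0 j) x (delta_mx 0 i).
  by move=> Wx j; case: (cT j) => _ h _; exact: h.
split=> [x Wx|i x Wx|i].
- apply: (@continuous_comp _ _ _ T f); last exact/cf/WU.
  apply/(@continuous_coordsP _ _ (nbhs x)) => j.
  by case: (cT j) => h _ _; exact: h.
- by have [] := is_derive_comp oU c1 (WU _ Wx) (dT i x Wx).
- have h j : ck n W (fun y => partial i (fun y => T y 0 j) y * partial j f (T y)).
    by apply: ckM => //; [case: (cT j) | exact: IH].
  apply: (eq_ck oW _ (ckD oW (ckD oW (h 0) (h 1)) (h 2%:R))) => x Wx /=.
  by rewrite (partial_comp oU c1 (WU _ Wx) (dT i x Wx)) sum3.
Qed.

Lemma smooth_comp U W f (T : coords R -> coords R) : open U -> open W ->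
  (forall x, W x -> U (T x)) -> (forall j, smooth_on W (fun y => T y 0 j)) ->
  smooth_on U f -> smooth_on W (fun y => f (T y)).
Proof.
move=> oU oW WU sT /smooth_onP sf; apply/smooth_onP => n.
by apply: ck_comp (sf n) => // j; exact: smooth_ck.
Qed.

(** Symmetry of second derivatives: both mixed derivatives are limits of the
    same second difference. *)
Lemma schwarz U f i j x : open U -> ck 2 U f -> U x ->
  partial i (partial j f) x = partial j (partial i f) x.
Proof.
move=> oU cf Ux; have [->//|ij] := eqVneq i j.
have [r r0 rU] := open_sub_cube oU Ux.
apply/eqP; rewrite -subr_eq0 -normr_le0; apply/ler_addgt0Pr => e e0; rewrite add0r.
have e20 : 0 < e / 2 by rewrite divr_gt0.
have main k l : k != l -> \forall s \near (0 : R)^'+,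
    exists2 d, `|partial l (partial k f) x - d| < e / 2 &
    f (setc k (x 0 k + s) (setc l (x 0 l + s) x)) - f (setc k (x 0 k + s) x)
    - (f (setc l (x 0 l + s) x) - f x) = d * s * s.
  move=> kl.
  have [_ df pf] := cf; have [_ dkf pkf] := pf k.
  have /cont_cubeP/(_ _ e20)[d d0 dP] := pkf l x Ux.
  have m0 : 0 < Num.min d r by rewrite lt_min d0.
  near=> s.
  have s0 : 0 < s by near: s; exact: nbhs_right_gt.
  have sm : s < Num.min d r by near: s; exact: nbhs_right_lt.
  have xs (a : 'I_3) : `|x 0 a + s - x 0 a| < Num.min d r.
    by rewrite addrC addKr gtr0_norm.
  have x0 (a : 'I_3) : `|x 0 a - x 0 a| < Num.min d r by rewrite subrr normr0.
  have cU z : cube x (Num.min d r) z -> U z.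
    by move=> xz; apply: rU; apply: subcube xz; rewrite ge_min lexx orbT.
  have cc := cube_center x m0.
  pose phi z := f (setc l (x 0 l + s) z) - f z.
  have cs z : cube x (Num.min d r) z -> cube x (Num.min d r) (setc l (x 0 l + s) z).
    by move=> xz; apply: cube_setc.
  have dphi z : cube x (Num.min d r) z -> is_derive z (delta_mx 0 k) phi
     (partial k f (setc l (x 0 l + s) z) - partial k f z).
    move=> xz.
    have c1 : ck 1 U f by apply: (@ck_le _ 1 2).
    have dT : forall j0, derivable (fun y => setc l (x 0 l + s) y 0 j0) z (delta_mx 0 k).
      move=> j0.
      rewrite (_ : (fun y => _) = if j0 == l then cst (x 0 l + s)
         else (fun y : coords R => y 0 j0)).
        by case: eqP => _; [exact: derivable_cst | exact: derivable_coord].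
      by apply/funext => y; rewrite setcE; case: eqP.
    have Ul : U (setc l (x 0 l + s) z) by apply/cU/cs.
    have h := is_derive_comp oU c1 Ul dT.
    rewrite /phi; apply: is_deriveB; last first.
      by apply/derivableP; apply: df; exact: cU.
    have -> : partial k f (setc l (x 0 l + s) z) =
      \sum_j partial k (fun y => setc l (x 0 l + s) y 0 j) z *
             partial j f (setc l (x 0 l + s) z).
      rewrite (bigD1 k) //= big1 ?addr0.
        rewrite (_ : (fun y => _) = (fun y : coords R => y 0 k)).
          by rewrite partial_coord eqxx mul1r.
        by apply/funext => y; rewrite setcE (negbTE kl).
      move=> j0 j0k.
      rewrite (_ : (fun y => _) = if j0 == l then cst (x 0 l + s)
         else (fun y : coords R => y 0 j0)).
        case: eqP => _; first by rewrite partial_cst mul0r.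
        by rewrite partial_coord eq_sym (negbTE j0k) mul0r.
      by apply/funext => y; rewrite setcE; case: eqP.
    exact: h.
  have dphi' z : cube x (Num.min d r) z -> derivable phi z (delta_mx 0 k).
    by move=> /dphi[].
  have y1 : cube x (Num.min d r) (setc k (x 0 k) x) by rewrite setc_id.
  have y2 : cube x (Num.min d r) (setc k (x 0 k + s) x) by apply: cube_setc.
  have [xi hxi] := mvt_line dphi' y1 y2.
  have cxi := cube_line y1 y2 hxi.
  rewrite setc_id /phi [partial k _ _](@derive_val _ _ _ _ _ _ _ (dphi _ cxi)).
  rewrite (_ : x 0 k + s - x 0 k = s); last by ring.
  move=> e1.
  set w := setc k xi x in cxi e1.
  have wl : w 0 l = x 0 l by rewrite setcE eq_sym (negbTE kl).
  have z1 : cube x (Num.min d r) (setc l (x 0 l) w) by rewrite -wl setc_id.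
  have z2 : cube x (Num.min d r) (setc l (x 0 l + s) w) by apply: cs.
  have dkf' z : cube x (Num.min d r) z -> derivable (partial k f) z (delta_mx 0 l).
    by move=> xz; apply: dkf; exact: cU.
  have [et het] := mvt_line dkf' z1 z2.
  have cet := cube_line z1 z2 het.
  rewrite -{2}wl setc_id (_ : x 0 l + s - x 0 l = s); last by ring.
  move=> e2.
  exists (partial l (partial k f) (setc l et w)).
    by apply: dP; apply: subcube cet; rewrite ge_min lexx.
  by rewrite -e2 -e1 setcC.
have : \forall s \near (0 : R)^'+, `|partial i (partial j f) x - partial j (partial i f) x| <= e.
  have ji : j != i by rewrite eq_sym.
  near=> s.
  have s0 : 0 < s by near: s; exact: nbhs_right_gt.
  have [a a1 a2] : exists2 d, `|partial j (partial i f) x - d| < e / 2 &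
    f (setc i (x 0 i + s) (setc j (x 0 j + s) x)) - f (setc i (x 0 i + s) x)
    - (f (setc j (x 0 j + s) x) - f x) = d * s * s.
    by near: s; exact: main.
  have [b b1 b2] : exists2 d, `|partial i (partial j f) x - d| < e / 2 &
    f (setc j (x 0 j + s) (setc i (x 0 i + s) x)) - f (setc j (x 0 j + s) x)
    - (f (setc i (x 0 i + s) x) - f x) = d * s * s.
    by near: s; exact: main.
  have ab : a = b.
    apply: (@mulIf _ s); first by rewrite gt_eqF.
    apply: (@mulIf _ s); first by rewrite gt_eqF.
    rewrite -a2 -b2 setcC //; ring.
  rewrite -ab in b1; rewrite distrC in a1.
  have := ler_normD (partial i (partial j f) x - a) (a - partial j (partial i f) x).
  by rewrite subrKA => h; lra.
by move=> /(@filter_ex _ _ _ _)[].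
Unshelve. all: by end_near. Qed.

End Chain.
(** * Primitives along a coordinate *)

Section Antiderivative.
Variable R : realType.
Implicit Types (a r rho t : R) (psi u : R -> R).

Notation mu := (@lebesgue_measure R).

(** Integrating from [a - rho] puts both sides of a under a single formula. *)
Definition antider a rho psi t : R :=
  Rintegral mu `[a - rho, t] psi - Rintegral mu `[a - rho, a] psi.

Lemma antider_base a rho psi : antider a rho psi a = 0.
Proof. exact: subrr. Qed.

Lemma is_derive_antider a rho psi t :
  (forall s, `|s - a| <= rho -> {for s, continuous psi}) -> `|t - a| < rho ->
  is_derive t 1 (antider a rho psi) (psi t).
Proof.
move=> cpsi; rewrite ltr_distl => /andP[t1 t2].
have ipsi : mu.-integrable `[a - rho, a + rho] (EFin \o psi).
  apply: continuous_compact_integrable; first exact: segment_compact.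
  apply: continuous_in_subspaceT => s; rewrite inE /= in_itv /= => /andP[h1 h2].
  by apply: cpsi; rewrite ler_distl h1.
have cpt : {for t, continuous psi}.
  by apply: cpsi; rewrite ltW // ltr_distl t1.
have [h1 h2] := continuous_FTC1_closed t2 ipsi t1 cpt.
set F := (fun x : R => _) in h1 h2.
have e : antider a rho psi = (fun s => F s - F a) by [].
rewrite e; clearbody F.
have dF : @is_derive R R^o R^o t 1 F (psi t).
  by apply: (DeriveDef h1); rewrite -derive1E.
rewrite -[psi t]subr0; exact: (is_deriveB dF (is_derive_cst (F a) t 1)).
Qed.

Lemma between_dist (s t xi : R) :
  Num.min s t <= xi <= Num.max s t -> `|xi - s| <= `|t - s|.
Proof.
have [st|ts] := leP s t; move=> /andP[h1 h2].
  by rewrite !ger0_norm ?subr_ge0 // lerD2r.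
by rewrite !ler0_norm ?subr_le0 ?(ltW ts) // lerN2 lerD2r.
Qed.

Lemma mvt_bound a t u (C : R) : u a = 0 ->
  (forall s, Num.min a t <= s <= Num.max a t -> derivable u s 1) ->
  (forall s, Num.min a t <= s <= Num.max a t -> `|'D_1 u s| <= C) ->
  `|u t| <= C * `|t - a|.
Proof.
move=> ua du bu; have [xi hxi] := mvt_between du.
by rewrite ua subr0 => ->; rewrite normrM ler_wpM2r // bu.
Qed.

Lemma is_derive_quad (g : R -> R) (s0 D C d : R) : 0 < d ->
  (forall s, `|s - s0| < d -> `|g s - g s0 - (s - s0) * D| <= C * (s - s0) ^+ 2) ->
  is_derive s0 1 g D.
Proof.
move=> d0 gq.
have : (fun h => h^-1 *: ((g \o shift s0) (h *: 1) - g s0)) @ 0^' --> D.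
  apply/cvgrPdist_lt => e e0.
  pose C1 := Num.max C 1.
  have C10 : 0 < C1 by rewrite lt_max ltr01 orbT.
  near=> h.
  have h0 : h != 0 by near: h; exact: nbhs_dnbhs_neq.
  have hd : `|h| < d by near: h; exact: dnbhs0_lt.
  have he : `|h| < e / C1.
    by near: h; apply: dnbhs0_lt; rewrite divr_gt0.
  have := gq (h + s0); rewrite addrK => /(_ hd) gqh.
  rewrite /= /GRing.scale /= mulr1 distrC.
  rewrite (_ : h^-1 * _ - D = h^-1 * (g (h + s0) - g s0 - h * D)); last first.
    by rewrite [RHS]mulrBr mulrA mulVf // mul1r.
  rewrite normrM normfV mulrC ltr_pdivrMr ?normr_gt0 //.
  apply: le_lt_trans gqh _; apply: (@le_lt_trans _ _ (C1 * `|h| ^+ 2)).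
    by rewrite -normrX ger0_norm ?sqr_ge0 // ler_wpM2r ?sqr_ge0 // le_max lexx.
  rewrite expr2 mulrA ltr_pM2r ?normr_gt0 // mulrC -ltr_pdivlMr //.
move=> h; split; first by apply/cvg_ex; exists D.
exact/cvg_lim.
Unshelve. all: by end_near. Qed.

Lemma antider_indep a rho rho' psi t :
  (forall s, `|s - a| <= rho' -> {for s, continuous psi}) ->
  rho <= rho' -> `|t - a| < rho -> antider a rho psi t = antider a rho' psi t.
Proof.
move=> cpsi rr ta; apply/eqP; rewrite -subr_eq0 -normr_le0.
have aa : `|a - a| < rho by rewrite subrr normr0 (le_lt_trans _ ta).
have du s : Num.min a t <= s <= Num.max a t ->
    is_derive s 1 (fun t => antider a rho psi t - antider a rho' psi t)
      (psi s - psi s).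
  move=> /(between_ball aa ta) sa.
  apply: is_deriveB; apply: is_derive_antider => //.
    by move=> z za; apply: cpsi; exact: le_trans za rr.
  exact: lt_le_trans sa rr.
rewrite -(mul0r `|t - a|).
apply: (@mvt_bound _ _ (fun t => antider a rho psi t - antider a rho' psi t)).
- by rewrite !antider_base subrr.
- by move=> s /du[].
- by move=> s /du[_ ->]; rewrite subrr normr0.
Qed.

(** The primitives on closed subintervals fit together by [antider_indep]. *)
Lemma antiderivative_open a r psi :
  (forall s, `|s - a| < r -> {for s, continuous psi}) ->
  exists2 u, u a = 0 & forall t, `|t - a| < r -> is_derive t 1 u (psi t).
Proof.
move=> cpsi.
pose m t := (`|t - a| + r) / 2.
exists (fun t => antider a (m t) psi t); first exact: antider_base.
move=> t ta.
have mt : m t < r by rewrite /m; lra.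
have tm : `|t - a| < m t by rewrite /m; lra.
have cm s : `|s - a| <= m t -> {for s, continuous psi}.
  by move=> sa; apply: cpsi; exact: le_lt_trans sa mt.
have dt := is_derive_antider cm tm.
apply: near_eq_is_derive dt.
have m0 : 0 < m t - `|t - a| by rewrite subr_gt0.
near=> s.
have st : `|s - t| < m t - `|t - a|.
  near: s; have := @nbhsx_ballx _ R t _ m0.
  by apply: filterS => s /=; rewrite /ball /= distrC.
have sa : `|s - a| < m t.
  have := ler_normD (s - t) (t - a); rewrite subrKA; lra.
have sm : `|s - a| < m s.
  by rewrite /m; have := lt_trans sa mt; lra.
have msr : m s < r by rewrite /m; have := lt_trans sa mt; lra.
have [mm|mm] := leP (m s) (m t).
  by rewrite (antider_indep cm mm).
rewrite (@antider_indep _ (m t) (m s)) // ?ltW //.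
by move=> z za; apply: cpsi; exact: le_lt_trans za msr.
Unshelve. all: by end_near. Qed.

End Antiderivative.

Section Primitive.
Variable R : realType.
Implicit Types (x y p : coords R) (i j : 'I_3) (f g phi : coords R -> R).
Implicit Types (r rho : R).

Lemma bounded_cube p r rho f : rho < r ->
  (forall x, cube p r x -> {for x, continuous f}) ->
  exists2 M, 0 <= M & forall x, cube p rho x -> `|f x| <= M.
Proof.
move=> rr cf; have [r0|r0] := ltP 0 rho; last first.
  exists 0 => // x /(_ 0) h.
  by have := le_lt_trans (normr_ge0 _) h; rewrite ltNge r0.
pose B (j : 'I_3) : set R := `[p 0 j - rho, p 0 j + rho]%classic.
have cB : compact [set x : coords R | forall j, B j (x ord0 j)].
  by apply: rV_compact => j; exact: segment_compact.
have pB : [set x : coords R | forall j, B j (x ord0 j)] p.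
  by move=> j; rewrite /B /= in_itv /= ; lra.
have [||c _ hc] := @EVT_max_rV R 3 (fun x => `|f x|) _ _ cB.
- by exists p.
- apply: continuous_in_subspaceT => x; rewrite inE /= => xB.
  apply: (@continuous_comp _ _ _ f Num.norm); last exact: norm_continuous.
  apply: cf => j; have := xB j; rewrite /B /= in_itv /= => /andP[h1 h2].
  by rewrite (le_lt_trans _ rr) // ler_distl h1.
exists `|f c| => // x xp; apply: hc; rewrite inE /= => j.
by have := xp j; rewrite ltr_distl /B /= in_itv /= => /andP[h1 h2]; rewrite !ltW.
Qed.

Definition prim i p rho phi x : R :=
  antider (p 0 i) rho (fun t => phi (setc i t x)) (x 0 i).

Lemma prim_setc i p rho phi t x :
  prim i p rho phi (setc i t x) =
  antider (p 0 i) rho (fun t => phi (setc i t x)) t.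
Proof.
rewrite /prim setc_same.
by congr antider; apply/funext => s; rewrite setc_setc.
Qed.

Lemma prim_base i p rho phi x : x 0 i = p 0 i -> prim i p rho phi x = 0.
Proof. by rewrite /prim => ->; exact: antider_base. Qed.

Section InCube.
Variables (p : coords R) (r rho : R).
Hypotheses (rho0 : 0 < rho) (rr : rho < r).

Let pr : cube p rho `<=` cube p r.
Proof. exact/subcube/ltW. Qed.

Lemma cont_slice i phi x t :
  (forall x, cube p r x -> {for x, continuous phi}) ->
  cube p r x -> `|t - p 0 i| <= rho ->
  {for t, continuous (fun s => phi (setc i s x))}.
Proof.
move=> cphi px tp.
apply: (@continuous_comp _ _ _ (fun s => setc i s x) phi).
  exact: continuous_setc1.
by apply: cphi; apply: cube_setc => //; exact: le_lt_trans tp rr.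
Qed.

Lemma is_derive_prim_slice i phi x t :
  (forall x, cube p r x -> {for x, continuous phi}) ->
  cube p r x -> `|t - p 0 i| < rho ->
  is_derive t 1 (fun s => prim i p rho phi (setc i s x)) (phi (setc i t x)).
Proof.
move=> cphi px tp.
rewrite (_ : (fun s => _) = antider (p 0 i) rho (fun t => phi (setc i t x))).
  apply: is_derive_antider tp => s sp; exact: cont_slice.
by apply/funext => s; exact: prim_setc.
Qed.

Lemma prim_bound i phi x M :
  (forall x, cube p r x -> {for x, continuous phi}) ->
  (forall x, cube p rho x -> `|phi x| <= M) ->
  cube p rho x -> `|prim i p rho phi x| <= M * rho.
Proof.
move=> cphi bphi px.
have M0 : 0 <= M by apply: le_trans (bphi _ px).
have c0 : `|p 0 i - p 0 i| < rho by rewrite subrr normr0.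
apply: (@le_trans _ _ (M * `|x 0 i - p 0 i|)); last first.
  by rewrite ler_wpM2l // ltW.
rewrite -[X in prim _ _ _ _ X](setc_id i).
have dp s : Num.min (p 0 i) (x 0 i) <= s <= Num.max (p 0 i) (x 0 i) ->
    `|s - p 0 i| < rho by apply: between_ball.
apply: (@mvt_bound _ _ _ (fun s => prim i p rho phi (setc i s x))).
- by rewrite prim_base // setc_same.
- move=> s /dp sp.
  by have [] := is_derive_prim_slice cphi (pr px) sp.
- move=> s /dp sp.
  have [_ ->] := is_derive_prim_slice cphi (pr px) sp.
  by apply: bphi; exact: cube_setc.
Qed.

Lemma is_derive_primi i phi x :
  (forall x, cube p r x -> {for x, continuous phi}) -> cube p rho x ->
  is_derive x (delta_mx 0 i) (prim i p rho phi) (phi x).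
Proof.
move=> cphi px.
have [h1 h2] := is_derive_prim_slice cphi (pr px) (px i).
have h3 := @derive_slice _ (prim i p rho phi) i (x 0 i) x.
have h4 := (@derivable_slice _ (prim i p rho phi) i (x 0 i) x).2 h1.
rewrite setc_id in h2; rewrite setc_id in h4; rewrite h2 setc_id in h3.
exact: (DeriveDef h4 (esym h3)).
Qed.

(** Differentiation under the integral sign, from a quadratic estimate of the
    increments of the integrand. *)
Lemma is_derive_primj i j phi x : j != i -> ck 2 (cube p r) phi ->
  cube p rho x ->
  is_derive x (delta_mx 0 j) (prim i p rho phi) (prim i p rho (partial j phi) x).
Proof.
move=> ji cphi px.
have [c0 d0 pphi] := cphi; have [c1 d1 c2] := pphi j.
have [C C0 bC] := @bounded_cube p r rho (partial j (partial j phi)) rr (c2 j).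
have [d dd0 dP] := open_sub_cube (@open_cube _ p rho) px.
have key : is_derive (x 0 j) 1 (fun s => prim i p rho phi (setc j s x))
    (prim i p rho (partial j phi) x).
  apply: (@is_derive_quad _ _ _ _ (C * rho) d) => // s sd.
  have ps : cube p rho (setc j s x).
    apply: dP; apply: cube_setc => //; exact: cube_center.
  rewrite setc_id.
  pose u t := prim i p rho phi (setc i t (setc j s x))
    - prim i p rho phi (setc i t x)
    - (s - x 0 j) * prim i p rho (partial j phi) (setc i t x).
  have -> : prim i p rho phi (setc j s x) - prim i p rho phi x -
      (s - x 0 j) * prim i p rho (partial j phi) x = u (x 0 i).
    have e : x 0 i = setc j s x 0 i by rewrite setcE eq_sym (negbTE ji).
    by rewrite /u setc_id e setc_id.
  have cc : `|p 0 i - p 0 i| < rho by rewrite subrr normr0.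
  have du t : Num.min (p 0 i) (x 0 i) <= t <= Num.max (p 0 i) (x 0 i) ->
     is_derive t 1 u (phi (setc i t (setc j s x)) - phi (setc i t x)
         - (s - x 0 j) * partial j phi (setc i t x))
     /\ `|t - p 0 i| < rho.
    move=> /(between_ball cc (px i)) tp; split => //.
    have h1 := is_derive_prim_slice c0 (pr ps) tp.
    have h2 := is_derive_prim_slice c0 (pr px) tp.
    have h3 := is_derive_prim_slice c1 (pr px) tp.
    by apply: is_deriveB; apply: is_deriveZ.
  apply: (@le_trans _ _ ((C * (s - x 0 j) ^+ 2) * `|x 0 i - p 0 i|)); last first.
    rewrite -!mulrA (mulrC rho); apply: ler_wpM2l => //.
    by rewrite mulrA; apply: ler_wpM2l; [exact: sqr_ge0 | exact/ltW/px].
  apply: mvt_bound.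
  - by rewrite /u !prim_base ?setc_same // mulr0 !subr0.
  - by move=> t /du[[]].
  move=> t /du[[_ ->] tp].
  set z := setc i t x.
  have zj : z 0 j = x 0 j by rewrite setcE (negbTE ji).
  have pz : cube p rho z by exact: cube_setc.
  have sz : setc i t (setc j s x) = setc j s z by rewrite setcC // eq_sym.
  have pz1 : cube p rho (setc j (x 0 j) z) by rewrite -zj setc_id.
  have pz2 : cube p rho (setc j s z) by rewrite -sz; exact: cube_setc.
  have d0' y : cube p rho y -> derivable phi y (delta_mx 0 j).
    by move=> /pr; exact: d0.
  have d1' y : cube p rho y -> derivable (partial j phi) y (delta_mx 0 j).
    by move=> /pr; exact: d1.
  have [xi hxi] := mvt_line d0' pz1 pz2.
  have pxi := cube_line pz1 pz2 hxi.
  have [et het] := mvt_line d1' pz1 pxi.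
  have pet := cube_line pz1 pxi het.
  rewrite -{1 3}zj setc_id sz => e1 ->.
  have -> : partial j phi (setc j xi z) * (s - x 0 j)
     - (s - x 0 j) * partial j phi z
     = (partial j phi (setc j xi z) - partial j phi z) * (s - x 0 j) by ring.
  rewrite e1 !normrM expr2 -mulrA.
  have xis : `|xi - x 0 j| <= `|s - x 0 j| by exact: between_dist hxi.
  rewrite -[X in C * X]ger0_norm ?sqr_ge0 // -expr2 normrX expr2.
  by apply: ler_pM => //; [exact: bC | rewrite ler_wpM2r].
have h3 := @derive_slice _ (prim i p rho phi) j (x 0 j) x.
case: key => h1 h2.
have h4 := (@derivable_slice _ (prim i p rho phi) j (x 0 j) x).2 h1.
rewrite setc_id in h4; rewrite h2 setc_id in h3.
exact: (DeriveDef h4 (esym h3)).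
Qed.

Lemma ck_prim n i phi : smooth_on (cube p r) phi ->
  ck n (cube p rho) (prim i p rho phi).
Proof.
elim: n phi => [|n IH] phi sphi.
- move=> x px.
  have cphi j y : cube p r y -> {for y, continuous (partial j phi)}.
    move=> py; exact: smooth_cont (smooth_partial j sphi) py.
  have cphi0 y : cube p r y -> {for y, continuous phi}.
    move=> py; exact: smooth_cont sphi py.
  have bd j : exists2 M, 0 <= M & forall x, cube p rho x -> `|partial j phi x| <= M.
    exact: bounded_cube rr (cphi j).
  have [M0 M00 bM0] := bounded_cube rr cphi0.
  have [N0 _ bN0] := bd 0; have [N1 _ bN1] := bd 1; have [N2 _ bN2] := bd 2%:R.
  pose M := Num.max M0 (Num.max (N0 * rho) (Num.max (N1 * rho) (N2 * rho))).
  apply: (ck1_cont (@open_cube _ p rho) _ _ px) => [j y py|].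
    have [->|ji] := eqVneq j i; first by case: (is_derive_primi i cphi0 py).
    by case: (is_derive_primj ji (smooth_ck 2 sphi) py).
  exists M => j y py; have [->|ji] := eqVneq j i.
    have [_ h] := is_derive_primi i cphi0 py; rewrite [X in `|X|]h.
    by rewrite /M le_max bM0.
  have [_ h] := is_derive_primj ji (smooth_ck 2 sphi) py; rewrite [X in `|X|]h.
  rewrite /M !le_max; apply/orP; right.
  move: j {ji h}; apply: all3.
  + by rewrite (prim_bound i (cphi 0) bN0).
  + by rewrite (prim_bound i (cphi 1) bN1) ?orbT.
  + by rewrite (prim_bound i (cphi 2%:R) bN2) ?orbT.
- have cphi0 y : cube p r y -> {for y, continuous phi}.
    move=> py; exact: smooth_cont sphi py.
  split=> [x px|j x px|j].
  + exact: ck_cont (IH phi sphi) px.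
  + have [->|ji] := eqVneq j i; first by case: (is_derive_primi i cphi0 px).
    by case: (is_derive_primj ji (smooth_ck 2 sphi) px).
  + have [->|ji] := eqVneq j i.
      apply: (@eq_ck _ _ _ phi) => [|x px|]; first exact: open_cube.
        by case: (is_derive_primi i cphi0 px).
      exact/smooth_ck/smooth_sub/sphi.
    apply: eq_ck (IH _ (smooth_partial j sphi)) => [|x px]; first exact: open_cube.
    by case: (is_derive_primj ji (smooth_ck 2 sphi) px).
Qed.

(** The last clause is what keeps the coordinates of a pp-wave adapted to V:
    coordinate functions built as primitives stay constant along V. *)
Lemma primitive i phi : smooth_on (cube p r) phi ->
  exists Phi, [/\ smooth_on (cube p rho) Phi,
    forall x, cube p rho x -> partial i Phi x = phi x
    & forall j, j != i -> (forall x, cube p r x -> partial j phi x = 0) ->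
        forall x, cube p rho x -> partial j Phi x = 0].
Proof.
move=> sphi; exists (prim i p rho phi); split.
- by apply/smooth_onP => n; exact: ck_prim.
- move=> x px.
  have cphi0 y : cube p r y -> {for y, continuous phi}.
    move=> py; exact: smooth_cont sphi py.
  by case: (is_derive_primi i cphi0 px).
- move=> j ji phi0 x px.
  have [_ h] := is_derive_primj ji (smooth_ck 2 sphi) px; rewrite [LHS]h.
  apply/eqP; rewrite -normr_le0 -(mul0r rho).
  apply: prim_bound px => y py.
    exact: smooth_cont (smooth_partial j sphi) py.
  by rewrite phi0 ?normr0 //; exact: pr.
Qed.

End InCube.

End Primitive.
(** * Replacing one coordinate by a function *)

Section Replace.
Variable R : realType.
Implicit Types (x y p : coords R) (i j : 'I_3) (f g phi : coords R -> R).
Implicit Types (r : R).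

Lemma is_derive1_near (f : R -> R) (x a : R) (g : R -> R) :
  (\forall z \near x, f z - f x = g z * (z - x)) -> {for x, continuous g} ->
  g x = a -> is_derive x 1 f a.
Proof.
move=> fg cg ga; apply/is_derive1_caratheodory.
exists (fun z => if z == x then a else (f z - f x) / (z - x)); split.
- move=> z; case: eqP => [->|/eqP zx]; first by rewrite !subrr mulr0.
  by rewrite divfK // subr_eq0.
- rewrite /prop_for /continuous_at eqxx -ga.
  have h : {near x, g =1 (fun z => if z == x then a else (f z - f x) / (z - x))}.
    near=> z; have fz : f z - f x = g z * (z - x) by near: z.
    case: eqP => [->|/eqP zx] //; rewrite fz mulfK // subr_eq0 //.
  rewrite ga in h *.
  by apply: cvg_trans (near_eq_cvg h) _; rewrite -ga.
- by rewrite eqxx.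
Unshelve. all: by end_near. Qed.

(** The inverse function theorem for the map that replaces the i-th coordinate
    by the value of [phi]: on each line in direction i this is a one-variable
    problem, solved by the intermediate value theorem; the derivatives of the
    solution are rational in those of [phi], whence smoothness. *)
Lemma solve_coordinate i p r phi : 0 < r -> smooth_on (cube p r) phi ->
  partial i phi p != 0 ->
  exists (sg : coords R -> R) (r1 d : R),
  let p' := setc i (phi p) p in
  [/\ [/\ 0 < d, 0 < r1, r1 <= r & smooth_on (cube p' d) sg],
      forall x, cube p r1 x -> partial i phi x != 0,
      forall y, cube p' d y ->
        cube p r1 (setc i (sg y) y) /\ phi (setc i (sg y) y) = y 0 i
    & forall x, cube p r1 x -> cube p' d (setc i (phi x) x) ->
        sg (setc i (phi x) x) = x 0 i].
Proof.
move=> r0 sphi; set c := partial i phi p => c0.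
have cnorm0 : 0 < `|c| by rewrite normr_gt0.
have oC := @open_cube R p r.
have ckphi := smooth_ck 1 sphi.
have pphi j : smooth_on (cube p r) (partial j phi) by exact: smooth_partial.
have [d1 d10 hd1] : exists2 d, 0 < d &
    forall y, cube p d y -> `|c - partial i phi y| < `|c| / 2.
  have m0 : 0 < `|c| / 2 by rewrite divr_gt0.
  have := smooth_cont (pphi i) (cube_center p r0).
  by move=> /cont_cubeP/(_ _ m0).
pose r1 := Num.min d1 r.
have r10 : 0 < r1 by rewrite lt_min d10.
have r1r : r1 <= r by rewrite ge_min lexx orbT.
have sub1 : cube p r1 `<=` cube p r by exact: subcube.
have slope x : cube p r1 x -> 1 / 2 < partial i phi x / c.
  move=> px; have : `|c - partial i phi x| < `|c| / 2.
    by apply: hd1; apply: subcube px; rewrite ge_min lexx.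
  move=> h; have : `|1 - partial i phi x / c| < 1 / 2.
    have -> : 1 - partial i phi x / c = (c - partial i phi x) / c.
      by rewrite mulrBl divff.
    rewrite normrM normfV ltr_pdivrMr //.
    by apply: lt_le_trans h _; rewrite [leLHS]mulrC div1r.
  by rewrite ltr_norml => /andP[h1 h2]; lra.
have nz x : cube p r1 x -> partial i phi x != 0.
  by move=> /slope h; apply/eqP => e; move: h; rewrite e mul0r; lra.
(* [phi / c] has slope > 1/2 along lines in direction i *)
have incr s t x : cube p r1 (setc i s x) -> cube p r1 (setc i t x) ->
    exists2 D, 1 / 2 < D &
      phi (setc i t x) / c - phi (setc i s x) / c = D * (t - s).
  move=> ps pt.
  have dphi y : cube p r1 y -> derivable phi y (delta_mx 0 i).
    by move=> /sub1; exact: smooth_derivable.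
  have [xi hxi e] := mvt_line dphi ps pt.
  exists (partial i phi (setc i xi x) / c).
    by apply: slope; exact: cube_line hxi.
  by rewrite -mulrBl e; ring.
pose p' := setc i (phi p) p.
pose h := r1 / 2.
have h0 : 0 < h by rewrite divr_gt0.
have hr : h < r1 by rewrite /h; lra.
have pp : cube p r1 p by exact: cube_center.
have side e : `|e| = h -> exists2 d, 0 < d & forall y, cube p' d y ->
    `|phi (setc i (p 0 i + e) p) - phi (setc i (p 0 i + e) y)| < `|c| * (h / 4).
  move=> eh.
  have Q : cube p r1 (setc i (p 0 i + e) p).
    by apply: cube_setc => //; rewrite (addrC (p 0 i)) addrK eh.
  have -> : setc i (p 0 i + e) p = setc i (p 0 i + e) p' by rewrite setc_setc.
  have cg : {for p', continuous (fun y => phi (setc i (p 0 i + e) y))}.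
    apply: (@continuous_comp _ _ _ (fun y => setc i (p 0 i + e) y) phi).
      by apply: (@continuous_setc _ _ (fun=> p 0 i + e)); exact: cst_continuous.
    by rewrite setc_setc; apply: smooth_cont sphi (sub1 _ Q).
  have m0 : 0 < `|c| * (h / 4) by rewrite mulr_gt0 // divr_gt0.
  by move/cont_cubeP: cg => /(_ _ m0).
have [da da0 hda] : exists2 d, 0 < d & forall y, cube p' d y ->
    `|phi (setc i (p 0 i + h) p) - phi (setc i (p 0 i + h) y)| < `|c| * (h / 4).
  by apply: side; rewrite gtr0_norm.
have [db db0 hdb] : exists2 d, 0 < d & forall y, cube p' d y ->
    `|phi (setc i (p 0 i - h) p) - phi (setc i (p 0 i - h) y)| < `|c| * (h / 4).
  by apply: side; rewrite normrN gtr0_norm.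
pose d := Num.min (Num.min da db) (Num.min r1 (`|c| * (h / 4))).
have d0 : 0 < d.
  have m0 : 0 < `|c| * (h / 4) by rewrite mulr_gt0 // divr_gt0.
  by rewrite /d lt_min; apply/andP; split; rewrite lt_min; apply/andP; split.
have dle : [/\ d <= da, d <= db, d <= r1 & d <= `|c| * (h / 4)].
  by split; rewrite /d ge_min; apply/orP; [left|left|right|right];
    rewrite ge_min lexx ?orbT.
have scale a b e : `|a - b| < `|c| * e -> `|a / c - b / c| < e.
  by move=> ab; rewrite -mulrBl normrM normfV ltr_pdivrMr // mulrC.
have inline y t : cube p' d y -> `|t - p 0 i| < r1 -> cube p r1 (setc i t y).
  move=> p'y tp j; rewrite setcE; case: eqP => [->//|/eqP ji].
  have := p'y j; rewrite setcE (negbTE ji) => /lt_le_trans; apply.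
  by case: dle.
have sol y : exists s, cube p' d y ->
    cube p r1 (setc i s y) /\ phi (setc i s y) = y 0 i.
  have [p'y|np] := pselect (cube p' d y); last by exists 0.
  have [dl1 dl2 dl3 dl4] := dle.
  have p1 : cube p r1 (setc i (p 0 i + h) p).
    by apply: cube_setc => //; rewrite (addrC (p 0 i)) addrK gtr0_norm.
  have p2 : cube p r1 (setc i (p 0 i - h) p).
    by apply: cube_setc => //; rewrite addrAC subrr add0r normrN gtr0_norm.
  have p0 : cube p r1 (setc i (p 0 i) p) by rewrite setc_id.
  have [D1 D1h] := incr _ _ _ p0 p1; have [D2 D2h] := incr _ _ _ p2 p0.
  rewrite setc_id (_ : p 0 i - (p 0 i - h) = h); last by ring.
  rewrite (_ : p 0 i + h - p 0 i = h); last by ring.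
  move=> e2 e1.
  have i1 : h / 2 < D1 * h by rewrite mulrC ltr_pM2r //; lra.
  have i2 : h / 2 < D2 * h by rewrite mulrC ltr_pM2r //; lra.
  have := scale _ _ _ (hda y (subcube dl1 p'y)).
  have := scale _ _ _ (hdb y (subcube dl2 p'y)).
  rewrite !ltr_distl => /andP[a1 a2] /andP[b1 b2].
  have : `|y 0 i / c - phi p / c| < h / 4.
    apply: scale; apply: lt_le_trans dl4.
    by have := p'y i; rewrite setc_same.
  rewrite ltr_distl => /andP[k1 k2].
  have [|||s] := @IVT R (fun s => phi (setc i s y) / c) (p 0 i - h) (p 0 i + h)
      (y 0 i / c).
  - lra.
  - apply: continuous_in_subspaceT => s; rewrite inE /= in_itv /= => /andP[s1 s2].
    apply: (@continuousM _ _ (fun s => phi (setc i s y)) (fun=> c^-1)).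
      apply: (@continuous_comp _ _ _ (fun s => setc i s y) phi).
        exact: continuous_setc1.
      apply: smooth_cont sphi (sub1 _ _); apply: inline => //.
      by apply: le_lt_trans hr; rewrite ler_distl; lra.
    exact: cst_continuous.
  - rewrite ge_min le_max; apply/andP; split; apply/orP; [left|right]; lra.
  rewrite in_itv /= => /andP[s1 s2] es; exists s => _; split.
    by apply: inline => //; apply: le_lt_trans hr; rewrite ler_distl; lra.
  by apply: (@mulIf _ c^-1); rewrite ?invr_eq0.
have [sg sgP] := choice sol.
have uniq s t x : cube p r1 (setc i s x) -> cube p r1 (setc i t x) ->
    phi (setc i s x) = phi (setc i t x) -> s = t.
  move=> ps pt e; have [D D0] := incr _ _ _ ps pt.
  rewrite e subrr => /esym/eqP; rewrite mulf_eq0 subr_eq0 => /orP[/eqP|/eqP//].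
  lra.
pose Phi y := setc i (sg y) y.
have csg y : cube p' d y -> {for y, continuous sg}.
  move=> p'y; have [q1 q2] := sgP y p'y.
  pose k (z : coords R) := z 0 i / c - phi (setc i (sg y) z) / c.
  have ctk : {for y, continuous k}.
    apply: (@continuousB _ _ _ (fun z : coords R => z 0 i / c)
                               (fun z => phi (setc i (sg y) z) / c)).
      apply: (@continuousM _ _ (fun z : coords R => z 0 i) (fun=> c^-1)).
        exact: continuous_coord.
      exact: cst_continuous.
    apply: (@continuousM _ _ (fun z => phi (setc i (sg y) z)) (fun=> c^-1)).
      apply: (@continuous_comp _ _ _ (fun z => setc i (sg y) z) phi).
        by apply: (@continuous_setc _ _ (fun=> sg y)); exact: cst_continuous.
      exact: smooth_cont sphi (sub1 _ q1).
    exact: cst_continuous.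
  have ky : k y = 0 by rewrite /k q2 subrr.
  apply/cont_cubeP => e e0.
  have e20 : 0 < e / 2 by rewrite divr_gt0.
  have /cont_cubeP/(_ _ e20)[a a0 ha] := ctk.
  have [b b0 hb] := open_sub_cube (@open_cube _ p' d) p'y.
  exists (Num.min a b); first by rewrite lt_min a0.
  move=> z yz.
  have p'z : cube p' d z by apply: hb; apply: subcube yz; rewrite ge_min lexx orbT.
  have [z1 z2] := sgP z p'z.
  have w1 : cube p r1 (setc i (sg y) z).
    by apply: inline => //; have := q1 i; rewrite setc_same.
  have [D D0] := incr _ _ _ w1 z1; rewrite z2 -/(k z) => eD.
  have : `|k z| < e / 2.
    have := ha z; rewrite ky sub0r normrN; apply.
    by apply: subcube yz; rewrite ge_min lexx.
  rewrite eD normrM gtr0_norm; last by lra.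
  rewrite distrC => hD.
  rewrite -(@ltr_pM2l _ (1 / 2)) //.
  apply: (@le_lt_trans _ _ (D * `|sg y - sg z|)).
    by apply: ler_wpM2r; [exact: normr_ge0 | exact: ltW].
  by rewrite div1r (mulrC 2^-1).
have cPhi y : cube p' d y -> {for y, continuous Phi}.
  by move=> p'y; apply: continuous_setc; exact: csg.
pose dsg j y := ((i == j)%:R - (j != i)%:R * partial j phi (Phi y)) /
                partial i phi (Phi y).
have dersg j y : cube p' d y -> is_derive y (delta_mx 0 j) sg (dsg j y).
  move=> p'y; have [q1 q2] := sgP y p'y.
  have [q [qe qc q0]] := C1_increment oC ckphi (sub1 _ q1).
  pose Q s := Phi (setc j s y).
  have Q0 : Q (y 0 j) = Phi y by rewrite /Q setc_id.
  have cQ : {for y 0 j, continuous Q}.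
    apply: (@continuous_comp _ _ _ (fun s => setc j s y) Phi).
      exact: continuous_setc1.
    by rewrite setc_id; exact: cPhi.
  have cq a : {for y 0 j, continuous (fun s => q a (Q s))}.
    by apply: (@continuous_comp _ _ _ Q (q a)) => //; rewrite Q0; exact: qc.
  have qi0 : q i (Q (y 0 j)) != 0 by rewrite Q0 q0; exact: nz.
  pose G s := ((i == j)%:R - (j != i)%:R * q j (Q s)) / q i (Q s).
  have key : is_derive (y 0 j) 1 (fun s => sg (setc j s y)) (dsg j y).
    apply: (@is_derive1_near _ _ _ G).
    - have [b b0 hb] := open_sub_cube (@open_cube _ p' d) p'y.
      have nq : \forall s \near y 0 j, q i (Q s) != 0.
        exact: (cvgr_neq0 (q i (Q (y 0 j))) (cq i) qi0).
      near=> s.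
      have qs : q i (Q s) != 0 by near: s.
      have sb : `|s - y 0 j| < b.
        near: s; have := @nbhsx_ballx _ R (y 0 j) _ b0.
        by apply: filterS => s /=; rewrite /ball /= distrC.
      have p's : cube p' d (setc j s y).
        by apply: hb; apply: cube_setc => //; exact: cube_center.
      have [w1 w2] := sgP _ p's.
      have := qe (Q s); rewrite {1}/Q /Phi w2 q2 setc_id -/(Phi y) => e.
      have Qi : Q s 0 i - Phi y 0 i = sg (setc j s y) - sg y.
        by rewrite /Q /Phi !setc_same.
      have Qa a : a != i -> Q s 0 a - Phi y 0 a = (a == j)%:R * (s - y 0 j).
        move=> ai; rewrite /Q /Phi !setcE (negbTE ai).
        by case: eqP => [->|_]; rewrite ?mul1r // subrr mul0r.
      have e1 : setc j s y 0 i - y 0 i = (i == j)%:R * (s - y 0 j).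
        by rewrite setcE; case: eqP => [->|_]; rewrite ?mul1r // subrr mul0r.
      have e2 : \sum_(a | a != i) q a (Q s) * (Q s 0 a - Phi y 0 a)
          = (j != i)%:R * q j (Q s) * (s - y 0 j).
        have [ji|ji] := eqVneq j i.
          rewrite !mul0r big1 // => a ai.
          by rewrite Qa // ji (negbTE ai) mul0r mulr0.
        rewrite mul1r (bigD1 j) //= Qa // eqxx mul1r big1 ?addr0 // => a.
        by move=> /andP[ai aj]; rewrite Qa // (negbTE aj) mul0r mulr0.
      rewrite e1 (bigD1 i) //= Qi e2 in e.
      rewrite /G mulrAC; apply: (canRL (mulfK qs)).
      by rewrite [RHS]mulrBl e; ring.
    - have c1 : {for y 0 j, continuous (fun s => (j != i)%:R * q j (Q s) : R)}.
        apply: (@continuousM _ _ (fun=> (j != i)%:R) (fun s => q j (Q s))).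
          exact: cst_continuous.
        exact: cq.
      have c2 : {for y 0 j, continuous
          (fun s => (i == j)%:R - (j != i)%:R * q j (Q s) : R)}.
        apply: continuousD; first exact: cst_continuous.
        by apply: continuousN.
      apply: (@continuousM _ _ _ (fun s => (q i (Q s))^-1)); first exact: c2.
      by apply: continuousV => //; exact: cq.
    - by rewrite /G Q0 !q0.
  have h3 := @derive_slice _ sg j (y 0 j) y.
  case: key => k1 k2.
  have h4 := (@derivable_slice _ sg j (y 0 j) y).2 k1.
  rewrite setc_id in h4; rewrite k2 setc_id in h3.
  exact: (DeriveDef h4 (esym h3)).
have oC' := @open_cube R p' d.
have ssg : smooth_on (cube p' d) sg.
  apply/smooth_onP; elim=> [|n IH]; first by move=> y; exact: csg.
  split=> [y py|j y py|j]; first exact: csg.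
    by case: (dersg j y py).
  have cT a : ck n (cube p' d) (fun y => Phi y 0 a).
    rewrite /Phi (_ : (fun y => _) = if a == i then sg else (fun y : coords R => y 0 a)).
      by case: eqP => _ //; exact: ck_coord.
    by apply/funext => y; rewrite setcE; case: eqP.
  apply: (@eq_ck _ _ _ (dsg j)) => // [y py|].
    by case: (dersg j y py).
  have inr y : cube p' d y -> cube p r (Phi y) by move=> /sgP[/sub1].
  apply: ckM => //.
    apply: ckD; [exact: oC' | exact: ck_cst | apply: ckN => //].
    apply: ckM; [exact: oC' | exact: ck_cst |].
    apply: (@ck_comp _ n _ _ _ Phi oC oC' inr cT); exact: smooth_ck (pphi _).
  apply: ckV; [exact: oC' | by move=> y /sgP[/nz] |].
  apply: (@ck_comp _ n _ _ _ Phi oC oC' inr cT); exact: smooth_ck (pphi _).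
exists sg, r1, d; split => //.
move=> x px p'x; have [] := sgP _ p'x; rewrite setc_setc setc_same => h1 h2.
by apply: (uniq _ _ x) => //; rewrite setc_id.
Unshelve. all: by end_near. Qed.

End Replace.
(** * Charts of a maximal atlas *)

Section Charts.
Variables (R : realType) (M : topologicalType) (S : smooth_structure R M).
Implicit Types (c d : chart R M) (q : M) (x y : coords R).

Lemma open_preimage_in (T1 T2 : topologicalType) (f : T1 -> T2)
    (A : set T1) (B : set T2) : open A -> open B ->
  (forall t, A t -> {for t, continuous f}) -> open [set t | A t /\ B (f t)].
Proof.
move=> oA oB cf; rewrite openE => t [At Bt]; rewrite /interior.
have nA : nbhs t A by exact: open_nbhs_nbhs.
have nB : nbhs t (f @^-1` B) by apply: cf => //; exact: open_nbhs_nbhs.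
by apply: filterS2 nA nB => z Az Bz; split.
Qed.

Lemma cimg_cmap c q : cdom c q -> cimg c (cmap c q).
Proof. by move=> cq; exists q. Qed.

Lemma cinvK c x : cimg c x -> cdom c (cinv c x) /\ cmap c (cinv c x) = x.
Proof. by move=> [q cq <-]; rewrite cmapK. Qed.

Lemma overlapE c d : overlap c d = [set x | cimg c x /\ cdom d (cinv c x)].
Proof.
apply/seteqP; split=> x /=.
  by move=> [q [cq dq] <-]; rewrite cmapK //; split => //; exact: cimg_cmap.
by move=> [cx dx]; have [h1 h2] := cinvK cx; exists (cinv c x).
Qed.

Lemma open_overlap c d : open (overlap c d).
Proof.
rewrite overlapE; apply: open_preimage_in; first exact: open_cimg.
  exact: open_cdom.
exact: continuous_cinv.
Qed.

Lemma overlap_cmap c d q : cdom c q -> cdom d q -> overlap c d (cmap c q).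
Proof. by move=> cq dq; exists q. Qed.

Lemma transition_cmap c d q : cdom c q -> transition c d (cmap c q) = cmap d q.
Proof. by move=> cq; rewrite /transition cmapK. Qed.

Lemma smooth_vec_cont (U : set (coords R)) (T : coords R -> coords R) x :
  (forall j, smooth_on U (fun y => T y 0 j)) -> U x -> {for x, continuous T}.
Proof.
move=> sT Ux; apply/(@continuous_coordsP _ _ (nbhs x)) => j.
exact: smooth_cont (sT j) Ux.
Qed.

(** Composing a chart with a diffeomorphism between open subsets of R^3 yields
    a chart, which belongs to the atlas by maximality. *)
Lemma diffeo_chart c (U W : set (coords R)) (Psi Phi : coords R -> coords R) :
  atlas S c -> open U -> U `<=` cimg c -> open W ->
  (forall x, U x -> W (Psi x)) -> (forall y, W y -> U (Phi y)) ->
  (forall x, U x -> Phi (Psi x) = x) -> (forall y, W y -> Psi (Phi y) = y) ->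
  (forall j, smooth_on U (fun x => Psi x 0 j)) ->
  (forall j, smooth_on W (fun y => Phi y 0 j)) ->
  exists c', [/\ atlas S c', cdom c' = [set q | cdom c q /\ U (cmap c q)],
    cimg c' = W & forall q, cmap c' q = Psi (cmap c q)].
Proof.
move=> Sc oU Uc oW UW WU PhiK PsiK sPsi sPhi.
pose dom := [set q | cdom c q /\ U (cmap c q)].
have odom : open dom.
  by apply: (open_preimage_in (@open_cdom _ _ c) oU); exact: continuous_cmap.
have imgE : (fun q => Psi (cmap c q)) @` dom = W.
  apply/seteqP; split=> [y [q [cq Uq] <-]|y Wy]; first exact: UW.
  have [q cq eq] := Uc _ (WU y Wy).
  exists q; last by rewrite eq PsiK.
  by split => //; rewrite eq; exact: WU.
have oimg : open ((fun q => Psi (cmap c q)) @` dom) by rewrite imgE.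
have mapK q : dom q -> cinv c (Phi (Psi (cmap c q))) = q.
  by move=> [cq Uq]; rewrite PhiK // cmapK.
have cmap' q : dom q -> {for q, continuous (fun q => Psi (cmap c q))}.
  move=> [cq Uq]; apply: (@continuous_comp _ _ _ (cmap c) Psi).
    exact: continuous_cmap.
  exact: smooth_vec_cont sPsi Uq.
have cinv' y : ((fun q => Psi (cmap c q)) @` dom) y ->
    {for y, continuous (fun y => cinv c (Phi y))}.
  rewrite imgE => Wy; apply: (@continuous_comp _ _ _ Phi (cinv c)).
    exact: smooth_vec_cont sPhi Wy.
  apply: continuous_cinv; exact/Uc/WU.
pose c' := Chart odom oimg mapK cmap' cinv'.
exists c'; split => //; apply: atlas_max => d Sd.
have [cd dc] := (atlas_compat Sc Sd, atlas_compat Sd Sc).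
split=> j.
- have sub y : overlap c' d y -> overlap c d (Phi y) /\ W y.
    move=> [q [[cq Uq] dq] <-] /=; rewrite PhiK //; split; last exact: UW.
    exact: overlap_cmap.
  have := @smooth_comp R (overlap c d) (overlap c' d)
    (fun x => transition c d x 0 j) Phi.
  apply; [exact: open_overlap | exact: open_overlap | by move=> y /sub[] | | exact: cd].
  by move=> k; apply: smooth_sub (sPhi k) => y /sub[].
- have sub x : overlap d c' x -> U (transition d c x) /\ overlap d c x.
    move=> [q [dq [cq Uq]] <-]; rewrite transition_cmap //; split => //.
    exact: overlap_cmap.
  have := @smooth_comp R U (overlap d c') (fun x => Psi x 0 j) (transition d c).
  apply; [exact: oU | exact: open_overlap | by move=> y /sub[] | | exact: sPsi].
  by move=> k; apply: smooth_sub (dc k) => y /sub[].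
Qed.

(** The coordinate systems used below all have a cube as image. *)
Definition cubic_chart c q r :=
  [/\ 0 < r, atlas S c, cdom c q & cimg c = cube (cmap c q) r].

Lemma shrink_chart c q r : atlas S c -> cdom c q -> 0 < r ->
  cube (cmap c q) r `<=` cimg c ->
  exists c', [/\ cubic_chart c' q r, cdom c' `<=` cdom c
    & forall q', cmap c' q' = cmap c q'].
Proof.
move=> Sc cq r0 rc.
have oC := @open_cube R (cmap c q) r.
have [||||||c' [Sc' dom img m]] := @diffeo_chart c _ _ id id Sc oC rc oC => //.
- by move=> j; exact: smooth_coord.
- by move=> j; exact: smooth_coord.
exists c'; split => //; last by rewrite dom => z [].
split=> //; last by rewrite m.
by rewrite dom; split => //; exact: cube_center.
Qed.

Lemma cubic_chart_exists q : exists c r, cubic_chart c q r.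
Proof.
have [c Sc cq] := atlas_cover S q.
have [r r0 rc] := open_sub_cube (@open_cimg _ _ c) (cimg_cmap cq).
by have [c' [h _ _]] := shrink_chart Sc cq r0 rc; exists c', r.
Qed.

Definition replaced i (phi : coords R -> R) c c' :=
  cdom c' `<=` cdom c /\
  forall q, cdom c' q -> cmap c' q = setc i (phi (cmap c q)) (cmap c q).

Lemma replace_chart c q r i phi : cubic_chart c q r ->
  smooth_on (cimg c) phi -> partial i phi (cmap c q) != 0 ->
  exists c' e, cubic_chart c' q e /\ replaced i phi c c'.
Proof.
move=> [r0 Sc cq cE] sphi d0; have sphi' := sphi; rewrite cE in sphi'.
have [sg [r1 [d [[d_gt0 r10 r1r ssg] nz sgP sgK]]]] := solve_coordinate r0 sphi' d0.
set p := cmap c q in nz sgP sgK ssg cE *.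
set p' := setc i (phi p) p in sgP sgK ssg.
pose U := [set x | cube p r1 x /\ cube p' d (setc i (phi x) x)].
have oW := @open_cube R p' d.
have sub x : cube p r1 x -> cimg c x.
  by rewrite cE; exact: subcube.
have oU : open U.
  apply: (open_preimage_in (@open_cube R p r1) oW).
  by move=> x /sub cx; apply: continuous_setc; exact: smooth_cont sphi cx.
have [||||||||c' [Sc' dom img m]] := @diffeo_chart c U (cube p' d)
    (fun x => setc i (phi x) x) (fun y => setc i (sg y) y) Sc oU.
- by move=> x [/sub].
- by [].
- by move=> x [].
- move=> y p'y; have [h1 h2] := sgP y p'y; split=> //.
  by rewrite setc_setc h2 setc_id.
- by move=> x [px p'x]; rewrite setc_setc sgK // setc_id.
- by move=> y p'y; have [h1 h2] := sgP y p'y; rewrite setc_setc h2 setc_id.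
- move=> j; rewrite (_ : (fun x => _) = if j == i then phi else (fun x : coords R => x 0 j)).
    case: eqP => _; last exact: smooth_coord.
    by apply: smooth_sub sphi => x [/sub].
  by apply/funext => x; rewrite setcE; case: eqP.
- move=> j; rewrite (_ : (fun x => _) = if j == i then sg else (fun x : coords R => x 0 j)).
    case: eqP => _; [exact: ssg | exact: smooth_coord].
  by apply/funext => x; rewrite setcE; case: eqP.
exists c', d; split.
  split => //; last by rewrite m.
  rewrite dom; split => //; split; first exact: cube_center.
  exact: cube_center.
by split => [z|z _]; [rewrite dom => -[] | rewrite m].
Qed.

Lemma permute_chart c q r (s : {perm 'I_3}) : cubic_chart c q r ->
  exists c', [/\ cubic_chart c' q r, cdom c' `<=` cdom c
    & forall q' j, cmap c' q' 0 j = cmap c q' 0 (s j)].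
Proof.
move=> [r0 Sc cq cE].
pose perm (t : {perm 'I_3}) (x : coords R) : coords R := \row_j x 0 (t j).
have oC p := @open_cube R p r.
have sp t U j : smooth_on U (fun x => perm t x 0 j).
  rewrite (_ : (fun x => _) = fun x : coords R => x 0 (t j)); first exact: smooth_coord.
  by apply/funext => x; rewrite mxE.
have [||||||||c' [Sc' dom img m]] := @diffeo_chart c _
  (cube (perm s (cmap c q)) r) (perm s) (perm (s^-1)%g) Sc (oC (cmap c q)).
- by rewrite cE.
- exact: oC.
- by move=> x px j; rewrite !mxE; exact: px.
- by move=> y py j; have := py ((s^-1)%g j); rewrite !mxE permKV.
- by move=> x _; apply/rowP => j; rewrite !mxE permKV.
- by move=> x _; apply/rowP => j; rewrite !mxE permK.
- by move=> j; exact: sp.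
- by move=> j; exact: sp.
exists c'; split => //.
- split=> //; last by rewrite m.
  by rewrite dom; split => //; exact: cube_center.
- by rewrite dom => z [].
- by move=> q' j; rewrite m mxE.
Qed.

Lemma jac_replaced i phi c c' q : atlas S c -> atlas S c' ->
  replaced i phi c c' -> cdom c' q ->
  jac c c' (cmap c q) =
  \matrix_(a, b) if b == i then partial a phi (cmap c q) else (a == b)%:R.
Proof.
move=> Sc Sc' [sub rp] c'q; apply/matrixP => a b; rewrite !mxE.
have oO := @open_overlap c c'.
have xO : overlap c c' (cmap c q) by apply: overlap_cmap => //; exact: sub.
rewrite (@eq_partial _ _ _ (fun x => setc i (phi x) x 0 b) a oO _ _ xO).
  have -> : (fun x => setc i (phi x) x 0 b)
      = if b == i then phi else (fun x : coords R => x 0 b).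
    by apply/funext => x; rewrite setcE; case: eqP.
  by case: eqP => // _; exact: partial_coord.
move=> x [z [cz c'z] <-]; rewrite transition_cmap // rp //.
Qed.

Lemma jac_permuted (s : {perm 'I_3}) c c' q : cdom c' `<=` cdom c ->
  (forall q' j, cmap c' q' 0 j = cmap c q' 0 (s j)) -> cdom c' q ->
  jac c c' (cmap c q) = \matrix_(a, b) (a == s b)%:R.
Proof.
move=> sub rp c'q; apply/matrixP => a b; rewrite !mxE.
have oO := @open_overlap c c'.
have xO : overlap c c' (cmap c q) by apply: overlap_cmap => //; exact: sub.
rewrite (@eq_partial _ _ _ (fun x : coords R => x 0 (s b)) a oO _ _ xO).
  exact: partial_coord.
by move=> x [z [cz c'z] <-]; rewrite transition_cmap // rp.
Qed.

(** The set where f has a given value and its complement are both open. *)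
Lemma connected_const (T : Type) (f : M -> T) : connected [set: M] ->
  (forall q, exists2 A, nbhs q A & forall q', A q' -> f q' = f q) ->
  forall q q', f q = f q'.
Proof.
move=> cM lc q q'.
have fop q1 : open [set z | f z = f q1].
  rewrite openE => z /= fz; rewrite /interior.
  by have [A nA hA] := lc z; apply: filterS nA => w /hA /= ->.
have fcl : open [set z | f z <> f q].
  rewrite openE => z /= fz; rewrite /interior.
  by have [A nA hA] := lc z; apply: filterS nA => w /hA /= ->.
have -> // : [set z | f z = f q] = [set: M] -> f q = f q'.
  by move=> e; have : [set z | f z = f q] q' by rewrite e.
apply: cM; first by exists q.
- by exists [set z | f z = f q] => //; rewrite setTI.
- exists [set z | f z = f q]; last by rewrite setTI.
  rewrite -openC (_ : ~` _ = [set z | f z <> f q]) //.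
Qed.

End Charts.
#[local] Opaque partial smooth_on.

(** * Poincare lemmas on cubes *)

Section Poincare.
Variable R : realType.
Implicit Types (p x : coords R) (i j k : 'I_3) (f : coords R -> R) (r : R).

Lemma partial_ext_cube p r f g i x : 
  (forall x, cube p r x -> f x = g x) -> cube p r x ->
  partial i f x = partial i g x.
Proof. by move=> fg; exact: (eq_partial i (@open_cube R p r) fg). Qed.

Lemma schwarz_cube p r f i j x : smooth_on (cube p r) f -> cube p r x ->
  partial i (partial j f) x = partial j (partial i f) x.
Proof.
by move=> sf px; apply: (schwarz i j (@open_cube R p r)) => //; exact: smooth_ck.
Qed.

Lemma smaller_radius r : 0 < r -> exists2 rho, 0 < rho & rho < r.
Proof. by move=> r0; exists (r / 2); lra. Qed.

(** Integrate a in direction i and correct by a primitive, in direction k, of the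
    defect, which no longer depends on the i-th coordinate; the remaining
    coordinate is a parameter. *)
Lemma poincare2 p r i k (a b : coords R -> R) : 0 < r -> i != k ->
  smooth_on (cube p r) a -> smooth_on (cube p r) b ->
  (forall x, cube p r x -> partial i b x = partial k a x) ->
  exists rho v, [/\ 0 < rho < r /\ smooth_on (cube p rho) v,
    forall x, cube p rho x -> partial i v x = a x,
    forall x, cube p rho x -> partial k v x = b x
    & forall j, j != i -> j != k ->
      (forall x, cube p r x -> partial j a x = 0 /\ partial j b x = 0) ->
      forall x, cube p rho x -> partial j v x = 0].
Proof.
move=> r0 ik sa sb cl.
have [r2 h2 h2r] := smaller_radius r0; have [r4 h4 h42] := smaller_radius h2.
have s2 : cube p r2 `<=` cube p r by apply: subcube; exact: ltW.
have s4 : cube p r4 `<=` cube p r2 by apply: subcube; exact: ltW.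
have [v1 [sv1 dv1 iv1]] := primitive h2 h2r i sa.
have o2 := @open_cube R p r2; have o4 := @open_cube R p r4.
have sb2 : smooth_on (cube p r2) b by exact: smooth_sub s2 sb.
have skv1 := smooth_partial k sv1.
pose b' x := b x - partial k v1 x.
have sb' : smooth_on (cube p r2) b' by exact: (smoothB o2 sb2 skv1).
have db' j x : cube p r2 x ->
    partial j b' x = partial j b x - partial k (partial j v1) x.
  move=> px; rewrite (smooth_partialB j sb2 skv1 px).
  by rewrite (schwarz_cube j k sv1 px).
have ib' x : cube p r2 x -> partial i b' x = 0.
  move=> px; rewrite db' // (partial_ext_cube k dv1 px) (cl _ (s2 _ px)).
  exact: subrr.
have [v2 [sv2 dv2 iv2]] := primitive h4 h42 k sb'.
have sv1' : smooth_on (cube p r4) v1 by exact: smooth_sub s4 sv1.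
exists r4, (fun x => v1 x + v2 x); split.
- by split; [rewrite h4 (lt_trans h42) | exact: (smoothD o4 sv1' sv2)].
- move=> x px; rewrite (smooth_partialD i sv1' sv2 px).
  by rewrite (dv1 _ (s4 _ px)) (iv2 i ik ib' _ px) addr0.
- move=> x px; rewrite (smooth_partialD k sv1' sv2 px).
  by rewrite (dv2 _ px) /b' addrC subrK.
- move=> j ji jk ab0 x px; rewrite (smooth_partialD j sv1' sv2 px).
  have j1 : forall x, cube p r2 x -> partial j v1 x = 0.
    by apply: (iv1 j ji) => y /ab0[].
  rewrite (j1 _ (s4 _ px)) add0r.
  apply: (iv2 j jk) px => y py.
  rewrite (db' _ _ py) (partial_ext_cube k j1 py) partial_cst subr0.
  by case: (ab0 y (s2 _ py)).
Qed.

(** [poincare2] leaves a defect in the third direction that depends on the third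
    coordinate alone. *)
Lemma poincare3 p r (a : 'I_3 -> coords R -> R) : 0 < r ->
  (forall i, smooth_on (cube p r) (a i)) ->
  (forall i j x, cube p r x -> partial i (a j) x = partial j (a i) x) ->
  exists rho v, [/\ 0 < rho < r, smooth_on (cube p rho) v
    & forall i x, cube p rho x -> partial i v x = a i x].
Proof.
move=> r0 sa cl.
have [r2 h2 h2r] := smaller_radius r0.
have s2 : cube p r2 `<=` cube p r by apply: subcube; exact: ltW.
have [v0 [sv0 dv0 _]] := primitive h2 h2r 0 (sa 0).
have o2 := @open_cube R p r2.
have sa2 j : smooth_on (cube p r2) (a j) by exact: smooth_sub s2 (sa j).
have sdv j : smooth_on (cube p r2) (partial j v0) by exact: smooth_partial.
pose b j x := a j x - partial j v0 x.
have sb j : smooth_on (cube p r2) (b j) by exact: (smoothB o2 (sa2 j) (sdv j)).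
have db i j x : cube p r2 x ->
    partial i (b j) x = partial i (a j) x - partial i (partial j v0) x.
  exact: (smooth_partialB i (sa2 j) (sdv j)).
have cb i j x : cube p r2 x -> partial i (b j) x = partial j (b i) x.
  move=> px; rewrite (db i j x px) (db j i x px) (schwarz_cube i j sv0 px).
  by rewrite (cl i j x (s2 _ px)).
have b0 j x : cube p r2 x -> partial 0 (b j) x = 0.
  move=> px; rewrite (cb 0 j x px) (db j 0 x px) (partial_ext_cube j dv0 px).
  exact: subrr.
have [rho [v1 [[rho0 sv1] d1 d2 d0]]] :=
  @poincare2 p r2 1 2%:R (b 1) (b 2%:R) h2 isT (sb 1) (sb 2%:R) (cb 1 2%:R).
have [rho1 rho2] := andP rho0.
have s8 : cube p rho `<=` cube p r2 by apply: subcube; exact: ltW.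
have sv0' : smooth_on (cube p rho) v0 by exact: smooth_sub s8 sv0.
exists rho, (fun x => v0 x + v1 x); split.
- by rewrite rho1 (lt_trans rho2).
- exact: (smoothD (@open_cube R p rho) sv0' sv1).
move=> i x px; rewrite (smooth_partialD i sv0' sv1 px).
have px2 := s8 _ px.
move: i; apply: all3.
- rewrite (dv0 _ px2) (d0 0 isT isT _ _ px) ?addr0 //.
  by move=> y py; split; exact: b0.
- by rewrite (d1 _ px) /b addrC subrK.
- by rewrite (d2 _ px) /b addrC subrK.
Qed.

End Poincare.

(** * Lorentzian metrics with a parallel field, in one chart *)

Section OneChart.
Variable R : realType.
Implicit Types (G : tensor2 R) (X : vfield R) (x : coords R) (i j k l m : 'I_3).

Lemma lorentzian_sym_unit G x : lorentzian_at G x ->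
  (G x)^T = G x /\ G x \in unitmx.
Proof.
case=> P Pu PG.
have PT : P^T \in unitmx by rewrite unitmx_tr.
split.
- have : (P *m G x *m P^T)^T = P *m G x *m P^T by rewrite PG tr_diag_mx.
  rewrite !trmx_mul trmxK mulmxA.
  by move=> /(can_inj (mulmxK PT))/(can_inj (mulKmx Pu)).
- have : P *m G x *m P^T \in unitmx.
    rewrite PG unitmxE det_diag big_ord_recl /= mxE /=.
    by rewrite big1 ?mulr1 ?unitrN1 // => i _; rewrite mxE.
  by rewrite !unitmx_mul => /andP[/andP[]].
Qed.

(** In an orthonormal basis of signature (-,+,+), if b is null and a is orthogonal
    to b, then [b_0^2 g(a,a) = (a_1 b_2 - a_2 b_1)^2], which vanishes only if a is
    proportional to b. *)
Lemma orthogonal_to_null G x (V X : coords R) : lorentzian_at G x ->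
  V != 0 -> inner G x V V = 0 -> inner G x V X = 0 ->
  0 < inner G x X X \/ exists a, X = a *: V.
Proof.
case=> P Pu PG V0.
pose co (Y : coords R) := Y *m invmx P.
have coK Y : co Y *m P = Y by rewrite /co mulmxKV.
have PT : P^T \in unitmx by rewrite unitmx_tr.
have innerE Y Z : inner G x Y Z = - (co Y 0 0 * co Z 0 0)
    + co Y 0 1 * co Z 0 1 + co Y 0 2%:R * co Z 0 2%:R.
  rewrite /inner -{1}(coK Y) -{1}(coK Z) trmx_mul !mulmxA.
  rewrite -(mulmxA (co Y)) -(mulmxA (co Y)) PG mxE sum3.
  have e k : (co Y *m diag_mx (\row_i (if i == 0 then -1 else 1 : R))) 0 k
      = co Y 0 k * (if k == 0 then -1 else 1) by rewrite mul_mx_diag !mxE.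
  by rewrite !e !mxE /=; ring.
rewrite !innerE.
set a0 := co X 0 0; set a1 := co X 0 1; set a2 := co X 0 2%:R.
set b0 := co V 0 0; set b1 := co V 0 1; set b2 := co V 0 2%:R => nV oV.
have b00 : b0 != 0.
  apply/eqP => e; have h : b1 ^+ 2 + b2 ^+ 2 = 0 by rewrite -[RHS]nV e; ring.
  have /eqP := h; rewrite paddr_eq0 ?sqr_ge0 // !sqrf_eq0 => /andP[/eqP z1 /eqP z2].
  have cV : co V = 0 by apply/rowP; apply: all3; rewrite [RHS]mxE.
  by move/eqP: V0; apply; rewrite -(coK V) cV mul0mx.
have b2p : 0 < b0 ^+ 2 by rewrite exprn_even_gt0.
have key : b0 ^+ 2 * (- (a0 * a0) + a1 * a1 + a2 * a2) = (a1 * b2 - a2 * b1) ^+ 2.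
  have -> : a1 * a1 = a1 ^+ 2 by ring.
  have e0 : b0 * a0 = b1 * a1 + b2 * a2.
    by apply/eqP; rewrite -subr_eq0 -oppr_eq0 -oV; apply/eqP; ring.
  have e1 : b0 ^+ 2 = b1 ^+ 2 + b2 ^+ 2.
    by apply/eqP; rewrite -subr_eq0 -oppr_eq0 -nV; apply/eqP; ring.
  transitivity (- (b0 * a0) ^+ 2 + b0 ^+ 2 * (a1 ^+ 2 + a2 ^+ 2)); first by ring.
  by rewrite e0 e1; ring.
have [e|ne] := eqVneq (a1 * b2 - a2 * b1) 0; last first.
  left; rewrite -(pmulr_rgt0 _ b2p) key lt0r sqr_ge0 andbT.
  by rewrite sqrf_eq0.
right; exists (a0 / b0).
suff cX : co X = (a0 / b0) *: co V by rewrite -(coK X) cX -scalemxAl coK.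
have e0 : a0 = (b1 * a1 + b2 * a2) / b0.
  apply: (canRL (mulfK b00)); apply/eqP; rewrite -subr_eq0 -oppr_eq0 -oV.
  by apply/eqP; ring.
have e1 : b0 ^+ 2 = b1 ^+ 2 + b2 ^+ 2.
  by apply/eqP; rewrite -subr_eq0 -oppr_eq0 -nV; apply/eqP; ring.
have f1 : a1 * b2 = a2 * b1 by apply/eqP; rewrite -subr_eq0 e.
have b2n : b0 ^+ 2 != 0 by rewrite gt_eqF.
apply/rowP; apply: all3; rewrite [RHS]mxE -/a0 -/a1 -/a2 -/b0 -/b1 -/b2.
- by rewrite divfK.
- apply: (mulfI b2n); rewrite e0.
  transitivity ((b1 * a1 + b2 * a2) * b1); last by field.
  by rewrite e1; transitivity (b1 * a1 * b1 + b2 * (a1 * b2)); [ring | rewrite f1; ring].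
- apply: (mulfI b2n); rewrite e0.
  transitivity ((b1 * a1 + b2 * a2) * b2); last by field.
  by rewrite e1; transitivity (b1 * (a2 * b1) + b2 * a2 * b2); [ring | rewrite -f1; ring].
Qed.

Lemma sum_mulmxV (A : 'M[R]_3) (F : 'I_3 -> R) j : A \in unitmx ->
  \sum_k A j k * \sum_m invmx A k m * F m = F j.
Proof.
move=> Au; have /matrixP AV := mulmxV Au.
transitivity (\sum_m (A *m invmx A) j m * F m).
  under [RHS]eq_bigr do rewrite mxE mulr_suml.
  rewrite exchange_big /=; apply: eq_bigr => k _.
  by rewrite mulr_sumr; apply: eq_bigr => m _; rewrite mulrA.
under eq_bigr do rewrite AV.
rewrite (bigD1 j) //= mxE eqxx mul1r big1 ?addr0 // => m mj.
by rewrite mxE eq_sym (negbTE mj) mul0r.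
Qed.

(** Christoffel symbols of the first kind. *)
Definition christoffel1 G i j l x : R :=
  2^-1 * (partial i (fun y => G y j l) x + partial j (fun y => G y i l) x
     - partial l (fun y => G y i j) x).

Lemma christoffel_lower G i j l x : G x \in unitmx ->
  \sum_k G x l k * christoffel G k i j x = christoffel1 G i j l x.
Proof.
move=> Gu; rewrite /christoffel1.
pose F l := partial i (fun y => G y j l) x + partial j (fun y => G y i l) x
     - partial l (fun y => G y i j) x.
rewrite -[_ - _]/(F l) -(sum_mulmxV F l Gu) mulr_sumr; apply: eq_bigr => k _.
by rewrite /christoffel -/(F _); ring.
Qed.

Definition lower G X j x : R := \sum_k G x j k * X x 0 k.

Section Parallel.
Variables (U : set (coords R)) (G : tensor2 R) (X : vfield R).
Hypotheses (oU : open U) (sG : forall i j, smooth_on U (fun x => G x i j)).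
Hypotheses (sX : forall k, smooth_on U (fun x => X x 0 k)).
Hypothesis GT : forall x, U x -> (G x)^T = G x.
Hypothesis Gu : forall x, U x -> G x \in unitmx.
Hypothesis par : forall x, U x -> parallel_at G X x.

Lemma sym_entry x i j : U x -> G x i j = G x j i.
Proof. by move=> /GT {1}<-; rewrite mxE. Qed.

Lemma sym_partial m x i j : U x ->
  partial m (fun y => G y i j) x = partial m (fun y => G y j i) x.
Proof. by apply: (eq_partial _ oU) => y; exact: sym_entry. Qed.

Lemma smooth_lower j : smooth_on U (lower G X j).
Proof. by apply: (smooth_sum _ oU) => k; exact: (smoothM oU (sG j k) (sX k)). Qed.

Lemma partial_lower i j x : U x -> partial i (lower G X j) x =
  \sum_k (G x j k * partial i (fun y => X y 0 k) x
          + X x 0 k * partial i (fun y => G y j k) x).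
Proof.
move=> Ux; rewrite /lower.
have -> : (fun x => \sum_k G x j k * X x 0 k) =
    (fun x => G x j 0 * X x 0 0 + G x j 1 * X x 0 1 + G x j 2%:R * X x 0 2%:R).
  by apply/funext => y; rewrite sum3.
have dG k : derivable (fun y => G y j k) x (delta_mx 0 i).
  exact: smooth_derivable (sG j k) Ux.
have dX k : derivable (fun y => X y 0 k) x (delta_mx 0 i).
  exact: smooth_derivable (sX k) Ux.
have dM k : derivable (fun y => G y j k * X y 0 k) x (delta_mx 0 i).
  exact: derivableM.
have dMD : derivable (fun y => G y j 0 * X y 0 0 + G y j 1 * X y 0 1) x (delta_mx 0 i).
  exact: derivableD.
rewrite (partialD dMD (dM 2%:R)) (partialD (dM 0) (dM 1)).
by rewrite !(partialM (dG _) (dX _)) sum3.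
Qed.

Lemma parallel_lower i j x : U x -> partial i (lower G X j) x =
  2^-1 * \sum_l X x 0 l * (partial i (fun y => G y l j) x
    + partial j (fun y => G y i l) x - partial l (fun y => G y i j) x).
Proof.
move=> Ux; rewrite partial_lower //.
have := par Ux; rewrite /parallel_at /covd => p.
have : \sum_k G x j k * (partial i (fun y => X y 0 k) x
   + \sum_l christoffel G k i l x * X x 0 l) = 0.
  by rewrite big1 // => k _; rewrite p mulr0.
have -> : \sum_k G x j k * (partial i (fun y => X y 0 k) x
   + \sum_l christoffel G k i l x * X x 0 l) =
   \sum_k G x j k * partial i (fun y => X y 0 k) x
   + \sum_l christoffel1 G i l j x * X x 0 l.
  under eq_bigr do rewrite mulrDr.
  rewrite big_split /=; congr (_ + _).
  under eq_bigr do rewrite mulr_sumr.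
  rewrite exchange_big /=; apply: eq_bigr => l _.
  rewrite -(christoffel_lower _ _ _ (Gu Ux)) mulr_suml; apply: eq_bigr => k _.
  by rewrite mulrA.
move=> /eqP; rewrite addr_eq0 => /eqP e.
rewrite big_split /= e -sumrN -big_split mulr_sumr /=; apply: eq_bigr => l _.
by rewrite /christoffel1 (sym_partial _ l j Ux) (sym_partial _ j l Ux) //; field.
Qed.

(** The right-hand side of [parallel_lower] is symmetric in i and j. *)
Lemma parallel_closed i j x : U x ->
  partial i (lower G X j) x = partial j (lower G X i) x.
Proof.
move=> Ux; rewrite !parallel_lower //; congr (_ * _); apply: eq_bigr => l _.
by rewrite (sym_partial l i j Ux) (sym_partial i l j Ux) (sym_partial j l i Ux); ring.
Qed.

(** The left-hand side is the Lie derivative of g along X, which is twice the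
    symmetric part of the covariant derivative of the 1-form dual to X. *)
Lemma parallel_killing i j x : U x ->
  \sum_l (X x 0 l * partial l (fun y => G y i j) x
    + G x l j * partial i (fun y => X y 0 l) x
    + G x i l * partial j (fun y => X y 0 l) x) = 0.
Proof.
move=> Ux.
have e1 := partial_lower i j Ux; have e2 := partial_lower j i Ux.
have e3 := parallel_lower i j Ux; have e4 := parallel_closed i j Ux.
have f1 : \sum_l (G x j l * partial i (fun y => X y 0 l) x) =
   partial i (lower G X j) x - \sum_l X x 0 l * partial i (fun y => G y j l) x.
  by rewrite e1 big_split /= addrK.
have f2 : \sum_l (G x i l * partial j (fun y => X y 0 l) x) =
   partial i (lower G X j) x - \sum_l X x 0 l * partial j (fun y => G y i l) x.
  by rewrite e4 e2 big_split /= addrK.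
rewrite !big_split /=.
under [X in _ + X + _]eq_bigr do rewrite (sym_entry _ _ Ux).
rewrite f1 f2 e3 mulr_sumr -!sumrN -!big_split /=; apply: big1 => l _.
by rewrite (sym_partial i j l Ux); field.
Qed.

End Parallel.

End OneChart.
(** * Brinkmann coordinates of a pp-wave *)

Section Sqrt.
Variable R : realType.
Implicit Types (f : coords R -> R) (x : coords R) (i : 'I_3).

Lemma is_derive_comp1 (phi : R -> R) f x i (D : R) :
  derivable f x (delta_mx 0 i) -> is_derive (f x) 1 phi D ->
  is_derive x (delta_mx 0 i) (fun y => phi (f y)) (D * partial i f x).
Proof.
move=> df dphi.
have df' : derivable f (setc i (x 0 i) x) (delta_mx 0 i) by rewrite setc_id.
have h0 := is_derive_slice df'; rewrite setc_id in h0.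
have dphi' : is_derive (f (setc i (x 0 i) x)) 1 phi D by rewrite setc_id.
have h1 := is_derive1_comp dphi' h0.
have h3 := @derive_slice _ (fun y => phi (f y)) i (x 0 i) x.
case: h1 => k1 k2.
have h4 := (@derivable_slice _ (fun y => phi (f y)) i (x 0 i) x).2 k1.
rewrite setc_id in h4; rewrite setc_id in h3.
by apply: (DeriveDef h4); rewrite -[LHS]h3 -k2.
Qed.

Lemma smooth_sqrt (U : set (coords R)) f : open U -> (forall x, U x -> 0 < f x) ->
  smooth_on U f -> smooth_on U (fun x => Num.sqrt (f x)).
Proof.
move=> oU f0 sf.
have ds i x : U x -> is_derive x (delta_mx 0 i) (fun x => Num.sqrt (f x))
    ((2 * Num.sqrt (f x))^-1 * partial i f x).
  move=> Ux; apply: is_derive_comp1; first exact: smooth_derivable sf Ux.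
  by apply: is_derive1_sqrt; exact: f0.
have cs x : U x -> {for x, continuous (fun x => Num.sqrt (f x))}.
  move=> Ux; apply: (@continuous_comp _ _ _ f Num.sqrt).
    exact: smooth_cont sf Ux.
  exact: sqrt_continuous.
apply/smooth_onP; elim=> [|n IH]; first exact: cs.
split=> [|i x Ux|i]; [exact: cs | by case: (ds i x Ux) |].
have h : ck n U (fun x => (2 * Num.sqrt (f x))^-1 * partial i f x).
  apply: (ckM oU); last exact: smooth_ck (smooth_partial i sf).
  apply: (ckV oU); last exact: (ckM oU (ck_cst n U 2) IH).
  by move=> x Ux; rewrite mulf_neq0 // gt_eqF // sqrtr_gt0 f0.
by apply: (eq_ck oU _ h) => x Ux; case: (ds i x Ux).
Qed.

End Sqrt.

Section PPWave.
Variables (R : realType) (M : topologicalType) (S : smooth_structure R M).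
Variables (g : chart R M -> tensor2 R) (V : chart R M -> vfield R).
Hypotheses (lor : lorentz_metric S g) (pp : pp_field S g V).
Implicit Types (c : chart R M) (q : M) (i j k : 'I_3) (x y : coords R).

(** The 1-form dual to V. *)
Definition th c j : coords R -> R := lower (g c) (V c) j.

Lemma g_smooth c i j : atlas S c -> smooth_on (cimg c) (fun x => g c x i j).
Proof. by move=> Sc; case: lor => h _ _; exact: h. Qed.

Lemma V_smooth c k : atlas S c -> smooth_on (cimg c) (fun x => V c x 0 k).
Proof. by move=> Sc; case: pp => -[h _] _; exact: h. Qed.

Lemma g_lorentzian c x : atlas S c -> cimg c x -> lorentzian_at (g c) x.
Proof. by move=> Sc [q cq <-]; case: lor => _ _ h; exact: h. Qed.

Lemma g_sym c x : atlas S c -> cimg c x -> (g c x)^T = g c x.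
Proof. by move=> Sc cx; case: (lorentzian_sym_unit (g_lorentzian Sc cx)). Qed.

Lemma g_symE c x i j : atlas S c -> cimg c x -> g c x i j = g c x j i.
Proof. by move=> Sc cx; rewrite -{1}(g_sym Sc cx) mxE. Qed.

Lemma g_unit c x : atlas S c -> cimg c x -> g c x \in unitmx.
Proof. by move=> Sc cx; case: (lorentzian_sym_unit (g_lorentzian Sc cx)). Qed.

Lemma V_parallel c x : atlas S c -> cimg c x -> parallel_at (g c) (V c) x.
Proof. by move=> Sc [q cq <-]; case: pp => _ h; case: (h q c Sc cq). Qed.

Lemma V_neq0 c x : atlas S c -> cimg c x -> V c x != 0.
Proof. by move=> Sc [q cq <-]; case: pp => _ h; case: (h q c Sc cq). Qed.

Lemma inner_lower c x Y : atlas S c -> cimg c x ->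
  inner (g c) x (V c x) Y = \sum_j th c j x * Y 0 j.
Proof.
move=> Sc cx; rewrite /inner mxE; apply: eq_bigr => j _.
rewrite [_^T _ _]mxE; congr (_ * _); rewrite mxE; apply: eq_bigr => k _.
by rewrite mulrC (g_symE _ _ Sc cx).
Qed.

Lemma V_null c x : atlas S c -> cimg c x ->
  inner (g c) x (V c x) (V c x) = 0.
Proof. by move=> Sc [q cq <-]; case: pp => _ h; case: (h q c Sc cq). Qed.

Lemma th_V c x : atlas S c -> cimg c x -> \sum_j th c j x * V c x 0 j = 0.
Proof. by move=> Sc cx; rewrite -inner_lower //; exact: V_null. Qed.

Lemma th_smooth c j : atlas S c -> smooth_on (cimg c) (th c j).
Proof.
move=> Sc; apply: smooth_lower; first exact: open_cimg.
  by move=> *; exact: g_smooth.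
by move=> *; exact: V_smooth.
Qed.

Lemma th_closed c i j x : atlas S c -> cimg c x ->
  partial i (th c j) x = partial j (th c i) x.
Proof.
move=> Sc; apply: parallel_closed; first exact: open_cimg.
- by move=> *; exact: g_smooth.
- by move=> *; exact: V_smooth.
- by move=> y; exact: g_sym.
- by move=> y; exact: g_unit.
- by move=> y; exact: V_parallel.
Qed.

Lemma V_killing c i j x : atlas S c -> cimg c x ->
  \sum_l (V c x 0 l * partial l (fun y => g c y i j) x
    + g c x l j * partial i (fun y => V c y 0 l) x
    + g c x i l * partial j (fun y => V c y 0 l) x) = 0.
Proof.
move=> Sc; apply: parallel_killing; first exact: open_cimg.
- by move=> *; exact: g_smooth.
- by move=> *; exact: V_smooth.
- by move=> y; exact: g_sym.
- by move=> y; exact: g_unit.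
- by move=> y; exact: V_parallel.
Qed.

Lemma V_law c c' q : atlas S c -> atlas S c' -> cdom c q -> cdom c' q ->
  V c' (cmap c' q) = V c (cmap c q) *m jac c c' (cmap c q).
Proof.
move=> Sc Sc' cq c'q; case: pp => -[_ h] _.
by rewrite -(h c c' Sc Sc' _ (overlap_cmap cq c'q)) transition_cmap.
Qed.

Lemma g_law c c' q : atlas S c -> atlas S c' -> cdom c q -> cdom c' q ->
  g c (cmap c q) = jac c c' (cmap c q) *m g c' (cmap c' q)
                   *m (jac c c' (cmap c q))^T.
Proof.
move=> Sc Sc' cq c'q; case: lor => _ h _.
by rewrite [LHS](h c c' Sc Sc' _ (overlap_cmap cq c'q)) transition_cmap.
Qed.

Lemma lowerE c x j : th c j x = (g c x *m (V c x)^T) j 0.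
Proof. by rewrite /th /lower mxE; apply: eq_bigr => k _; rewrite [_^T _ _]mxE. Qed.

Lemma th_law c c' q j : atlas S c -> atlas S c' -> cdom c q -> cdom c' q ->
  th c j (cmap c q) = \sum_k jac c c' (cmap c q) j k * th c' k (cmap c' q).
Proof.
move=> Sc Sc' cq c'q; rewrite lowerE (g_law Sc Sc' cq c'q).
rewrite -!mulmxA -trmx_mul -(V_law Sc Sc' cq c'q) mxE.
by apply: eq_bigr => k _; rewrite -lowerE.
Qed.

(** Brinkmann coordinates are reached through a chain of such charts, each obtained
    from the previous one by replacing one coordinate. *)
Definition adapted (A : chart R M -> coords R -> Prop) q :=
  exists c r, cubic_chart S c q r /\ forall x, cimg c x -> A c x.

Section Replaced.
Variables (c c' : chart R M) (i : 'I_3) (phi : coords R -> R).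
Hypotheses (Sc : atlas S c) (Sc' : atlas S c') (rp : replaced i phi c c').
Variable q : M.
Hypothesis c'q : cdom c' q.
Let x := cmap c q.
Let y := cmap c' q.

Let cq : cdom c q. Proof. by case: rp => h _; exact: h. Qed.

Lemma V_replaced k : V c' y 0 k =
  if k == i then \sum_a V c x 0 a * partial a phi x else V c x 0 k.
Proof.
rewrite (V_law Sc Sc' cq c'q) (jac_replaced Sc Sc' rp c'q) mxE.
case: eqP => [ki|/eqP ki].
  by apply: eq_bigr => a _; rewrite mxE ki eqxx.
rewrite (bigD1 k) //= big1 ?addr0; first by rewrite mxE (negbTE ki) eqxx mulr1.
by move=> a ak; rewrite mxE (negbTE ki) (negbTE ak) mulr0.
Qed.

Lemma th_replaced a : th c a x =
  (if a == i then 0 else th c' a y) + partial a phi x * th c' i y.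
Proof.
rewrite (th_law a Sc Sc' cq c'q) (jac_replaced Sc Sc' rp c'q).
rewrite (bigD1 i) //= mxE eqxx addrC; congr (_ + _).
case: eqP => [->|/eqP ai].
  by rewrite big1 // => k ki; rewrite mxE (negbTE ki) eq_sym (negbTE ki) mul0r.
rewrite (bigD1 a) //= big1 ?addr0; first by rewrite mxE (negbTE ai) eqxx mul1r.
by move=> k /andP[ki ka]; rewrite mxE (negbTE ki) eq_sym (negbTE ka) mul0r.
Qed.

Lemma g_replaced a b : g c x a b =
  \sum_l (\sum_k (if k == i then partial a phi x else (a == k)%:R) * g c' y k l)
    * (if l == i then partial b phi x else (b == l)%:R).
Proof.
rewrite (g_law Sc Sc' cq c'q) (jac_replaced Sc Sc' rp c'q) mxE.
apply: eq_bigr => l _; rewrite !mxE; congr (_ * _).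
by apply: eq_bigr => k _; rewrite !mxE.
Qed.

End Replaced.

Lemma cimgP c y : cimg c y -> exists2 q, cdom c q & y = cmap c q.
Proof. by move=> [q cq <-]; exists q. Qed.

Lemma coord_replaced c c' : cdom c' `<=` cdom c ->
  (forall q, cmap c' q = cmap c q) -> replaced 0 (fun x => x 0 0) c c'.
Proof. by move=> sub e; split=> // q _; rewrite e setc_id. Qed.

Lemma same_chart c c' q : atlas S c -> atlas S c' -> cdom c' `<=` cdom c ->
  (forall q, cmap c' q = cmap c q) -> cdom c' q ->
  V c' (cmap c' q) = V c (cmap c' q) /\ g c' (cmap c' q) = g c (cmap c' q).
Proof.
move=> Sc Sc' sub e c'q; have rp := coord_replaced sub e.
have cq := sub _ c'q.
have J : jac c c' (cmap c q) = 1%:M.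
  rewrite (jac_replaced Sc Sc' rp c'q); apply/matrixP => a b; rewrite !mxE.
  by case: eqP => [->|_] //; rewrite partial_coord.
have h1 := V_law Sc Sc' cq c'q; have h2 := g_law Sc Sc' cq c'q.
by rewrite J mulmx1 in h1; rewrite J mul1mx trmx1 mulmx1 in h2;
  rewrite e in h1 h2 *; split.
Qed.

(** A restriction of a chart has the same components of g and V. *)
Lemma shrink_adapted (A : 'M[R]_3 -> coords R -> Prop) c q r (N : set (coords R)) :
  cubic_chart S c q r -> (forall x, cimg c x -> A (g c x) (V c x)) ->
  nbhs (cmap c q) N ->
  exists c' r', [/\ cubic_chart S c' q r', cmap c' q = cmap c q,
    forall x, cimg c' x -> A (g c' x) (V c' x),
    forall x, cimg c' x -> N x /\ cimg c x
    & forall x, cimg c' x -> V c' x = V c x /\ g c' x = g c x].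
Proof.
move=> [r0 Sc cq cE] Ac nN.
have : nbhs (cmap c q) (N `&` cimg c).
  apply: filterI => //; rewrite cE; exact: nbhs_cube.
move=> /nbhs_sub_cube[r' r'0 sub].
have [c' [cub' sub' e]] := shrink_chart Sc cq r'0 (fun x h => (sub x h).2).
have [_ Sc' c'q c'E] := cub'.
have same x : cimg c' x -> V c' x = V c x /\ g c' x = g c x.
  by move=> /cimgP[z c'z ->]; exact: same_chart.
have sub2 x : cimg c' x -> N x /\ cimg c x.
  by rewrite c'E e => /sub[].
exists c', r'; split => //.
by move=> x c'x; have [-> ->] := same x c'x; apply: Ac; case: (sub2 x c'x).
Qed.

Lemma perm_onto01 (a b : 'I_3) : a != b -> exists s : {perm 'I_3}, s 0 = a /\ s 1 = b.
Proof.
move=> ab; pose s1 := tperm 0 a; pose b' := s1 b.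
have b'0 : b' != 0.
  rewrite -(tpermR 0 a) -/s1 (inj_eq perm_inj) eq_sym //.
exists (tperm 1%R b' * s1)%g; split; rewrite permM.
  have e0 : tperm 1 b' 0 = 0 by apply: tpermD.
  by rewrite e0; exact: tpermL.
by rewrite tpermL /b' tpermK.
Qed.

(** Since V is null, a suitable order of the coordinates makes the first component
    of V and the second component of its dual 1-form nonzero. *)
Lemma transverse_chart q : adapted (fun c x => V c x 0 0 != 0 /\ th c 1 x != 0) q.
Proof.
have [c [r cub]] := cubic_chart_exists S q; have [r0 Sc cq cE] := cub.
have cx := cimg_cmap cq; set x := cmap c q in cx.
have Vn := V_neq0 Sc cx.
have [k Vk] : exists k, V c x 0 k != 0.
  apply: contrapT => h; move/eqP: Vn; apply; apply/rowP => k; rewrite mxE.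
  by apply/eqP/negPn/negP => hk; apply: h; exists k.
have [l lk tl] : exists2 l, l != k & th c l x != 0.
  apply: contrapT => h.
  have h0 l : l != k -> th c l x = 0.
    by move=> lk; apply/eqP/negPn/negP => hl; apply: h; exists l.
  have := th_V Sc cx; rewrite (bigD1 k) //= big1 ?addr0; last first.
    by move=> l lk; rewrite h0 // mul0r.
  move/eqP; rewrite mulf_eq0 (negbTE Vk) orbF => /eqP tk.
  have t0 : g c x *m (V c x)^T = 0.
    apply/matrixP => l b; rewrite ord1 -lowerE [RHS]mxE.
    by have [->|/h0] := eqVneq l k.
  have : (V c x)^T = 0 by rewrite -(mulKmx (g_unit Sc cx) (V c x)^T) t0 mulmx0.
  by move=> /(congr1 trmx); rewrite trmxK trmx0 => /eqP; apply/negP.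
rewrite eq_sym in lk.
have [s [s0 s1]] := perm_onto01 lk.
have [c1 [cub1 sub1 m1]] := permute_chart s cub.
have [_ Sc1 c1q c1E] := cub1.
have J := jac_permuted sub1 m1 c1q.
have V0 : V c1 (cmap c1 q) 0 0 != 0.
  rewrite (V_law Sc Sc1 cq c1q) J mxE (bigD1 k) //= big1 ?addr0.
    by rewrite mxE s0 eqxx mulr1.
  by move=> a ak; rewrite mxE s0 (negbTE ak) mulr0.
have t1 : th c1 1 (cmap c1 q) != 0.
  have := th_law l Sc Sc1 cq c1q; rewrite J (bigD1 1) //= big1 ?addr0.
    by rewrite mxE s1 eqxx mul1r => <-.
  by move=> a a1; rewrite mxE -s1 (inj_eq perm_inj) eq_sym (negbTE a1) mul0r.
have c1x := cimg_cmap c1q.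
have [] := @shrink_adapted (fun _ _ => True) c1 q r
  ([set z | V c1 z 0 0 != 0] `&` [set z | th c1 1 z != 0]) cub1.
- by [].
- have n1 := cvgr_neq0 _ (smooth_cont (V_smooth 0 Sc1) c1x) V0.
  have n2 := cvgr_neq0 _ (smooth_cont (th_smooth 1 Sc1) c1x) t1.
  by apply: filterI; [exact: n1 | exact: n2].
move=> c' [r' [cub' _ _ N same]]; exists c', r'; split=> // z c'z.
have [[h1 h2] _] := N z c'z; have [e1 e2] := same z c'z.
by rewrite lowerE e1 e2 -lowerE.
Qed.


Lemma cubic_cimg c q r : cubic_chart S c q r -> cimg c (cmap c q).
Proof. by move=> [_ _ cq _]; exact: cimg_cmap. Qed.

Lemma shrink_to c q r rho : cubic_chart S c q r -> 0 < rho < r ->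
  exists c1, [/\ cubic_chart S c1 q rho, cmap c1 q = cmap c q,
    cimg c1 = cube (cmap c q) rho, forall x, cimg c1 x -> cimg c x
    & forall x, cimg c1 x -> V c1 x = V c x /\ g c1 x = g c x].
Proof.
move=> [r0 Sc cq cE] /andP[rho0 rhor].
have sub : cube (cmap c q) rho `<=` cimg c.
  by rewrite cE; apply: subcube; exact: ltW.
have [c1 [cub1 sub1 e]] := shrink_chart Sc cq rho0 sub.
have [_ Sc1 c1q c1E] := cub1.
exists c1; split => //; first by rewrite c1E e.
  by rewrite c1E e.
by move=> x /cimgP[z c1z ->]; exact: same_chart.
Qed.

Lemma th_same c c1 x j : V c1 x = V c x /\ g c1 x = g c x -> th c1 j x = th c j x.
Proof. by move=> [e1 e2]; rewrite !lowerE e1 e2. Qed.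

(** The dual 1-form of V is closed; take a primitive as second coordinate v. *)
Lemma v_chart q : adapted (fun c x =>
  V c x 0 0 != 0 /\ forall j, th c j x = (j == 1)%:R) q.
Proof.
have [c [r [cub A1]]] := transverse_chart q; have [r0 Sc cq cE] := cub.
have sth j : smooth_on (cube (cmap c q) r) (th c j) by rewrite -cE; exact: th_smooth.
have cth i j x : cube (cmap c q) r x -> partial i (th c j) x = partial j (th c i) x.
  by rewrite -cE; exact: th_closed.
have [rho [v [rhor sv dv]]] := poincare3 r0 sth cth.
have [c1 [cub1 e1 c1E sub1 same1]] := shrink_to cub rhor.
have [_ Sc1 c1q _] := cub1.
have sv1 : smooth_on (cimg c1) v by rewrite c1E.
have c1x := cubic_cimg cub1.
have dv1 i x : cimg c1 x -> partial i v x = th c1 i x.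
  by move=> h; rewrite (th_same _ (same1 x h)); apply: dv; rewrite -c1E.
have A1' x : cimg c1 x -> V c1 x 0 0 != 0 /\ th c1 1 x != 0.
  move=> h; rewrite (th_same _ (same1 x h)); have [-> _] := same1 x h.
  by apply: A1; exact: sub1.
have d0 : partial 1 v (cmap c1 q) != 0 by rewrite dv1 //; case: (A1' _ c1x).
have [c2 [d [cub2 rp]]] := replace_chart cub1 sv1 d0.
have [_ Sc2 _ _] := cub2; have [sub2 _] := rp.
exists c2, d; split=> // _ /cimgP[z c2z ->].
have c1z := cimg_cmap (sub2 _ c2z).
have [V0 t1] := A1' _ c1z.
have T a := th_replaced Sc1 Sc2 rp c2z a.
rewrite (V_replaced Sc1 Sc2 rp c2z) /=; split => //.
have th1 : th c2 1 (cmap c2 z) = 1.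
  apply: (mulfI t1); rewrite mulr1 -{1}(dv1 1 _ c1z).
  by have := T 1; rewrite eqxx add0r.
move=> j; have [->//|j1] := eqVneq j 1.
have := T j; rewrite (negbTE j1) th1 mulr1 dv1 // => /esym/eqP.
by rewrite -subr_eq0 addrK => /eqP.
Qed.

Lemma smooth_g_cube c p r i j : atlas S c -> cimg c = cube p r ->
  smooth_on (cube p r) (fun x => g c x i j).
Proof. by move=> Sc <-; exact: g_smooth. Qed.

Lemma smooth_V_cube c p r k : atlas S c -> cimg c = cube p r ->
  smooth_on (cube p r) (fun x => V c x 0 k).
Proof. by move=> Sc <-; exact: V_smooth. Qed.

(** On a leaf v = const the metric is degenerate with kernel V, hence the
    square of a 1-form; the Killing equation says that this 1-form is closed
    on the leaf.  A primitive is the third coordinate x. *)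
Lemma x_chart q : adapted (fun c x =>
  [/\ V c x 0 0 != 0, V c x 0 1 = 0, V c x 0 2%:R = 0, g c x 2%:R 2%:R = 1
    & forall j, th c j x = (j == 1)%:R]) q.
Proof.
have [c [r [cub A2]]] := v_chart q; have [r0 Sc cq cE] := cub.
set p := cmap c q in cE.
have V1 x : cimg c x -> V c x 0 1 = 0.
  move=> cx; have [_ t] := A2 x cx.
  have := th_V Sc cx; rewrite sum3 !t /= mul0r mul1r add0r => <-.
  by rewrite mul0r addr0.
have low x j : cimg c x ->
    g c x j 0 * V c x 0 0 + g c x j 2%:R * V c x 0 2%:R = (j == 1)%:R.
  move=> cx; have [_ t] := A2 x cx.
  by rewrite -(t j) /th /lower sum3 (V1 x cx) mulr0 addr0.
have g22 x : cimg c x -> 0 < g c x 2%:R 2%:R.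
  move=> cx; have [V0 t] := A2 x cx.
  have gE : inner (g c) x (delta_mx 0 2%:R) (delta_mx 0 2%:R) = g c x 2%:R 2%:R.
    by rewrite /inner -rowE trmx_delta -colE !mxE.
  have oV : inner (g c) x (V c x) (delta_mx 0 2%:R) = 0.
    rewrite inner_lower // big1 // => j _; rewrite t mxE.
    by case: eqP => [->|_]; rewrite ?mul0r // mulr0.
  have [|[a ea]] := orthogonal_to_null (g_lorentzian Sc cx) (V_neq0 Sc cx)
    (V_null Sc cx) oV; first by rewrite gE.
  have := congr1 (fun w : coords R => w 0 0) ea; rewrite !mxE /=.
  move/esym/eqP; rewrite mulf_eq0 (negbTE V0) orbF => /eqP a0.
  have := congr1 (fun w : coords R => w 0 2%:R) ea.
  by rewrite !mxE a0 mul0r !eqxx => /eqP; rewrite oner_eq0.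
have oC := @open_cube R p r.
pose s x := Num.sqrt (g c x 2%:R 2%:R).
pose t x := g c x 0 2%:R / s x.
have sg i j := smooth_g_cube i j Sc cE.
have sV k := smooth_V_cube k Sc cE.
have in_c x : cube p r x -> cimg c x by rewrite cE.
have ss : smooth_on (cube p r) s.
  by apply: smooth_sqrt => // x /in_c; exact: g22.
have s0 x : cube p r x -> s x != 0.
  by move=> px; rewrite gt_eqF // sqrtr_gt0 g22 //; exact: in_c.
have st : smooth_on (cube p r) t by exact: (smoothM oC (sg 0 2%:R) (smoothV oC s0 ss)).
have g22E x : cube p r x -> g c x 2%:R 2%:R = s x * s x.
  by move=> px; rewrite -expr2 sqr_sqrtr // ltW // g22 //; exact: in_c.
have g02E x : cube p r x -> g c x 0 2%:R = s x * t x.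
  by move=> px; rewrite /t mulrC divfK // s0.
have tV x : cube p r x -> t x * V c x 0 0 + s x * V c x 0 2%:R = 0.
  move=> px; apply: (mulfI (s0 x px)); rewrite mulr0.
  have e : g c x 2%:R 0 * V c x 0 0 + g c x 2%:R 2%:R * V c x 0 2%:R = 0.
    exact: low (in_c _ px).
  rewrite (g_symE 2%:R 0 Sc (in_c _ px)) (g02E x px) (g22E x px) in e.
  by rewrite -[RHS]e; ring.
have dd f k x : smooth_on (cube p r) f -> cube p r x -> derivable f x (delta_mx 0 k).
  by move=> sf px; exact: smooth_derivable sf px.
have cl x : cube p r x -> partial 0 s x = partial 2%:R t x.
  move=> px; have cx := in_c _ px; have [V0 _] := A2 x cx.
  have K := V_killing 2%:R 2%:R Sc cx.
  rewrite sum3 (V1 x cx) in K.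
  have dV1 k : partial k (fun y => V c y 0 1) x = 0.
    rewrite (@eq_partial _ (cube p r) _ (fun=> 0) k oC _ x px) ?partial_cst //.
    by move=> y /in_c; exact: V1.
  have ds k : derivable s x (delta_mx 0 k) by exact: dd.
  have dt k : derivable t x (delta_mx 0 k) by exact: dd.
  have dV k : derivable (fun y => V c y 0 k) x (delta_mx 0 2%:R) by exact: dd (sV k) px.
  have dg k : partial k (fun y => g c y 2%:R 2%:R) x = 2 * s x * partial k s x.
    rewrite (@eq_partial _ (cube p r) _ (fun x => s x * s x) k oC g22E x px).
    by rewrite (partialM (ds k) (ds k)); ring.
  have dtV : t x * partial 2%:R (fun y => V c y 0 0) x
     + V c x 0 0 * partial 2%:R t x + (s x * partial 2%:R (fun y => V c y 0 2%:R) x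
     + V c x 0 2%:R * partial 2%:R s x) = 0.
    have := @eq_partial _ (cube p r) _ (fun=> 0) 2%:R oC tV x px.
    rewrite partial_cst (partialD (derivableM (dt _) (dV _)) (derivableM (ds _) (dV _))).
    by rewrite (partialM (dt _) (dV _)) (partialM (ds _) (dV _)).
  rewrite !dg !dV1 (g_symE 2%:R 0 Sc cx) (g02E x px) (g22E x px) in K.
  apply/eqP; rewrite -subr_eq0; apply/eqP.
  have n2 : 2 * s x * V c x 0 0 != 0 by rewrite !mulf_neq0 ?s0 // pnatr_eq0.
  apply: (mulfI n2); rewrite mulr0.
  move: K dtV {n2}.
  move: (partial 2%:R (fun y => V c y 0 0) x) (partial 2%:R (fun y => V c y 0 2%:R) x)
    (partial 0 s x) (partial 1 s x) (partial 2%:R s x) (partial 2%:R t x)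
    (V c x 0 0) (V c x 0 2%:R) (s x) (t x) (g c x 1 2%:R) (g c x 2%:R 1)
    => dV0 dV2 s0x s1x s2x t2x V0x V2x sx tx g12 g21 K dtV.
  transitivity (V0x * (2 * sx * s0x) + V2x * (2 * sx * s2x)
    + 2 * sx * (tx * dV0 + sx * dV2)
    - 2 * sx * (tx * dV0 + V0x * t2x + (sx * dV2 + V2x * s2x))); first by ring.
  by rewrite dtV mulr0 subr0 -[RHS]K; ring.
have [rho [v [[rhor sv] d0 d2 _]]] := @poincare2 _ p r 0 2%:R t s r0 isT st ss cl.
have [c1 [cub1 e1 c1E sub1 same1]] := shrink_to cub rhor.
have [_ Sc1 c1q _] := cub1.
have sv1 : smooth_on (cimg c1) v by rewrite c1E.
have c1x := cubic_cimg cub1.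
have in1 x : cimg c1 x -> cube p rho x by rewrite c1E.
have sub1' x : cimg c1 x -> cube p r x by rewrite -cE; exact: sub1.
have dn : partial 2%:R v (cmap c1 q) != 0.
  by rewrite (d2 _ (in1 _ c1x)); apply/s0/sub1'.
have [c2 [d [cub2 rp]]] := replace_chart cub1 sv1 dn.
have [_ Sc2 _ _] := cub2; have [sub2 _] := rp.
exists c2, d; split=> // _ /cimgP[z c2z ->].
have c1z := cimg_cmap (sub2 _ c2z); set x := cmap c1 z in c1z.
have [eV eg] := same1 _ c1z.
have px := sub1' _ c1z.
have [V0 tE] := A2 _ (sub1 _ c1z).
have T a := th_replaced Sc1 Sc2 rp c2z a.
have T' a : th c1 a x = (a == 1)%:R by rewrite (th_same _ (same1 _ c1z)) tE.
have th2 : th c2 2%:R (cmap c2 z) = 0.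
  have := T 2%:R; rewrite T' eqxx add0r (d2 _ (in1 _ c1z)) => /esym/eqP.
  by rewrite mulf_eq0 (negbTE (s0 _ px)) => /eqP.
have tt j : th c2 j (cmap c2 z) = (j == 1)%:R.
  have [->//|j2] := eqVneq j 2%:R.
  by have := T j; rewrite T' (negbTE j2) th2 mulr0 addr0.
have U k := V_replaced Sc1 Sc2 rp c2z k.
have U0 := U 0; have U1 := U 1; have U2 := U 2%:R.
rewrite /= -/x eV in U0 U1 U2.
have e0 : V c2 (cmap c2 z) 0 2%:R = 0.
  rewrite U2 sum3 (V1 _ (sub1 _ c1z)) (d0 _ (in1 _ c1z)) (d2 _ (in1 _ c1z)) -[RHS](tV x px).
  by ring.
split => //.
- by rewrite U0.
- by rewrite U1 V1 //; exact: sub1.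
- have G := g_replaced Sc1 Sc2 rp c2z 2%:R 2%:R.
  rewrite -/x eg !sum3 /= (d2 _ (in1 _ c1z)) (g22E _ px) in G.
  have sn := s0 _ px; apply: (mulfI sn); apply: (mulfI sn).
  by rewrite mulr1 [RHS]G; ring.
Qed.

(** A primitive of g_01 in the first coordinate makes V a coordinate field. *)
Lemma u_chart q : adapted (fun c x =>
  [/\ forall k, V c x 0 k = (k == 0)%:R, g c x 2%:R 2%:R = 1
    & forall j, th c j x = (j == 1)%:R]) q.
Proof.
have [c [r [cub A3]]] := x_chart q; have [r0 Sc cq cE] := cub.
set p := cmap c q in cE.
have in_c x : cube p r x -> cimg c x by rewrite cE.
have sg := smooth_g_cube 0 1 Sc cE.
have [rho rho0 rhor] := smaller_radius r0.
have [v [sv dv _]] := primitive rho0 rhor 0 sg.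
have rr : 0 < rho < r by rewrite rho0.
have [c1 [cub1 e1 c1E sub1 same1]] := shrink_to cub rr.
have [_ Sc1 c1q _] := cub1.
have sv1 : smooth_on (cimg c1) v by rewrite c1E.
have c1x := cubic_cimg cub1.
have in1 x : cimg c1 x -> cube p rho x by rewrite c1E.
have g01 x : cimg c1 x -> V c x 0 0 * g c x 0 1 = 1.
  move=> c1x'; have cx := sub1 _ c1x'; have [V0 V1 V2 _ t] := A3 x cx.
  have : th c 1 x = 1 by rewrite t.
  rewrite /th /lower sum3 V1 V2 !mulr0 !addr0 => <-.
  by rewrite (g_symE 0 1 Sc cx) mulrC.
have dn : partial 0 v (cmap c1 q) != 0.
  rewrite (dv _ (in1 _ c1x)); apply/eqP => e; have := g01 _ c1x.
  by rewrite e mulr0 => /eqP; rewrite eq_sym oner_eq0.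
have [c2 [d [cub2 rp]]] := replace_chart cub1 sv1 dn.
have [_ Sc2 _ _] := cub2; have [sub2 _] := rp.
exists c2, d; split=> // _ /cimgP[z c2z ->].
have c1z := cimg_cmap (sub2 _ c2z); set x := cmap c1 z in c1z.
have [eV eg] := same1 _ c1z.
have [V0 V1 V2 g22 tE] := A3 _ (sub1 _ c1z).
have G1 := g01 _ c1z.
have T a := th_replaced Sc1 Sc2 rp c2z a.
have T' a : th c1 a x = (a == 1)%:R by rewrite (th_same _ (same1 _ c1z)) tE.
have dv0 : partial 0 v x != 0.
  rewrite (dv _ (in1 _ c1z)); apply/eqP => e; move: G1.
  by rewrite e mulr0 => /eqP; rewrite eq_sym oner_eq0.
have th0 : th c2 0 (cmap c2 z) = 0.
  have := T 0; rewrite T' eqxx add0r => /esym/eqP.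
  by rewrite mulf_eq0 (negbTE dv0) => /eqP.
have tt j : th c2 j (cmap c2 z) = (j == 1)%:R.
  have [->//|j0] := eqVneq j 0.
  by have := T j; rewrite T' (negbTE j0) th0 mulr0 addr0.
have U k := V_replaced Sc1 Sc2 rp c2z k.
have Vk k : V c2 (cmap c2 z) 0 k = (k == 0)%:R.
  move: k; apply: all3; rewrite U /= -/x eV.
  - by rewrite sum3 V1 V2 !mul0r !addr0 (dv _ (in1 _ c1z)).
  - exact: V1.
  - exact: V2.
have gj0 j : g c2 (cmap c2 z) j 0 = (j == 1)%:R.
  by rewrite -(tt j) /th /lower sum3 !Vk /= !mulr0 !addr0 mulr1.
split => //.
have c2z' := cimg_cmap c2z.
have G := g_replaced Sc1 Sc2 rp c2z 2%:R 2%:R.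
rewrite -/x eg g22 !sum3 /= in G.
rewrite (g_symE 0 2%:R Sc2 c2z') !gj0 /= in G.
by rewrite [RHS]G; ring.
Qed.

(** Finally u is corrected to remove the cross term dv dx. *)
Lemma brinkmann_chart q : adapted (fun c x =>
  [/\ forall k, V c x 0 k = (k == 0)%:R,
    g c x = brinkmann (g c x 1 1) & partial 0 (fun y => g c y 1 1) x = 0]) q.
Proof.
have [c [r [cub A4]]] := u_chart q; have [r0 Sc cq cE] := cub.
set p := cmap c q in cE.
have in_c x : cube p r x -> cimg c x by rewrite cE.
have killing c0 : atlas S c0 ->
    (forall x, cimg c0 x -> forall k, V c0 x 0 k = (k == 0)%:R) ->
    forall i j x, cimg c0 x -> partial 0 (fun y => g c0 y i j) x = 0.
  move=> Sc0 VE i j x cx; have K := V_killing i j Sc0 cx.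
  have dV k l : partial k (fun y => V c0 y 0 l) x = 0.
    rewrite (@eq_partial _ (cimg c0) _ (fun=> (l == 0)%:R) k _ _ x cx).
    - exact: partial_cst.
    - exact: open_cimg.
    - by move=> y cy; rewrite VE.
  by move: K; rewrite sum3 !dV !VE //= !mulr0 !mul0r mul1r !addr0.
have sg := smooth_g_cube 1 2%:R Sc cE.
have [rho rho0 rhor] := smaller_radius r0.
have [w [sw dw iw]] := primitive rho0 rhor 2%:R sg.
have VE0 x : cimg c x -> forall k, V c x 0 k = (k == 0)%:R.
  by move=> cx; case: (A4 x cx).
have w0 x : cube p rho x -> partial 0 w x = 0.
  by apply: (iw 0 isT) => y /in_c cy; exact: killing.
have rr : 0 < rho < r by rewrite rho0.
have [c1 [cub1 e1 c1E sub1 same1]] := shrink_to cub rr.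
have [_ Sc1 c1q _] := cub1.
pose v x := x 0 0 + w x.
have sv : smooth_on (cube p rho) v.
  by apply: (smoothD (@open_cube R p rho) _ sw); exact: smooth_coord.
have sv1 : smooth_on (cimg c1) v by rewrite c1E.
have c1x := cubic_cimg cub1.
have in1 x : cimg c1 x -> cube p rho x by rewrite c1E.
have dv k x : cube p rho x -> partial k v x = (k == 0)%:R + partial k w x.
  move=> px; rewrite (partialD (@derivable_coord R k 0 x) (smooth_derivable sw px)).
  by rewrite partial_coord.
have dn : partial 0 v (cmap c1 q) != 0.
  by rewrite dv ?w0 ?addr0 ?oner_eq0 //; exact: in1.
have [c2 [d [cub2 rp]]] := replace_chart cub1 sv1 dn.
have [_ Sc2 _ _] := cub2; have [sub2 _] := rp.
have main x : cimg c2 x -> (forall k, V c2 x 0 k = (k == 0)%:R) /\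
    g c2 x = brinkmann (g c2 x 1 1).
  move=> /cimgP[z c2z ->].
  have c1z := cimg_cmap (sub2 _ c2z); set y := cmap c1 z in c1z.
  have [eV eg] := same1 _ c1z.
  have [VE g22 tE] := A4 _ (sub1 _ c1z).
  have T a := th_replaced Sc1 Sc2 rp c2z a.
  have T' a : th c1 a y = (a == 1)%:R by rewrite (th_same _ (same1 _ c1z)) tE.
  have py := in1 _ c1z.
  have th0 : th c2 0 (cmap c2 z) = 0.
    by have := T 0; rewrite T' eqxx add0r dv // w0 // addr0 mul1r.
  have tt j : th c2 j (cmap c2 z) = (j == 1)%:R.
    have [->//|j0] := eqVneq j 0.
    by have := T j; rewrite T' (negbTE j0) th0 mulr0 addr0.
  have Vk k : V c2 (cmap c2 z) 0 k = (k == 0)%:R.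
    rewrite (V_replaced Sc1 Sc2 rp c2z k) -/y eV.
    have [_|k0] := eqVneq k 0; last by rewrite VE (negbTE k0).
    by rewrite sum3 !VE /= !mul0r mul1r !addr0 dv // w0 // addr0.
  have gj0 j : g c2 (cmap c2 z) j 0 = (j == 1)%:R.
    by rewrite -(tt j) /th /lower sum3 !Vk /= !mulr0 !addr0 mulr1.
  have c2z' := cimg_cmap c2z.
  have g0j j : g c2 (cmap c2 z) 0 j = (j == 1)%:R.
    by rewrite (g_symE 0 j Sc2 c2z') gj0.
  have G := g_replaced Sc1 Sc2 rp c2z 2%:R 2%:R.
  rewrite -/y eg g22 !sum3 /= !gj0 !g0j /= in G.
  have G' := g_replaced Sc1 Sc2 rp c2z 1 2%:R.
  rewrite -/y eg !sum3 /= !gj0 !g0j /= dv // [partial 2%:R v y]dv // dw // in G'.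
  split=> //.
  have h22 : g c2 (cmap c2 z) 2%:R 2%:R = 1 by rewrite [RHS]G; ring.
  have h12 : g c2 (cmap c2 z) 1 2%:R = 0.
    apply: (addrI (g c y 1 2%:R)); rewrite addr0 [RHS]G'.
    by rewrite mulr0n mulr1n; ring.
  have h21 : g c2 (cmap c2 z) 2%:R 1 = 0 by rewrite (g_symE 2%:R 1 Sc2 c2z').
  apply/matrixP => i j; rewrite [RHS]mxE; move: i; apply: all3; move: j; apply: all3;
    by rewrite /= ?g0j ?gj0.
exists c2, d; split=> // x cx; have [h1 h2] := main x cx; split => //.
by apply: killing => // y /main[].
Qed.

End PPWave.
(** * Curvature and field equation of a Brinkmann metric *)

Section Brinkmann.
Variable R : realType.

Definition inv_brinkmann (f : R) : 'M[R]_3 :=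
  \matrix_(i, j) nth 0 (nth [::] [:: [:: - f; 1; 0];
                                     [:: 1; 0; 0];
                                     [:: 0; 0; 1]] i) j.

Lemma invmx_brinkmann (f : R) : invmx (brinkmann f) = inv_brinkmann f.
Proof.
have h : brinkmann f *m inv_brinkmann f = 1%:M.
  apply/matrixP => i j; rewrite mxE sum3 !mxE.
  by move: i; apply: all3; move: j; apply: all3 => /=; ring.
have [u _] := mulmx1_unit h.
by rewrite -[LHS]mulmx1 -h mulKmx.
Qed.

(** The table of Christoffel symbols, as a function of the derivatives F1 and F2
    of F. *)
Definition gamT (F1 F2 : R) (k i j : 'I_3) : R :=
  match val k, val i, val j with
  | 0, 1, 1 => 2^-1 * F1
  | 0, 1, 2 | 0, 2, 1 => 2^-1 * F2
  | 2, 1, 1 => - (2^-1 * F2)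
  | _, _, _ => 0
  end.

Definition rieT (F22 : R) (l i j k : 'I_3) : R :=
  match val l, val i, val j, val k with
  | 0, 2, 1, 2 => 2^-1 * F22
  | 0, 1, 2, 2 => - (2^-1 * F22)
  | 2, 2, 1, 1 => - (2^-1 * F22)
  | 2, 1, 2, 1 => 2^-1 * F22
  | _, _, _, _ => 0
  end.

Lemma gamT_christoffel (P : 'I_3 -> R) (Fx : R) k i j : P 0 = 0 ->
  let d m a b := if (a == 1) && (b == 1) then P m else 0 : R in
  2^-1 * (inv_brinkmann Fx k 0 * (d i j 0 + d j i 0 - d 0 i j) +
          inv_brinkmann Fx k 1 * (d i j 1 + d j i 1 - d 1 i j) +
          inv_brinkmann Fx k 2%:R * (d i j 2%:R + d j i 2%:R - d 2%:R i j)) =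
  gamT (P 1) (P 2%:R) k i j.
Proof.
move=> P0 d; rewrite /d {d} !mxE.
by move: k; apply: all3; move: i; apply: all3; move: j; apply: all3;
  rewrite /gamT /= ?P0; field.
Qed.

Lemma rieT_riemann (P1 P2 : 'I_3 -> R) (F1 F2 : R) l i j k :
  P1 0 = 0 -> P2 0 = 0 -> P1 2%:R = P2 1 ->
  let T a b m := gamT F1 F2 a b m in
  gamT (P1 i) (P2 i) l j k - gamT (P1 j) (P2 j) l i k +
  ((T l i 0 * T 0 j k - T l j 0 * T 0 i k) + (T l i 1 * T 1 j k - T l j 1 * T 1 i k)
   + (T l i 2%:R * T 2%:R j k - T l j 2%:R * T 2%:R i k)) = rieT (P2 2%:R) l i j k.
Proof.
move=> P10 P20 P12 T; rewrite /T {T}.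
move: l; apply: all3; move: i; apply: all3; move: j; apply: all3;
  move: k; apply: all3; rewrite /gamT /rieT /= ?P10 ?P20 ?P12; by ring.
Qed.

Definition hessT (P D0 D1 D2 : 'I_3 -> R) (f0 f2 : R) (i j : 'I_3) : R :=
  nth 0 (nth [::]
  [:: [:: D0 0; D1 0; D2 0];
      [:: D0 1; D1 1 - 2^-1 * P 1 * f0 + 2^-1 * P 2%:R * f2;
          D2 1 - 2^-1 * P 2%:R * f0];
      [:: D0 2%:R; D1 2%:R - 2^-1 * P 2%:R * f0; D2 2%:R]] i) j.

Definition dgradT (P D0 D1 D2 : 'I_3 -> R) (Fx f0 : R) (i k : 'I_3) : R :=
  nth 0 [:: - P i * f0 - Fx * D0 i + D1 i; D0 i; D2 i] k.

Lemma hessT_hess (P D0 D1 D2 : 'I_3 -> R) (Fx f0 f1 f2 : R) i j : P 0 = 0 ->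
  let X k := nth 0 [:: - Fx * f0 + f1; f0; f2] k in
  let T k a b := gamT (P 1) (P 2%:R) k a b in
  let C k := dgradT P D0 D1 D2 Fx f0 i k +
     (T k i 0 * X (0 : 'I_3) + T k i 1 * X (1 : 'I_3) + T k i 2%:R * X (2%:R : 'I_3)) in
  C 0 * brinkmann Fx 0 j + C 1 * brinkmann Fx 1 j + C 2%:R * brinkmann Fx 2%:R j
  = hessT P D0 D1 D2 f0 f2 i j.
Proof.
move=> P0 X T C; rewrite /C /X /T {C X T} !mxE.
by move: i; apply: all3; move: j; apply: all3;
  rewrite /dgradT /hessT /gamT /= ?P0; field.
Qed.

Lemma hessT_trace (P D0 D1 D2 : 'I_3 -> R) (Fx f0 f2 : R) : D1 0 = D0 1 ->
  let T i j := inv_brinkmann Fx i j * hessT P D0 D1 D2 f0 f2 i j in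
  (T 0 0 + T 0 1 + T 0 2%:R) + (T 1 0 + T 1 1 + T 1 2%:R)
  + (T 2%:R 0 + T 2%:R 1 + T 2%:R 2%:R) = - Fx * D0 0 + 2 * D1 0 + D2 2%:R.
Proof. by move=> D01 T; rewrite /T {T} !mxE /hessT /= D01; ring. Qed.

Lemma grad_norm2T (Fx f0 f1 f2 : R) :
  let X := \row_k nth 0 [:: - Fx * f0 + f1; f0; f2] k : coords R in
  (X *m brinkmann Fx *m X^T) 0 0 = - Fx * f0 ^+ 2 + 2 * f0 * f1 + f2 ^+ 2.
Proof. by rewrite /= mxE sum3 !mxE !sum3 !mxE /=; ring. Qed.

Lemma hessT_field (P D0 D1 D2 : 'I_3 -> R) (L Fx F22 fx f0 f2 : R) :
  (forall i j : 'I_3, fx * (if (i == 1) && (j == 1) then - (2^-1 * F22) else 0)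
     - hessT P D0 D1 D2 f0 f2 i j
     + (- Fx * D0 0 + 2 * D1 0 + D2 2%:R + L) * brinkmann Fx i j = 0) ->
  [/\ D0 0 = 0, D1 0 = - (L / 2), D2 0 = 0 /\ D2 2%:R = - (L / 2),
      D2 1 = 2^-1 * P 2%:R * f0
    & D1 1 - 2^-1 * P 1 * f0 + 2^-1 * P 2%:R * f2
      = - (2^-1 * fx * F22) - L / 2 * Fx].
Proof.
move=> E.
have h00 := E 0 0; have h01 := E 0 1; have h02 := E 0 2%:R.
have h11 := E 1 1; have h12 := E 1 2%:R; have h22 := E 2%:R 2%:R.
rewrite mxE /hessT /= in h00; rewrite mxE /hessT /= in h01.
rewrite mxE /hessT /= in h02; rewrite mxE /hessT /= in h11.
rewrite mxE /hessT /= in h12; rewrite mxE /hessT /= in h22.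
have e00 : D0 0 = 0 by lra.
rewrite e00 in h00 h01 h02 h11 h12 h22 *.
have e01 : D1 0 = - (L / 2) by lra.
have e22 : D2 2%:R = - (L / 2) by lra.
rewrite e01 e22 in h00 h01 h02 h11 h12 h22 *.
have e02 : D2 0 = 0 by lra.
split => //.
  by apply/eqP; rewrite -subr_eq0; apply/eqP; rewrite -oppr0 -h12; field.
by apply/eqP; rewrite -subr_eq0; apply/eqP; rewrite -oppr0 -h11; field.
Qed.

Section OneChart.
Variables (U : set (coords R)) (G : tensor2 R) (F : coords R -> R).
Hypotheses (oU : open U) (sF : smooth_on U F).
Hypothesis GE : forall x, U x -> G x = brinkmann (F x).
Hypothesis F0 : forall x, U x -> partial 0 F x = 0.
Implicit Types (x : coords R) (i j k l m : 'I_3) (f : coords R -> R).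

Lemma partial_brinkmann m i j x : U x ->
  partial m (fun y => G y i j) x = if (i == 1) && (j == 1) then partial m F x else 0.
Proof.
move=> Ux.
have -> : partial m (fun y => G y i j) x =
    partial m (fun y => (brinkmann (F y)) i j) x.
  by apply: (eq_partial m oU) => // y Uy; rewrite GE.
have -> : (fun y => brinkmann (F y) i j) = (fun y => nth 0 (nth [::]
    [:: [:: 0; 1; 0]; [:: 1; F y; 0]; [:: 0; 0; 1]] i) j).
  by apply/funext => y; rewrite mxE.
by move: i; apply: all3; move: j; apply: all3; rewrite /= ?partial_cst.
Qed.

Definition gam k i j x : R := gamT (partial 1 F x) (partial 2%:R F x) k i j.

Lemma christoffelE k i j x : U x -> christoffel G k i j x = gam k i j x.
Proof.
move=> Ux; rewrite /christoffel sum3 GE // invmx_brinkmann.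
rewrite !partial_brinkmann //.
exact: (@gamT_christoffel (fun m => partial m F x) (F x) k i j (F0 Ux)).
Qed.

Lemma partial_christoffel m k i j x : U x ->
  partial m (christoffel G k i j) x = partial m (gam k i j) x.
Proof. by apply: (eq_partial m oU) => y; exact: christoffelE. Qed.

Lemma F_schwarz i j x : U x -> partial i (partial j F) x = partial j (partial i F) x.
Proof. by move=> Ux; apply: (schwarz i j oU) => //; exact: smooth_ck. Qed.

Lemma F0j j x : U x -> partial 0 (partial j F) x = 0.
Proof.
move=> Ux; rewrite F_schwarz // (eq_partial j oU (g := fun=> 0)) ?partial_cst //.
Qed.

Lemma partial_half m j x : U x ->
  partial m (fun y => 2^-1 * partial j F y) x = 2^-1 * partial m (partial j F) x.
Proof.
move=> Ux; have d : derivable (partial j F) x (delta_mx 0 m).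
  exact: smooth_derivable (smooth_partial j sF) Ux.
rewrite (partialM (f := fun=> 2^-1) (derivable_cst _ _ _) d).
by rewrite partial_cst mulr0 addr0.
Qed.

Lemma partial_nhalf m j x : U x ->
  partial m (fun y => - (2^-1 * partial j F y)) x =
  - (2^-1 * partial m (partial j F) x).
Proof.
move=> Ux; have d : derivable (partial j F) x (delta_mx 0 m).
  exact: smooth_derivable (smooth_partial j sF) Ux.
rewrite partialN ?partial_half //.
exact: (derivableM (f := fun=> 2^-1) (derivable_cst _ _ _) d).
Qed.

Lemma partial_gam m k i j x : U x -> partial m (gam k i j) x =
  gamT (partial m (partial 1 F) x) (partial m (partial 2%:R F) x) k i j.
Proof.
move=> Ux.
by move: k; apply: all3; move: i; apply: all3; move: j; apply: all3;
  rewrite /gam /gamT /= ?partial_cst ?partial_half ?partial_nhalf.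
Qed.

Lemma riemannE l i j k x : U x ->
  riemann G l i j k x = rieT (partial 2%:R (partial 2%:R F) x) l i j k.
Proof.
move=> Ux; rewrite /riemann sum3 !partial_christoffel // !partial_gam //.
rewrite !christoffelE //.
apply: (@rieT_riemann (fun m => partial m (partial 1 F) x)
  (fun m => partial m (partial 2%:R F) x)); first exact: F0j.
- exact: F0j.
- exact: F_schwarz.
Qed.

Lemma ricciE j k x : U x -> ricci G j k x =
  if (j == 1) && (k == 1) then - (2^-1 * partial 2%:R (partial 2%:R F) x) else 0.
Proof.
move=> Ux; rewrite /ricci sum3 !riemannE //.
by move: j; apply: all3; move: k; apply: all3; rewrite /rieT /= ?add0r ?addr0.
Qed.

Lemma curv_flat x X Y Z : U x -> partial 2%:R (partial 2%:R F) x = 0 ->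
  curv_at G x X Y Z = 0.
Proof.
move=> Ux F22; apply/rowP => l; rewrite !mxE.
apply: big1 => i _; apply: big1 => j _; apply: big1 => k _.
rewrite riemannE //.
have -> : rieT (partial 2%:R (partial 2%:R F) x) l i j k = 0.
  move: l; apply: all3; move: i; apply: all3; move: j; apply: all3;
    move: k; apply: all3; by rewrite /rieT /= ?F22 ?mulr0 ?oppr0.
by rewrite !mul0r.
Qed.

Section Function.
Variable f : coords R -> R.
Hypothesis sf : smooth_on U f.

Lemma gradE x : U x -> grad G f x =
  \row_k nth 0 [:: - F x * partial 0 f x + partial 1 f x; partial 0 f x;
                   partial 2%:R f x] k.
Proof.
move=> Ux; apply/rowP => k; rewrite !mxE sum3 GE // invmx_brinkmann !mxE.
move: (partial 0 f x) (partial 1 f x) (partial 2%:R f x) (F x) => f0 f1 f2 Fx.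
by move: k; apply: all3 => /=; ring.
Qed.

Lemma f_derivable i j x : U x -> derivable (partial i f) x (delta_mx 0 j).
Proof. by move=> Ux; exact: smooth_derivable (smooth_partial i sf) Ux. Qed.

Lemma f_schwarz i j x : U x -> partial i (partial j f) x = partial j (partial i f) x.
Proof. by move=> Ux; apply: (schwarz i j oU) => //; exact: smooth_ck. Qed.

Lemma partial_grad i k x : U x -> partial i (fun y => grad G f y 0 k) x =
  dgradT (fun m => partial m F x) (fun m => partial m (partial 0 f) x)
    (fun m => partial m (partial 1 f) x) (fun m => partial m (partial 2%:R f) x)
    (F x) (partial 0 f x) i k.
Proof.
move=> Ux.
have e y : U y -> grad G f y 0 k = nth (fun=> 0)
    [:: (fun y => - F y * partial 0 f y + partial 1 f y); partial 0 f;
        partial 2%:R f] k y.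
  by move=> Uy; rewrite gradE // mxE; move: k; apply: all3.
rewrite (eq_partial i oU e Ux).
rewrite /dgradT; move: k {e}; apply: all3 => //=.
have dF : derivable F x (delta_mx 0 i) by exact: smooth_derivable sF Ux.
have d0 := @f_derivable 0 i x Ux; have d1 := @f_derivable 1 i x Ux.
rewrite (partialD (f := fun y => - F y * partial 0 f y)
  (derivableM (derivableN dF) d0) d1).
rewrite (partialM (f := fun y => - F y) (derivableN dF) d0) (partialN dF).
move: (partial i F x) (F x) (partial 0 f x) (partial i (partial 0 f) x)
  (partial i (partial 1 f) x) => Fi Fx f0 f0i f1i.
by ring.
Qed.

Lemma hessE i j x : U x -> hess G f i j x =
  hessT (fun m => partial m F x) (fun m => partial m (partial 0 f) x)
    (fun m => partial m (partial 1 f) x) (fun m => partial m (partial 2%:R f) x)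
    (partial 0 f x) (partial 2%:R f x) i j.
Proof.
move=> Ux; rewrite /hess sum3 /covd !sum3 !partial_grad // !christoffelE //.
rewrite gradE // GE //.
rewrite -(@hessT_hess _ _ _ _ (F x) _ (partial 1 f x) _ _ _ (F0 Ux)).
by rewrite !mxE.
Qed.

Lemma laplacianE x : U x -> laplacian G f x =
  - F x * partial 0 (partial 0 f) x + 2 * partial 0 (partial 1 f) x
  + partial 2%:R (partial 2%:R f) x.
Proof.
move=> Ux; rewrite /laplacian sum3 !sum3 !hessE // GE // invmx_brinkmann.
exact: (@hessT_trace _ _ (fun m => partial m (partial 1 f) x) _ _ _ _
  (f_schwarz 0 1 Ux)).
Qed.

Lemma grad_norm2E x : U x -> inner G x (grad G f x) (grad G f x) =
  - F x * partial 0 f x ^+ 2 + 2 * partial 0 f x * partial 1 f x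
  + partial 2%:R f x ^+ 2.
Proof.
by move=> Ux; rewrite /inner gradE // GE // grad_norm2T.
Qed.

(** The field equation in Brinkmann coordinates.  Its trace gives
    [laplacian f = - 3 Lambda / 2], since the scalar curvature vanishes. *)
Lemma field_brinkmann (L : R) x : U x ->
  (forall i j, f x * ricci G i j x - hess G f i j x
               + (laplacian G f x + L) * G x i j = 0) ->
  [/\ partial 0 (partial 0 f) x = 0, partial 0 (partial 1 f) x = - (L / 2),
      partial 0 (partial 2%:R f) x = 0 /\ partial 2%:R (partial 2%:R f) x = - (L / 2),
      partial 1 (partial 2%:R f) x = 2^-1 * partial 2%:R F x * partial 0 f x
    & partial 1 (partial 1 f) x - 2^-1 * partial 1 F x * partial 0 f x
        + 2^-1 * partial 2%:R F x * partial 2%:R f x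
      = - (2^-1 * f x * partial 2%:R (partial 2%:R F) x) - L / 2 * F x].
Proof.
move=> Ux h.
apply: (@hessT_field (fun m => partial m F x) (fun m => partial m (partial 0 f) x)
  (fun m => partial m (partial 1 f) x) (fun m => partial m (partial 2%:R f) x)
  L (F x) (partial 2%:R (partial 2%:R F) x) (f x) (partial 0 f x)
  (partial 2%:R f x)) => i j.
by have := h i j; rewrite ricciE // hessE // GE // laplacianE.
Qed.

End Function.

End OneChart.

End Brinkmann.
(** * The field equation on a pp-wave *)

Section FieldEquation.
Variables (R : realType) (M : topologicalType) (S : smooth_structure R M).
Variables (g : chart R M -> tensor2 R) (V : chart R M -> vfield R).
Variables (h : M -> R) (L : R).
Hypotheses (lor : lorentz_metric S g) (pp : pp_field S g V).
Hypotheses (sh : smooth_function S h) (fe : field_equation S g h L).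
Hypothesis (conn : connected [set: M]).
Implicit Types (c : chart R M) (q : M) (i j k : 'I_3) (x y : coords R).

Notation hl := (local_expr h).

(** The metric function F, if c is a Brinkmann chart. *)
Definition Fb c : coords R -> R := fun y => g c y 1 1.

Lemma h_smooth c : atlas S c -> smooth_on (cimg c) (hl c).
Proof. exact: sh. Qed.

Lemma hlE c q : cdom c q -> hl c (cmap c q) = h q.
Proof. by move=> cq; rewrite /local_expr cmapK. Qed.

Lemma field_at c x i j : atlas S c -> cimg c x ->
  hl c x * ricci (g c) i j x - hess (g c) (hl c) i j x
    + (laplacian (g c) (hl c) x + L) * g c x i j = 0.
Proof. by move=> Sc [q cq <-]; exact: fe. Qed.

Lemma smooth_trans c c' j : atlas S c -> atlas S c' ->
  smooth_on (overlap c c') (fun x => transition c c' x 0 j).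
Proof. by move=> Sc Sc'; exact: (atlas_compat Sc Sc' j). Qed.

Lemma dh_law c c' q i : atlas S c -> atlas S c' -> cdom c q -> cdom c' q ->
  partial i (hl c) (cmap c q) =
  \sum_j jac c c' (cmap c q) i j * partial j (hl c') (cmap c' q).
Proof.
move=> Sc Sc' cq c'q.
have ov := overlap_cmap cq c'q.
have e x : overlap c c' x -> hl c x = hl c' (transition c c' x).
  by move=> [z [cz c'z] <-]; rewrite transition_cmap // !hlE.
have Ux : cimg c' (transition c c' (cmap c q)).
  by rewrite transition_cmap //; exact: cimg_cmap.
have dT j : derivable (fun y => transition c c' y 0 j) (cmap c q) (delta_mx 0 i).
  exact: smooth_derivable (smooth_trans j Sc Sc') ov.
rewrite (eq_partial i (@open_overlap _ _ c c') e ov).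
rewrite (partial_comp (@open_cimg _ _ c') (smooth_ck 1 (h_smooth Sc')) Ux dT).
by rewrite transition_cmap //; apply: eq_bigr => j _; rewrite mxE.
Qed.

(** The derivative of h along V. *)
Definition hV c x : R := \sum_k V c x 0 k * partial k (hl c) x.

Lemma hV_law c c' q : atlas S c -> atlas S c' -> cdom c q -> cdom c' q ->
  hV c (cmap c q) = hV c' (cmap c' q).
Proof.
move=> Sc Sc' cq c'q; rewrite /hV.
under eq_bigr do rewrite (dh_law _ Sc Sc' cq c'q) mulr_sumr.
rewrite exchange_big /=; apply: eq_bigr => j _.
rewrite (V_law pp Sc Sc' cq c'q) mxE mulr_suml; apply: eq_bigr => k _.
by rewrite mulrA.
Qed.

Definition drow c x : coords R := \row_k partial k (hl c) x.

Lemma gradT c x : atlas S c -> cimg c x ->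
  g c x *m (grad (g c) (hl c) x)^T = (drow c x)^T.
Proof.
move=> Sc cx.
have -> : (grad (g c) (hl c) x)^T = invmx (g c x) *m (drow c x)^T.
  apply/matrixP => k b; rewrite ord1 !mxE; apply: eq_bigr => l _.
  by rewrite !mxE.
by rewrite mulKVmx // (g_unit lor Sc cx).
Qed.

Lemma jac_unit c c' q : atlas S c -> atlas S c' -> cdom c q -> cdom c' q ->
  jac c c' (cmap c q) \in unitmx.
Proof.
move=> Sc Sc' cq c'q; have := g_unit lor Sc (cimg_cmap cq).
by rewrite (g_law lor Sc Sc' cq c'q) !unitmx_mul => /andP[/andP[]].
Qed.

Lemma grad_law c c' q : atlas S c -> atlas S c' -> cdom c q -> cdom c' q ->
  grad (g c') (hl c') (cmap c' q) =
  grad (g c) (hl c) (cmap c q) *m jac c c' (cmap c q).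
Proof.
move=> Sc Sc' cq c'q; set J := jac c c' _; set x := cmap c q.
have Ju : J \in unitmx by exact: jac_unit.
have e1 := gradT Sc (cimg_cmap cq); have e2 := gradT Sc' (cimg_cmap c'q).
have ed : (drow c x)^T = J *m (drow c' (cmap c' q))^T.
  apply/matrixP => k b; rewrite ord1 !mxE (dh_law _ Sc Sc' cq c'q).
  by apply: eq_bigr => l _; rewrite !mxE.
rewrite -/x ed -e2 [X in X *m _](g_law lor Sc Sc' cq c'q) -/J -!mulmxA in e1.
have e3 := can_inj (mulKmx (g_unit lor Sc' (cimg_cmap c'q))) (can_inj (mulKmx Ju) e1).
by apply: trmx_inj; rewrite trmx_mul -e3.
Qed.

Lemma grad_norm2_law c c' q : atlas S c -> atlas S c' -> cdom c q -> cdom c' q ->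
  grad_norm2 g h c (cmap c q) = grad_norm2 g h c' (cmap c' q).
Proof.
move=> Sc Sc' cq c'q; rewrite /grad_norm2 /inner (grad_law Sc Sc' cq c'q).
by rewrite [in LHS](g_law lor Sc Sc' cq c'q) trmx_mul !mulmxA.
Qed.

(** A choice of one chart around each point turns Q into a function on M, to which
    [connected_const] applies. *)
Lemma invariant_const (Q : chart R M -> coords R -> R) :
  (forall c c' q, atlas S c -> atlas S c' -> cdom c q -> cdom c' q ->
     Q c (cmap c q) = Q c' (cmap c' q)) ->
  (forall q, exists c, [/\ atlas S c, cdom c q &
     forall x, cimg c x -> Q c x = Q c (cmap c q)]) ->
  forall c c' q q', atlas S c -> atlas S c' -> cdom c q -> cdom c' q' ->
  Q c (cmap c q) = Q c' (cmap c' q').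
Proof.
move=> inv loc c c' q q' Sc Sc' cq c'q'.
have [ch chP] : exists ch : M -> chart R M, forall z, atlas S (ch z) /\ cdom (ch z) z.
  have ex z : exists d, atlas S d /\ cdom d z.
    by have [d Sd dz] := atlas_cover S z; exists d.
  by have [ch chP] := choice ex; exists ch.
have cst : forall z z', Q (ch z) (cmap (ch z) z) = Q (ch z') (cmap (ch z') z').
  apply: (@connected_const _ _ (fun z => Q (ch z) (cmap (ch z) z)) conn) => z.
  have [d [Sd dz dc]] := loc z.
  exists (cdom d); first by apply: open_nbhs_nbhs; split => //; exact: open_cdom.
  move=> z' dz'; have [S1 c1] := chP z; have [S2 c2] := chP z'.
  rewrite (inv _ d) // dc ?[in RHS](inv _ d) //.
  exact: cimg_cmap.
have [S1 c1] := chP q; have [S2 c2] := chP q'.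
by rewrite (inv _ (ch q)) // (cst q q') (inv _ c').
Qed.

Lemma const_on_cube p r (f : coords R -> R) :
  (forall i x, cube p r x -> derivable f x (delta_mx 0 i)) ->
  (forall i x, cube p r x -> partial i f x = 0) ->
  forall x, cube p r x -> f x = f p.
Proof.
move=> df f0 x px.
have r0 : 0 < r by apply: le_lt_trans (px 0).
have pj j : `|p 0 j - p 0 j| < r by rewrite subrr normr0.
have p1 : cube p r (setc 0 (p 0 0) x) by exact: cube_setc.
have p2 : cube p r (setc 1 (p 0 1) (setc 0 (p 0 0) x)) by exact: cube_setc.
rewrite -(indep_cube (df 0) (f0 0) px (pj 0)) -(indep_cube (df 1) (f0 1) p1 (pj 1)).
rewrite -(indep_cube (df 2%:R) (f0 2%:R) p2 (pj 2%:R)); congr f.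
by apply/rowP; apply: all3; rewrite !setcE.
Qed.

(** Brinkmann charts: [V = d/du] and [g = dv (2 du + F dv) + dx^2]. *)
Definition bchart c :=
  [/\ atlas S c, forall x, cimg c x -> forall k, V c x 0 k = (k == 0)%:R,
    forall x, cimg c x -> g c x = brinkmann (Fb c x)
    & forall x, cimg c x -> partial 0 (Fb c) x = 0].

Lemma bchart_exists q : exists c r, cubic_chart S c q r /\ bchart c.
Proof.
have [c [r [cub B]]] := brinkmann_chart lor pp q; exists c, r; split => //.
have [_ Sc _ _] := cub; split => // x cx; by case: (B x cx).
Qed.

Lemma Fb_smooth c : bchart c -> smooth_on (cimg c) (Fb c).
Proof. by move=> [Sc _ _ _]; exact: (g_smooth lor). Qed.

Lemma hV_bchart c x : bchart c -> cimg c x -> hV c x = partial 0 (hl c) x.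
Proof.
move=> [_ VE _ _] cx; rewrite /hV sum3 !(VE x cx) /=.
by rewrite !mul0r mul1r !addr0.
Qed.

Lemma field_b c x : bchart c -> cimg c x ->
  [/\ partial 0 (partial 0 (hl c)) x = 0,
      partial 0 (partial 1 (hl c)) x = - (L / 2),
      partial 0 (partial 2%:R (hl c)) x = 0 /\
      partial 2%:R (partial 2%:R (hl c)) x = - (L / 2),
      partial 1 (partial 2%:R (hl c)) x =
        2^-1 * partial 2%:R (Fb c) x * partial 0 (hl c) x
    & partial 1 (partial 1 (hl c)) x
        - 2^-1 * partial 1 (Fb c) x * partial 0 (hl c) x
        + 2^-1 * partial 2%:R (Fb c) x * partial 2%:R (hl c) x
      = - (2^-1 * hl c x * partial 2%:R (partial 2%:R (Fb c)) x) - L / 2 * Fb c x].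
Proof.
move=> bc cx; have [Sc VE gE F0] := bc.
apply: (field_brinkmann (@open_cimg _ _ c) (Fb_smooth bc) gE F0 (h_smooth Sc) cx).
by move=> i j; exact: field_at.
Qed.

Lemma dh_derivable c k i x : atlas S c -> cimg c x ->
  derivable (partial k (hl c)) x (delta_mx 0 i).
Proof. by move=> Sc cx; exact: smooth_derivable (smooth_partial k (h_smooth Sc)) cx. Qed.

Lemma h_schwarz c i j x : atlas S c -> cimg c x ->
  partial i (partial j (hl c)) x = partial j (partial i (hl c)) x.
Proof.
by move=> Sc cx; apply: (schwarz i j (@open_cimg _ _ c)) cx; exact: smooth_ck (h_smooth Sc).
Qed.

(** Differentiate the (v,x)-component of the field equation in x; as h_xx is
    constant, only this product remains. *)
Lemma curvature_kills_hu c x : bchart c -> cimg c x ->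
  partial 2%:R (partial 2%:R (Fb c)) x * partial 0 (hl c) x = 0.
Proof.
move=> bc cx; have [Sc VE gE F0] := bc.
have oC := @open_cimg _ _ c.
have e12 y : cimg c y -> partial 1 (partial 2%:R (hl c)) y =
    2^-1 * partial 2%:R (Fb c) y * partial 0 (hl c) y.
  by move=> cy; case: (field_b bc cy).
have e22 y : cimg c y -> partial 2%:R (partial 2%:R (hl c)) y = - (L / 2).
  by move=> cy; case: (field_b bc cy) => _ _ [].
have s2 := smooth_partial 2%:R (h_smooth Sc).
have l : partial 2%:R (partial 1 (partial 2%:R (hl c))) x = 0.
  rewrite (schwarz 2%:R 1 oC (smooth_ck 2 s2) cx) (eq_partial 1 oC e22 cx).
  exact: partial_cst.
rewrite (eq_partial 2%:R oC e12 cx) in l.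
have sF2 := smooth_partial 2%:R (Fb_smooth bc).
have dF : derivable (partial 2%:R (Fb c)) x (delta_mx 0 2%:R).
  exact: smooth_derivable sF2 cx.
have dhF : derivable (fun y => 2^-1 * partial 2%:R (Fb c) y) x (delta_mx 0 2%:R).
  exact: (derivableM (f := fun=> 2^-1) (derivable_cst _ _ _) dF).
have d0 := @dh_derivable c 0 2%:R x Sc cx.
rewrite (partialM (f := fun y => 2^-1 * partial 2%:R (Fb c) y) dhF d0) in l.
rewrite (partialM (f := fun=> 2^-1) (derivable_cst _ _ _) dF) partial_cst in l.
have e20 : partial 2%:R (partial 0 (hl c)) x = 0.
  by rewrite (h_schwarz 2%:R 0 Sc cx); case: (field_b bc cx) => _ _ [].
rewrite e20 mulr0 add0r mulr0 addr0 in l.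
move: l => /eqP; rewrite mulrCA mulf_eq0 invr_eq0 (negbTE (_ : 2 != 0 :> R)) ?pnatr_eq0 //=.
by move=> /eqP l; rewrite mulrC.
Qed.

Lemma nonflat_F22 c q : bchart c -> cdom c q -> nonflat_at S g q ->
  partial 2%:R (partial 2%:R (Fb c)) (cmap c q) != 0.
Proof.
move=> bc cq nf; have [Sc VE gE F0] := bc; apply/eqP => F22.
have [X [Y [Z]]] := nf c Sc cq; move=> /eqP; apply.
exact: (curv_flat (@open_cimg _ _ c) (Fb_smooth bc) gE F0 X Y Z (cimg_cmap cq) F22).
Qed.

Hypothesis nf : exists q, nonflat_at S g q.

(** Where the curvature does not vanish, h_u = 0, and the (u,v)-component of the
    field equation reads Lambda = 0. *)
Lemma Lambda0 : L = 0.
Proof.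
have [q nq] := nf; have [c [r [cub bc]]] := bchart_exists q.
have [r0 Sc cq cE] := cub; have cx := cimg_cmap cq.
have F22 := nonflat_F22 bc cq nq.
have sF22 := smooth_partial 2%:R (smooth_partial 2%:R (Fb_smooth bc)).
have n1 : \forall y \near cmap c q, partial 2%:R (partial 2%:R (Fb c)) y != 0.
  exact: (cvgr_neq0 _ (smooth_cont sF22 cx) F22).
have [rho rho0 sub] := nbhs_sub_cube n1.
have [s s0 sub'] := open_sub_cube (@open_cimg _ _ c) cx.
pose t := Num.min rho s.
have t0 : 0 < t by rewrite lt_min rho0.
have hu y : cube (cmap c q) t y -> partial 0 (hl c) y = 0.
  move=> py.
  have F22y : partial 2%:R (partial 2%:R (Fb c)) y != 0.
    by apply: sub; apply: subcube py; rewrite ge_min lexx.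
  have cy : cimg c y by apply: sub'; apply: subcube py; rewrite ge_min lexx orbT.
  by have /eqP := curvature_kills_hu bc cy; rewrite mulf_eq0 (negbTE F22y) => /eqP.
have [_ e01 _ _ _] := field_b bc cx.
move: e01; rewrite (h_schwarz 0 1 Sc cx).
rewrite (eq_partial 1 (@open_cube R _ _) hu (cube_center _ t0)) partial_cst => /eqP.
rewrite eq_sym oppr_eq0 mulf_eq0 invr_eq0 pnatr_eq0 orbF.
by move=> /eqP.
Qed.

(** The derivative of h along V is a constant, and zero at a non-flat point. *)
Lemma hV0 c q : atlas S c -> cdom c q -> hV c (cmap c q) = 0.
Proof.
move=> Sc cq; have [q0 nq0] := nf.
have [c0 [r0 [cub0 bc0]]] := bchart_exists q0; have [_ Sc0 cq0 _] := cub0.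
have -> : hV c (cmap c q) = hV c0 (cmap c0 q0).
  apply: (invariant_const hV_law) => // z.
  have [d [r [cub bd]]] := bchart_exists z; have [r1 Sd dz dE] := cub.
  exists d; split => // x dx; rewrite !hV_bchart //; last exact: cimg_cmap.
  rewrite dE in dx; apply: (const_on_cube _ _ dx) => i y.
    by rewrite -dE => dy; exact: dh_derivable.
  rewrite -dE => dy; have [e0 e1 [e2 _] _ _] := field_b bd dy.
  move: i; apply: all3; first exact: e0.
    by rewrite (h_schwarz 1 0 Sd dy) e1 Lambda0 mul0r oppr0.
  by rewrite (h_schwarz 2%:R 0 Sd dy); exact: e2.
have cx := cimg_cmap cq0; rewrite hV_bchart //.
have /eqP := curvature_kills_hu bc0 cx.
by rewrite mulf_eq0 (negbTE (nonflat_F22 bc0 cq0 nq0)) => /eqP.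
Qed.

Lemma hu0 c x : bchart c -> cimg c x -> partial 0 (hl c) x = 0.
Proof.
move=> bc cx; rewrite -hV_bchart //; have [Sc _ _ _] := bc.
by case: cx => q cq <-; exact: hV0.
Qed.

Lemma grad_norm2_b c x : bchart c -> cimg c x ->
  grad_norm2 g h c x = partial 2%:R (hl c) x ^+ 2.
Proof.
move=> bc cx; have [Sc VE gE F0] := bc.
rewrite /grad_norm2 (grad_norm2E gE (hl c) cx) (hu0 bc cx).
by rewrite expr0n /= !(mulr0, mul0r, add0r).
Qed.

Lemma hx_const c q r x : cubic_chart S c q r -> bchart c -> cimg c x ->
  partial 2%:R (hl c) x = partial 2%:R (hl c) (cmap c q).
Proof.
move=> [r0 Sc cq cE] bc cx; rewrite cE in cx.
apply: (const_on_cube _ _ cx) => i y; rewrite -cE => cy; first exact: dh_derivable.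
have [_ _ [e0 e2] e1 _] := field_b bc cy.
move: i; apply: all3; first exact: e0.
  by rewrite e1 (hu0 bc cy) mulr0.
by rewrite e2 Lambda0 mul0r oppr0.
Qed.

(** The derivative of [g(grad h, grad h)] is twice the Hessian of h applied to
    grad h, and the Hessian is now a multiple of the square of dv. *)
Lemma grad_norm2_const c c' q q' : atlas S c -> atlas S c' ->
  cdom c q -> cdom c' q' ->
  grad_norm2 g h c (cmap c q) = grad_norm2 g h c' (cmap c' q').
Proof.
apply: (invariant_const grad_norm2_law) => z.
have [d [r [cub bd]]] := bchart_exists z; have [r1 Sd dz dE] := cub.
exists d; split => // x dx; rewrite !grad_norm2_b //; last exact: cimg_cmap.
by rewrite (hx_const cub bd dx).
Qed.

Lemma field_b0 c x : bchart c -> cimg c x ->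
  partial 1 (partial 1 (hl c)) x
    + 2^-1 * partial 2%:R (Fb c) x * partial 2%:R (hl c) x
  = - (2^-1 * hl c x * partial 2%:R (partial 2%:R (Fb c)) x).
Proof.
move=> bc cx; have [_ _ _ _] := field_b bc cx.
by rewrite (hu0 bc cx) mulr0 subr0 Lambda0 mul0r mul0r subr0.
Qed.

End FieldEquation.
(** * A linear second order differential equation *)

Section LinearODE.
Variable R : realType.
Implicit Types (a r t : R) (u w y : R -> R).

Lemma bounded_interval a rho u :
  (forall t, `|t - a| <= rho -> {for t, continuous u}) ->
  exists2 K, 0 <= K & forall t, `|t - a| <= rho -> `|u t| <= K.
Proof.
move=> cu; have [rho0|rho0] := leP 0 rho; last first.
  exists 0 => // t h; have := le_lt_trans (le_trans (normr_ge0 _) h) rho0.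
  by rewrite ltxx.
have ab : a - rho <= a + rho by lra.
have [|c _ hc] := @EVT_max R (fun t => `|u t|) (a - rho) (a + rho) ab.
  apply: continuous_in_subspaceT => t; rewrite inE /= in_itv /= => /andP[h1 h2].
  apply: (@continuous_comp _ _ _ u Num.norm); last exact: norm_continuous.
  by apply: cu; rewrite ler_distl h1.
exists `|u c| => // t; rewrite ler_distl => /andP[h1 h2].
by apply: hc; rewrite in_itv /= h1.
Qed.

Section Picard.
Variables (a r K B : R) (k b : R -> R).
(* K r^2 is the contraction constant of the iteration *)
Hypotheses (r0 : 0 < r) (B0 : 0 <= B) (Krr : K * r * r <= 1 / 2).
Hypothesis ck : forall t, `|t - a| < r -> {for t, continuous k}.
Hypothesis cb : forall t, `|t - a| < r -> {for t, continuous b}.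
Hypothesis bk : forall t, `|t - a| < r -> `|k t| <= K.
Hypothesis bb : forall t, `|t - a| < r -> `|b t| <= B.

Let inB t := `|t - a| < r.
Let contB u := forall t, inB t -> {for t, continuous u}.

Variable I : (R -> R) -> R -> R.
Hypothesis I0 : forall u, contB u -> I u a = 0.
Hypothesis dI : forall u, contB u -> forall t, inB t -> is_derive t 1 (I u) (u t).

Let aB : inB a. Proof. by rewrite /inB subrr normr0. Qed.

Let contI u : contB u -> contB (I u).
Proof. by move=> cu t Bt; apply: derivable_cont; case: (dI cu Bt). Qed.

Let lipI u w C : contB u -> contB w ->
  (forall t, inB t -> `|u t - w t| <= C) ->
  forall t, inB t -> `|I u t - I w t| <= C * r.
Proof.
move=> cu cw uw t Bt.
have C0 : 0 <= C by apply: le_trans (uw a aB).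
apply: (@le_trans _ _ (C * `|t - a|)); last by rewrite ler_wpM2l // ltW.
have ds s : Num.min a t <= s <= Num.max a t ->
    inB s /\ is_derive s 1 (fun t => I u t - I w t) (u s - w s).
  move=> /(between_ball aB Bt) Bs; split => //.
  by apply: is_deriveB; exact: dI.
apply: (@mvt_bound _ _ _ (fun t => I u t - I w t)).
- by rewrite !I0 // subrr.
- by move=> s /ds[_ []].
- by move=> s /ds[Bs [_ ->]]; exact: uw.
Qed.

Let rhs y t := b t - k t * y t.

Let cont_rhs y : contB y -> contB (rhs y).
Proof.
move=> cy t Bt; apply: continuousB; first exact: cb.
by apply: continuousM; [exact: ck | exact: cy].
Qed.

(* xi is the fixed point of T, the uniform limit of its iterates from 0, and eta is
   the inner integral *)
Let T y := I (I (rhs y)).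

Let contT y : contB y -> contB (T y).
Proof. by move=> cy; do 2!apply: contI; exact: cont_rhs. Qed.

Let lipT y z C : contB y -> contB z ->
  (forall t, inB t -> `|y t - z t| <= C) ->
  forall t, inB t -> `|T y t - T z t| <= C / 2.
Proof.
move=> cy cz yz t Bt.
have C0 : 0 <= C by apply: le_trans (yz a aB).
have h1 s : inB s -> `|rhs y s - rhs z s| <= K * C.
  move=> Bs; rewrite /rhs (_ : _ - _ = - (k s * (y s - z s))); last by ring.
  by rewrite normrN normrM ler_pM // ?bk ?yz.
have h2 := lipI (cont_rhs cy) (cont_rhs cz) h1.
have h3 := lipI (contI (cont_rhs cy)) (contI (cont_rhs cz)) h2 Bt.
apply: le_trans h3 _; rewrite (_ : K * C * r * r = C * (K * r * r)); last by ring.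
by apply: le_trans (ler_wpM2l C0 Krr) _; rewrite div1r.
Qed.

Let yn n := iter n T (fun=> 0).

Let contyn n : contB (yn n).
Proof.
elim: n => [|n IH]; first by move=> t _; exact: cst_continuous.
exact: contT.
Qed.

Let C := B * r * r.

Let C0 : 0 <= C.
Proof. by rewrite !mulr_ge0 // ltW. Qed.

Let step n t : inB t -> `|yn n.+1 t - yn n t| <= C * (1 / 2) ^+ n.
Proof.
elim: n t => [|n IH] t Bt.
  have c0 : contB (fun=> 0) by move=> s _; exact: cst_continuous.
  have h1 s : inB s -> `|rhs (fun=> 0) s - 0| <= B.
    by move=> Bs; rewrite /rhs mulr0 !subr0; exact: bb.
  have IIE s : inB s -> I (fun=> 0) s = 0.
    move=> Bs; apply/eqP; rewrite -normr_le0 -[leRHS](mul0r `|s - a|).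
    apply: mvt_bound; first exact: (I0 c0).
      by move=> z /(between_ball aB Bs) Bz; case: (dI c0 Bz).
    by move=> z /(between_ball aB Bs) Bz; case: (dI c0 Bz) => _ ->; rewrite normr0.
  have h2 s : inB s -> `|I (rhs (fun=> 0)) s - 0| <= B * r.
    by move=> Bs; have := lipI (cont_rhs c0) c0 h1 Bs; rewrite (IIE s Bs).
  have h3 := lipI (contI (cont_rhs c0)) c0 h2 Bt.
  by rewrite (IIE t Bt) in h3; rewrite expr0 mulr1; exact: h3.
have hS : `|yn n.+2 t - yn n.+1 t| <= C * (1 / 2) ^+ n / 2.
  exact: (lipT (@contyn n.+1) (@contyn n) IH Bt).
by apply: le_trans hS _; rewrite exprSr; lra.
Qed.

Let tail n m t : inB t -> `|yn (n + m) t - yn n t| <= 2 * C * (1 / 2) ^+ n.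
Proof.
move=> Bt.
have : `|yn (n + m) t - yn n t| <= 2 * C * ((1 / 2) ^+ n - (1 / 2) ^+ (n + m)).
  elim: m => [|m IH]; first by rewrite addn0 !subrr normr0 mulr0.
  have h := step (n + m) Bt.
  rewrite addnS; apply: le_trans (ler_distD (yn (n + m) t) _ _) _.
  apply: le_trans (lerD h IH) _.
  by rewrite exprS; lra.
move=> /le_trans; apply; apply: ler_wpM2l; first by rewrite mulr_ge0.
by rewrite lerBlDr lerDl exprn_ge0.
Qed.

Let small e : 0 < e -> exists n, 2 * C * (1 / 2) ^+ n < e.
Proof.
move=> e0.
have h : `|1 / 2 : R| < 1 by rewrite ger0_norm; lra.
have D0 : 0 < e / (2 * C + 1).
  by rewrite divr_gt0 // ltr_wpDl // mulr_ge0.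
have /cvgrPdist_lt/(_ _ D0)[N _ hN] := cvg_expr h.
exists N; have := hN N (leqnn N); rewrite /= sub0r normrN.
rewrite ger0_norm ?exprn_ge0 // => hq.
have p1 : 0 < 2 * C + 1 by rewrite ltr_wpDl // mulr_ge0.
rewrite ltr_pdivlMr // in hq.
have q0 : 0 <= (1 / 2 : R) ^+ N by rewrite exprn_ge0.
have := C0; nra.
Qed.

Let yl t := limn (fun n => yn n t).

Let cvgyn t : inB t -> yn n t @[n --> \oo] --> yl t.
Proof.
move=> Bt; apply: cauchy_cvg; apply: cauchy_exP => e e0.
have [n hn] := small e0; exists (yn n t); exists n => // m /= nm.
rewrite -(subnKC nm) /ball /= distrC.
exact: le_lt_trans (tail n (m - n) Bt) hn.
Qed.

Let yl_tail n t : inB t -> `|yl t - yn n t| <= 2 * C * (1 / 2) ^+ n.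
Proof.
move=> Bt; apply/ler_addgt0Pl => e e0.
have /cvgrPdist_lt/(_ _ e0)[N _ hN] := cvgyn Bt.
have h1 := hN (maxn n N) (leq_maxr _ _).
have h2 := tail n (maxn n N - n) Bt.
rewrite subnKC ?leq_maxl // in h2.
apply: le_trans (ler_distD (yn (maxn n N) t) _ _) _.
by apply: lerD => //; exact: ltW.
Qed.

Let cont_yl : contB yl.
Proof.
move=> t Bt; apply/cvgrPdist_lt => e e0.
have e3 : 0 < e / 3 by rewrite divr_gt0.
have [n hn] := small e3.
have /cvgrPdist_lt/(_ _ e3) := @contyn n t Bt => hc.
have nB : \forall s \near t, inB s.
  have rt : 0 < r - `|t - a| by rewrite subr_gt0.
  have := @nbhsx_ballx _ R t _ rt; apply: filterS => s /=; rewrite /ball /= => st.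
  by have d := ler_distD t s a; rewrite distrC in st; rewrite /inB; lra.
near=> s.
have Bs : inB s by near: s.
have h1 := yl_tail n Bt; have h2 := yl_tail n Bs; rewrite distrC in h2.
have h3 : `|yn n t - yn n s| < e / 3 by near: s.
have := ler_distD (yn n t) (yl t) (yl s); have := ler_distD (yn n s) (yn n t) (yl s).
by lra.
Unshelve. all: by end_near. Qed.

Let yl_fixed t : inB t -> T yl t = yl t.
Proof.
move=> Bt; apply/eqP; rewrite -subr_eq0 -normr_le0; apply/ler_addgt0Pl => e e0.
have e2 : 0 < e / 2 by rewrite divr_gt0.
have [n hn] := small e2; rewrite addr0.
have h1 : `|T yl t - yn n.+1 t| <= 2 * C * (1 / 2) ^+ n / 2.
  by apply: (lipT cont_yl (@contyn n)) => // s Bs; exact: yl_tail.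
have h2 := yl_tail n.+1 Bt; rewrite distrC in h2.
have := ler_distD (yn n.+1 t) (T yl t) (yl t).
rewrite exprS in h2; lra.
Qed.

Lemma picard : exists xi eta : R -> R, forall t, `|t - a| < r ->
  is_derive t 1 xi (eta t) /\ is_derive t 1 eta (b t - k t * xi t).
Proof.
exists (T yl), (I (rhs yl)) => t Bt.
have c1 := cont_rhs cont_yl.
split; first exact: (dI (contI c1) Bt).
by rewrite yl_fixed //; exact: (dI c1 Bt).
Qed.

End Picard.

(** This is the equation [xi'' + k xi = b].  The interval is shortened until Picard
    iteration contracts. *)
Lemma linear_ode a r (k b : R -> R) : 0 < r ->
  (forall t, `|t - a| < r -> {for t, continuous k}) ->
  (forall t, `|t - a| < r -> {for t, continuous b}) ->
  exists rho xi eta, 0 < rho < r /\ forall t, `|t - a| < rho ->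
    is_derive t 1 xi (eta t) /\ is_derive t 1 eta (b t - k t * xi t).
Proof.
move=> r0 ctk ctb.
have h2 : 0 < r / 2 by rewrite divr_gt0.
have sub t : `|t - a| <= r / 2 -> `|t - a| < r by move=> h; lra.
have [K K0 bK] := bounded_interval (fun t h => ctk t (sub t h)).
have [B B0 bB] := bounded_interval (fun t h => ctb t (sub t h)).
pose rho := Num.min (r / 2) (1 / (2 * (K + 1))).
have K1 : 0 < 2 * (K + 1) by rewrite mulr_gt0 // ltr_wpDl.
have rho0 : 0 < rho by rewrite lt_min h2 divr_gt0.
have rhor : rho <= r / 2 by rewrite ge_min lexx.
have rhoK : rho * (2 * (K + 1)) <= 1.
  by rewrite -ler_pdivlMr // /rho ge_min lexx orbT.
have sub2 t : `|t - a| < rho -> `|t - a| <= r / 2 by move=> h; lra.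
have Krr : K * rho * rho <= 1 / 2 by nra.
have [I IP] : exists I : (R -> R) -> R -> R, forall u,
    (forall t, `|t - a| < rho -> {for t, continuous u}) ->
    I u a = 0 /\ forall t, `|t - a| < rho -> is_derive t 1 (I u) (u t).
  have ex u : exists w : R -> R,
      (forall t, `|t - a| < rho -> {for t, continuous u}) ->
      w a = 0 /\ forall t, `|t - a| < rho -> is_derive t 1 w (u t).
    have [cu|ncu] := pselect (forall t, `|t - a| < rho -> {for t, continuous u}).
      by have [w w0 dw] := antiderivative_open cu; exists w.
    by exists u.
  by have [I IP] := choice ex; exists I.
have [xi [eta sol]] := @picard a rho K B k b rho0 B0 Krr
  (fun t h => ctk t (sub t (sub2 t h))) (fun t h => ctb t (sub t (sub2 t h)))
  (fun t h => bK t (sub2 t h)) (fun t h => bB t (sub2 t h)) I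
  (fun u cu => (IP u cu).1) (fun u cu => (IP u cu).2).
exists rho, xi, eta; split => //; rewrite rho0 /=; lra.
Qed.

End LinearODE.
(** * Functions of one coordinate *)

Section FunctionsOfV.
Variable R : realType.
Implicit Types (f : coords R -> R) (x y p : coords R) (i j : 'I_3) (u w : R -> R).

Lemma partial_ln (U : set (coords R)) f i x : smooth_on U f -> U x -> 0 < f x ->
  is_derive x (delta_mx 0 i) (fun y => ln (f y)) ((f x)^-1 * partial i f x).
Proof.
move=> sf Ux fx; apply: is_derive_comp1; first exact: smooth_derivable sf Ux.
exact: is_derive1_ln.
Qed.

Lemma smooth_ln (U : set (coords R)) f : open U -> (forall x, U x -> 0 < f x) ->
  smooth_on U f -> smooth_on U (fun y => ln (f y)).
Proof.
move=> oU f0 sf.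
have ds i x : U x -> is_derive x (delta_mx 0 i) (fun y => ln (f y))
    ((f x)^-1 * partial i f x).
  by move=> Ux; exact: partial_ln sf Ux (f0 x Ux).
have sd i : smooth_on U (fun x => (f x)^-1 * partial i f x).
  apply: (smoothM oU _ (smooth_partial i sf)).
  by apply: (smoothV oU _ sf) => x Ux; rewrite gt_eqF // f0.
have cs x : U x -> {for x, continuous (fun y => ln (f y))}.
  move=> Ux; apply: (@continuous_comp _ _ _ f (@ln R)).
    exact: smooth_cont sf Ux.
  exact: continuous_ln (f0 x Ux).
apply/smooth_onP; case=> [|n]; first exact: cs.
split=> [|i x Ux|i]; [exact: cs | by case: (ds i x Ux) |].
by apply: (eq_ck oU _ (smooth_ck n (sd i))) => x Ux; case: (ds i x Ux).
Qed.

Definition strip (a r : R) : set (coords R) := [set y | `|y 0 1 - a| < r].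

Lemma open_strip a r : open (strip a r).
Proof.
have c0 (y : coords R) : setT y -> {for y, continuous (fun y : coords R => y 0 1)}.
  by move=> _; exact: continuous_coord.
have oB : open (ball a r : set R) by rewrite ball_itv; exact: interval_open.
have := open_preimage_in (@openT (coords R)) oB c0.
rewrite (_ : [set t | _] = strip a r) //.
by apply/seteqP; split=> y /=; rewrite /ball /= distrC // => -[].
Qed.

Definition onv u : coords R -> R := fun y => u (y 0 1).

Lemma is_derive_onv u (D : R) i y : is_derive (y 0 1) 1 u D ->
  is_derive y (delta_mx 0 i) (onv u) (D * (i == 1)%:R).
Proof.
move=> du; have := @is_derive_comp1 _ u (fun y => y 0 1) y i D
  (@derivable_coord _ _ _ _) du.
by rewrite partial_coord.
Qed.

Lemma ck_onv n (a r : R) u w : (forall t : R, `|t - a| < r -> is_derive t 1 u (w t)) ->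
  ck n (strip a r) (onv w) -> ck n.+1 (strip a r) (onv u).
Proof.
move=> du cw; have oS := @open_strip a r.
split=> [y Sy|i y Sy|i].
- apply: (@continuous_comp _ _ _ (fun y : coords R => y 0 1) u).
    exact: continuous_coord.
  by apply: derivable_cont; case: (du _ Sy).
- by case: (is_derive_onv i (du _ Sy)).
- apply: (eq_ck oS _ (ckM oS cw (ck_cst n _ (i == 1)%:R))) => y Sy.
  exact: esym (partial_val (is_derive_onv i (du _ Sy))).
Qed.

Definition slice p f : R -> R := fun t => f (setc 1 t p).

Lemma cube_slice p r (t : R) : `|t - p 0 1| < r -> cube p r (setc 1 t p).
Proof.
move=> tr; apply: cube_setc => //; apply: cube_center.
exact: le_lt_trans tr.
Qed.

Lemma is_derive_slice1 p r f (t : R) : smooth_on (cube p r) f -> `|t - p 0 1| < r ->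
  is_derive t 1 (slice p f) (slice p (partial 1 f) t).
Proof.
by move=> sf tr; apply: is_derive_slice; apply: smooth_derivable sf (cube_slice tr).
Qed.

Lemma slice_derive1n p r f n (t : R) : smooth_on (cube p r) f -> `|t - p 0 1| < r ->
  derivable (derive1n n (slice p f)) t 1 /\
  derive1n n (slice p f) t = slice p (iter n (partial 1) f) t.
Proof.
move=> sf.
have siter m : smooth_on (cube p r) (iter m (partial 1) f).
  by elim: m => [//|m IH] /=; exact: smooth_partial.
elim: n t => [|n IH] t tr.
  by rewrite derive1n0; split => //; case: (is_derive_slice1 sf tr).
have near_t : \forall s \near t, `|s - p 0 1| < r.
  have rt : 0 < r - `|t - p 0 1| by rewrite subr_gt0.
  have := @nbhsx_ballx _ R t _ rt; apply: filterS => s /=; rewrite /ball /= => st.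
  by have := ler_distD t s (p 0 1); rewrite distrC in st; lra.
have eqS : forall s, `|s - p 0 1| < r ->
    derive1n n.+1 (slice p f) s = slice p (iter n.+1 (partial 1) f) s.
  move=> s sr; rewrite derive1nS derive1E.
  have nears : \forall z \near s, derive1n n (slice p f) z = slice p (iter n (partial 1) f) z.
    have rt : 0 < r - `|s - p 0 1| by rewrite subr_gt0.
    have := @nbhsx_ballx _ R s _ rt; apply: filterS => z /=; rewrite /ball /= => st.
    apply: (IH z _).2.
    by have := ler_distD s z (p 0 1); rewrite distrC in st; lra.
  rewrite (near_eq_derive _ nears).
  by case: (is_derive_slice1 (siter n) sr) => _ ->.
split; last exact: eqS.
have h : \forall z \near t, slice p (iter n.+1 (partial 1) f) z = derive1n n.+1 (slice p f) z.
  by apply: filterS near_t => z zr; rewrite eqS.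
apply: near_eq_derivable h _.
by case: (is_derive_slice1 (siter n.+1) tr).
Qed.

Lemma slice_smooth1 p r f (D : set R) : smooth_on (cube p r) f ->
  (forall t : R, D t -> `|t - p 0 1| < r) -> smooth1_on D (slice p f).
Proof. by move=> sf Dr n t /Dr tr; case: (slice_derive1n n sf tr). Qed.

Lemma function_of_v p r f y : smooth_on (cube p r) f ->
  (forall x, cube p r x -> partial 0 f x = 0) ->
  (forall x, cube p r x -> partial 2%:R f x = 0) ->
  cube p r y -> slice p f (y 0 1) = f y.
Proof.
move=> sf f0 f2 py.
have pj j : `|p 0 j - p 0 j| < r.
  by rewrite subrr normr0; apply: le_lt_trans (py 0).
have d i x : cube p r x -> derivable f x (delta_mx 0 i).
  by move=> px; exact: smooth_derivable sf px.
have p1 : cube p r (setc 0 (p 0 0) y) by exact: cube_setc.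
rewrite -(indep_cube (d 0) f0 py (pj 0)) -(indep_cube (d 2%:R) f2 p1 (pj 2%:R)).
by rewrite /slice; congr f; apply/rowP; apply: all3; rewrite !setcE.
Qed.

Lemma smooth_onv p r f : smooth_on (cube p r) f ->
  smooth_on (strip (p 0 1) r) (onv (slice p f)).
Proof.
move=> sf.
have := @smooth_comp R (cube p r) (strip (p 0 1) r) f (fun y => setc 1 (y 0 1) p).
apply => //; [exact: open_cube | exact: open_strip | |].
  by move=> y Sy; exact: cube_slice.
move=> j; rewrite (_ : (fun y => _) = if j == 1 then (fun y : coords R => y 0 1)
    else fun=> p 0 j).
  by case: eqP => _; [exact: smooth_coord | exact: smooth_cst].
by apply/funext => y; rewrite setcE; case: eqP.
Qed.

Lemma vc_cube p r t : (@vc R @` cube p r) t -> `|t - p 0 1| < r.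
Proof. by move=> [y py <-]; exact: py. Qed.

End FunctionsOfV.

(** * The normal form with spacelike gradient *)

Section SpacelikeForm.
Variable R : realType.
Variables (p : coords R) (r : R) (H F : coords R -> R) (gam : R).
Hypotheses (sH : smooth_on (cube p r) H) (sF : smooth_on (cube p r) F).
Hypothesis F0 : forall x, cube p r x -> partial 0 F x = 0.
Hypothesis H0 : forall x, cube p r x -> partial 0 H x = 0.
Hypothesis H2 : forall x, cube p r x -> partial 2%:R H x = gam.
Hypothesis Hpos : forall x, cube p r x -> 0 < H x.
Hypothesis field : forall x, cube p r x -> partial 1 (partial 1 H) x
  + 2^-1 * partial 2%:R F x * partial 2%:R H x
  = - (2^-1 * H x * partial 2%:R (partial 2%:R F) x).

Let oC := @open_cube R p r.
Let F2 := partial 2%:R F.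
Let H11 := partial 1 (partial 1 H).

Lemma H11_smooth : smooth_on (cube p r) H11.
Proof. exact/smooth_partial/smooth_partial/sH. Qed.

Lemma F2_smooth : smooth_on (cube p r) F2.
Proof. exact: smooth_partial sF. Qed.

Lemma H11_v i x (a : R) : (forall x, cube p r x -> partial i H x = a) ->
  cube p r x -> partial i H11 x = 0.
Proof.
move=> Hi px; rewrite /H11 (schwarz_cube i 1 (smooth_partial 1 sH) px).
have e y : cube p r y -> partial i (partial 1 H) y = 0.
  move=> py; rewrite (schwarz_cube i 1 sH py) (partial_ext_cube 1 Hi py).
  exact: partial_cst.
by rewrite (partial_ext_cube 1 e px); exact: partial_cst.
Qed.

Lemma F2_u x : cube p r x -> partial 0 F2 x = 0.
Proof.
move=> px; rewrite /F2 (schwarz_cube 0 2%:R sF px) (partial_ext_cube 2%:R F0 px).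
exact: partial_cst.
Qed.

Hypothesis gam0 : gam != 0.

(* gamma0, alpha and beta as functions on the cube *)
Let g0 x := H x - gam * x 0 2%:R.
Let al x := H x * F2 x + (2 * H11 x) * x 0 2%:R.
Let A x := gam * al x + 2 * (g0 x * H11 x).
Let be x := F x - (gam ^- 2 * (A x * ln (H x)) - (2 / gam) * (x 0 2%:R * H11 x)).

Let sx := @smooth_coord R (cube p r) 2%:R.

Let sg0 : smooth_on (cube p r) g0.
Proof. exact: (smoothB oC sH (smoothZ gam oC sx)). Qed.

Let s2H : smooth_on (cube p r) (fun x => 2 * H11 x).
Proof. exact: (smoothZ 2 oC H11_smooth). Qed.

Let sHF : smooth_on (cube p r) (fun x => H x * F2 x).
Proof. exact: (smoothM oC sH F2_smooth). Qed.

Let sHx : smooth_on (cube p r) (fun x => (2 * H11 x) * x 0 2%:R).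
Proof. exact: (smoothM oC s2H sx). Qed.

Let sal : smooth_on (cube p r) al.
Proof. exact: (smoothD oC sHF sHx). Qed.

Let sgH : smooth_on (cube p r) (fun x => g0 x * H11 x).
Proof. exact: (smoothM oC sg0 H11_smooth). Qed.

Let sA : smooth_on (cube p r) A.
Proof. exact: (smoothD oC (smoothZ gam oC sal) (smoothZ 2 oC sgH)). Qed.

Let sl : smooth_on (cube p r) (fun x => ln (H x)).
Proof. exact: (smooth_ln oC Hpos sH). Qed.

Let sAl : smooth_on (cube p r) (fun x => A x * ln (H x)).
Proof. exact: (smoothM oC sA sl). Qed.

Let sxH : smooth_on (cube p r) (fun x => x 0 2%:R * H11 x).
Proof. exact: (smoothM oC sx H11_smooth). Qed.

Let sb1 : smooth_on (cube p r) (fun x => gam ^- 2 * (A x * ln (H x))).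
Proof. exact: (smoothZ _ oC sAl). Qed.

Let sb2 : smooth_on (cube p r) (fun x => (2 / gam) * (x 0 2%:R * H11 x)).
Proof. exact: (smoothZ _ oC sxH). Qed.

Let sbe : smooth_on (cube p r) be.
Proof. exact: (smoothB oC sF (smoothB oC sb1 sb2)). Qed.

Let dH i x : cube p r x -> i != 1 -> partial i H x = gam * (i == 2%:R)%:R.
Proof.
move=> px; move: i; apply: all3 => // _; first by rewrite (H0 px) mulr0.
by rewrite (H2 px) mulr1.
Qed.

Let dH11 i x : cube p r x -> i != 1 -> partial i H11 x = 0.
Proof.
by move=> px; move: i; apply: all3 => // _; [exact: H11_v H0 px | exact: H11_v H2 px].
Qed.

Let dF2 i x : cube p r x -> i != 1 -> H x * partial i F2 x =
  - (2 * H11 x + gam * F2 x) * (i == 2%:R)%:R.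
Proof.
move=> px; move: i; apply: all3 => // _; first by rewrite (F2_u px) !mulr0.
have e := field px; rewrite (H2 px) -/F2 -/H11 in e.
transitivity (- 2 * (- (2^-1 * H x * partial 2%:R F2 x))); first by field.
by rewrite -e; move: (H11 x) (F2 x) => a b /=; field.
Qed.

Let dg0 i x : cube p r x -> i != 1 -> partial i g0 x = 0.
Proof.
move=> px i1.
rewrite (smooth_partialB i sH (smoothZ gam oC sx) px) (smooth_partialZ gam i sx px).
by rewrite partial_coord (dH px i1) subrr.
Qed.

Let dal i x : cube p r x -> i != 1 -> partial i al x = 0.
Proof.
move=> px i1.
rewrite (smooth_partialD i sHF sHx px) (smooth_partialM i sH F2_smooth px).
rewrite (smooth_partialM i s2H sx px) (smooth_partialZ 2 i H11_smooth px).
rewrite partial_coord (dH px i1) (dH11 px i1) (dF2 px i1).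
by move: (H11 x) (F2 x) (x 0 2%:R) => a b c; ring.
Qed.

Let dA i x : cube p r x -> i != 1 -> partial i A x = 0.
Proof.
move=> px i1.
rewrite (smooth_partialD i (smoothZ gam oC sal) (smoothZ 2 oC sgH) px).
rewrite (smooth_partialZ gam i sal px) (smooth_partialZ 2 i sgH px).
rewrite (smooth_partialM i sg0 H11_smooth px) (dal px i1) (dg0 px i1) (dH11 px i1).
by rewrite !mulr0 !addr0 !mulr0 addr0.
Qed.

Let AE x : A x = H x * (gam * F2 x + 2 * H11 x).
Proof. by rewrite /A /al /g0; move: (F2 x) (H11 x) (H x) => a b c; ring. Qed.

Let dbe i x : cube p r x -> i != 1 -> partial i be x = 0.
Proof.
move=> px i1.
rewrite (smooth_partialB i sF (smoothB oC sb1 sb2) px) (smooth_partialB i sb1 sb2 px).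
rewrite (smooth_partialZ _ i sAl px) (smooth_partialZ _ i sxH px).
rewrite (smooth_partialM i sA sl px) (smooth_partialM i sx H11_smooth px).
rewrite partial_coord (dA px i1) (dH11 px i1).
rewrite (partial_val (partial_ln i sH px (Hpos px))).
rewrite (dH px i1) AE.
have Hn : H x != 0 by rewrite gt_eqF // Hpos.
move: i i1; apply: all3 => //= _; last first.
  rewrite -/F2; move: Hn; move: (F2 x) (H11 x) (H x) (x 0 2%:R) (ln (H x)) => a b c d e c0.
  by field; rewrite gam0 c0.
rewrite (F0 px); move: Hn; move: (F2 x) (H11 x) (H x) (x 0 2%:R) (ln (H x)) => a b c d e c0.
by field; rewrite gam0 c0.
Qed.

Let of_v f y : smooth_on (cube p r) f ->
  (forall i x, cube p r x -> i != 1 -> partial i f x = 0) -> cube p r y ->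
  slice p f (y 0 1) = f y.
Proof. by move=> sf df py; apply: (function_of_v sf) py => x px; exact: df. Qed.

(** The (v,v)-component of the field equation is an ordinary differential
    equation for F in x: it says that [H F_x + 2 H_vv x] is a function alpha
    of v, and integrates to the logarithm. *)
Lemma spacelike_normal_form :
  (forall x, cube p r x -> partial 2%:R F2 x != 0) ->
  exists (gamma0 alpha beta : R -> R),
    [/\ smooth1_on (@vc R @` cube p r) gamma0,
        smooth1_on (@vc R @` cube p r) alpha,
        smooth1_on (@vc R @` cube p r) beta
      & forall y, cube p r y ->
        let v := vc y in let x := xc y in
        [/\ gam * alpha v + 2 * gamma0 v * derive1n 2 gamma0 v != 0,
            H y = gam * x + gamma0 v
          & F y = (gam * alpha v + 2 * gamma0 v * derive1n 2 gamma0 v)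
                   * ln (gamma0 v + gam * x) / gam ^+ 2
                 - 2 * x * derive1n 2 gamma0 v / gam + beta v]].
Proof.
move=> F22; exists (slice p g0), (slice p al), (slice p be); split.
- by apply: (slice_smooth1 sg0) => t; exact: vc_cube.
- by apply: (slice_smooth1 sal) => t; exact: vc_cube.
- by apply: (slice_smooth1 sbe) => t; exact: vc_cube.
move=> y py; rewrite /vc /xc; cbv zeta.
have e0 := of_v sg0 dg0 py; have e1 := of_v sal dal py; have e2 := of_v sbe dbe py.
have [_ e3] := slice_derive1n 2 sg0 (py 1).
have d11 x : cube p r x -> partial 1 (partial 1 g0) x = H11 x.
  have d1 z : cube p r z -> partial 1 g0 z = partial 1 H z.
    move=> pz; rewrite (smooth_partialB 1 sH (smoothZ gam oC sx) pz).
    by rewrite (smooth_partialZ gam 1 sx pz) partial_coord mulr0 subr0.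
  by move=> px; exact: (partial_ext_cube 1 d1 px).
have e4 : derive1n 2 (slice p g0) (y 0 1) = H11 y.
  rewrite e3 /slice /= (d11 _ (cube_slice (py 1))).
  exact: of_v H11_smooth dH11 py.
rewrite e0 e1 e2 e4.
have HE : g0 y + gam * y 0 2%:R = H y by rewrite /g0 subrK.
split.
- have -> : gam * al y + 2 * g0 y * H11 y = A y by rewrite /A mulrA.
  rewrite AE; apply: mulf_neq0; first exact/lt0r_neq0/Hpos.
  apply/eqP => z; have := dF2 py (isT : (2%:R : 'I_3) != 1).
  rewrite mulr1 (addrC (2 * _)) z oppr0 => /eqP.
  by rewrite mulf_eq0 (negbTE (F22 y py)) orbF (negbTE (lt0r_neq0 (Hpos py))).
- by rewrite addrC HE.
- rewrite HE /be.
  have -> : gam * al y + 2 * g0 y * H11 y = A y by rewrite /A mulrA.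
  move: (A y) (ln (H y)) (H11 y) (F y) (y 0 2%:R) => a b c d e.
  by field.
Qed.

End SpacelikeForm.
(** * Normal form charts around a non-flat point *)

Section Shears.
Variable R : realType.
Implicit Types (f : coords R -> R) (x y p : coords R) (u w : R -> R).

Lemma slice_continuous p r f t : smooth_on (cube p r) f -> `|t - p 0 1| < r ->
  {for t, continuous (slice p f)}.
Proof. by move=> sf tr; apply: derivable_cont; case: (is_derive_slice1 sf tr). Qed.

Lemma onv_continuous u y : derivable u (y 0 1) 1 -> {for y, continuous (onv u)}.
Proof.
move=> du; apply: (@continuous_comp _ _ _ (fun y : coords R => y 0 1) u).
  exact: continuous_coord.
exact: derivable_cont.
Qed.

Lemma sub_strip a (rho r : R) : rho <= r -> strip a rho `<=` strip a r.
Proof. by move=> rr y /= h; exact: lt_le_trans h rr. Qed.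

Lemma smooth_primitive_v p rho (f : coords R -> R) : 0 < rho ->
  smooth_on (strip (p 0 1) rho) (onv (slice p f)) ->
  exists2 mu : R -> R, smooth_on (strip (p 0 1) rho) (onv mu) &
    forall t, `|t - p 0 1| < rho -> is_derive t 1 mu (slice p f t).
Proof.
move=> rho0 sf.
have cf t : `|t - p 0 1| < rho -> {for t, continuous (slice p f)}.
  move=> tr.
  have st : strip (p 0 1) rho (setc 1 t p) by rewrite /strip /= setcE.
  have e : slice p (onv (slice p f)) = slice p f.
    by apply/funext => s; rewrite {1}/slice /onv setcE.
  rewrite -e; apply: derivable_cont.
  by have [] := is_derive_slice (smooth_derivable (i := 1) sf st).
have [mu _ dmu] := antiderivative_open cf.
exists mu; last exact: dmu.
apply/smooth_onP; case=> [|n].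
  by move=> y Sy; apply: onv_continuous; case: (dmu _ Sy).
exact: (ck_onv dmu (smooth_ck n sf)).
Qed.

(** The functions of v by which the coordinates are sheared: the geodesic
    equation removes the terms of F that are linear in x, and a quadrature
    removes the remaining function of v. *)
Lemma shear_functions p r (K P Q : coords R -> R) : 0 < r ->
  smooth_on (cube p r) K -> smooth_on (cube p r) P -> smooth_on (cube p r) Q ->
  exists (rho : R) (xi eta mu : R -> R),
    [/\ 0 < rho < r, smooth_on (strip (p 0 1) rho) (onv xi),
        smooth_on (strip (p 0 1) rho) (onv eta),
        smooth_on (strip (p 0 1) rho) (onv mu)
      & forall t, `|t - p 0 1| < rho ->
        [/\ is_derive t 1 xi (eta t),
            is_derive t 1 eta (slice p P t / 2 - slice p K t * xi t)
          & is_derive t 1 mu (2^-1 * (slice p K t * (xi t * xi t)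
              - slice p P t * xi t - slice p Q t - eta t * eta t))]].
Proof.
move=> r0 sK sP sQ.
have cP t : `|t - p 0 1| < r -> {for t, continuous (fun t => slice p P t / 2)}.
  move=> tr; apply: continuousM; first exact: slice_continuous tr.
  exact: cst_continuous.
have [rho [xi [eta [rhor sol]]]] :=
  linear_ode r0 (fun t tr => slice_continuous sK tr) cP.
have /andP[rho0 rr] := rhor.
have oS := @open_strip R (p 0 1) rho.
have onvS f : smooth_on (cube p r) f -> smooth_on (strip (p 0 1) rho) (onv (slice p f)).
  by move=> sf; apply: smooth_sub (smooth_onv sf); exact/sub_strip/ltW.
have cke n : ck n (strip (p 0 1) rho) (onv xi) /\ ck n (strip (p 0 1) rho) (onv eta).
  elim: n => [|n [c1 c2]].
    split=> y Sy; apply: onv_continuous; case: (sol _ Sy) => -[h _] [h' _].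
      exact: h.
    exact: h'.
  split; first by apply: ck_onv c2 => t /sol[].
  apply: (@ck_onv R n (p 0 1) rho eta (fun t => slice p P t / 2 - slice p K t * xi t)).
    by move=> t /sol[].
  have s1 := smooth_ck n (smoothZ 2^-1 oS (onvS _ sP)).
  have s2 := ckM oS (smooth_ck n (onvS _ sK)) c1.
  have s3 := ckD oS s1 (ckN oS s2).
  by apply: (eq_ck oS _ s3) => y Sy; rewrite /onv mulrC.
have sxi : smooth_on (strip (p 0 1) rho) (onv xi).
  by apply/smooth_onP => n; case: (cke n).
have seta : smooth_on (strip (p 0 1) rho) (onv eta).
  by apply/smooth_onP => n; case: (cke n).
pose f y := 2^-1 * (slice p K (y 0 1) * (xi (y 0 1) * xi (y 0 1))
  - slice p P (y 0 1) * xi (y 0 1) - slice p Q (y 0 1) - eta (y 0 1) * eta (y 0 1)).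
have sf : smooth_on (strip (p 0 1) rho) f.
  apply: (smoothZ _ oS).
  apply: (smoothB oS); last exact: (smoothM oS seta seta).
  apply: (smoothB oS); last exact: (onvS _ sQ).
  apply: (smoothB oS); last exact: (smoothM oS (onvS _ sP) sxi).
  exact: (smoothM oS (onvS _ sK) (smoothM oS sxi sxi)).
have ef t : slice p f t = 2^-1 * (slice p K t * (xi t * xi t)
  - slice p P t * xi t - slice p Q t - eta t * eta t).
  by rewrite /f {1}/slice setcE.
have [|mu smu dmu] := @smooth_primitive_v p rho f rho0.
  rewrite (_ : onv (slice p f) = f) //.
  by apply/funext => y; rewrite /onv ef.
exists rho, xi, eta, mu; split; [exact: rhor | exact: sxi | exact: seta | exact: smu |].
move=> t tr; have [d1 d2] := sol t tr.
by split; [exact: d1 | exact: d2 | rewrite -ef; exact: dmu].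
Qed.

(** The effect on the metric of x |-> x - xi(v) and then of
    u |-> u + eta(v) x - mu(v). *)
Lemma shear_x (G : 'I_3 -> 'I_3 -> R) (d : 'I_3 -> R) (F e : R) :
  d 0 = 0 -> d 1 = - e -> d 2%:R = 1 ->
  (forall a b : 'I_3, brinkmann F a b =
    \sum_l (\sum_k (if k == 2%:R then d a else (a == k)%:R) * G k l)
      * (if l == 2%:R then d b else (b == l)%:R)) ->
  [/\ G 0 0 = 0 /\ G 2%:R 2%:R = 1, G 0 1 = 1 /\ G 1 0 = 1,
      G 0 2%:R = 0 /\ G 2%:R 0 = 0, G 1 2%:R = e /\ G 2%:R 1 = e
    & G 1 1 = F + e ^+ 2].
Proof.
move=> d0 d1 d2 E.
have e00 := E 0 0; have e01 := E 0 1; have e02 := E 0 2%:R.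
have e10 := E 1 0; have e11 := E 1 1; have e12 := E 1 2%:R.
have e20 := E 2%:R 0; have e21 := E 2%:R 1; have e22 := E 2%:R 2%:R.
rewrite !mxE !sum3 /= d0 in e00; rewrite !mxE !sum3 /= d0 d1 in e01.
rewrite !mxE !sum3 /= d0 d2 in e02; rewrite !mxE !sum3 /= d0 d1 in e10.
rewrite !mxE !sum3 /= d1 in e11; rewrite !mxE !sum3 /= d1 d2 in e12.
rewrite !mxE !sum3 /= d0 d2 in e20; rewrite !mxE !sum3 /= d1 d2 in e21.
rewrite !mxE !sum3 /= d2 in e22; clear E.
move: (G 0 0) (G 0 1) (G 0 2%:R) (G 1 0) (G 1 1) (G 1 2%:R) (G 2%:R 0) (G 2%:R 1)
  (G 2%:R 2%:R) e00 e01 e02 e10 e11 e12 e20 e21 e22 => a b c a' b' c' a'' b'' c''.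
move=> e00 e01 e02 e10 e11 e12 e20 e21 e22.
have h22 : c'' = 1 by lra.
have h02 : c = 0 by lra.
have h20 : a'' = 0 by lra.
have h00 : a = 0 by lra.
rewrite h22 h02 h20 h00 in e01 e10 e11 e12 e21 *.
have h01 : b = 1 by lra.
have h10 : a' = 1 by lra.
have h12 : c' = e by lra.
have h21 : b'' = e by lra.
rewrite h01 h10 h12 h21 in e11 *.
split => //; rewrite [in RHS]e11; ring.
Qed.

Lemma shear_u (G G' : 'I_3 -> 'I_3 -> R) (d : 'I_3 -> R) (F e f : R) :
  d 0 = 1 -> d 1 = f -> d 2%:R = e ->
  [/\ G 0 0 = 0 /\ G 2%:R 2%:R = 1, G 0 1 = 1 /\ G 1 0 = 1,
      G 0 2%:R = 0 /\ G 2%:R 0 = 0, G 1 2%:R = e /\ G 2%:R 1 = e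
    & G 1 1 = F + e ^+ 2] ->
  (forall a b : 'I_3, G a b =
    \sum_l (\sum_k (if k == 0 then d a else (a == k)%:R) * G' k l)
      * (if l == 0 then d b else (b == l)%:R)) ->
  forall i j : 'I_3, G' i j = brinkmann (F + e ^+ 2 - 2 * f) i j.
Proof.
move=> d0 d1 d2 [[g00 g22] [g01 g10] [g02 g20] [g12 g21] g11] E.
have e00 := E 0 0; have e01 := E 0 1; have e02 := E 0 2%:R.
have e10 := E 1 0; have e11 := E 1 1; have e12 := E 1 2%:R.
have e20 := E 2%:R 0; have e21 := E 2%:R 1; have e22 := E 2%:R 2%:R.
rewrite g00 !sum3 /= d0 in e00; rewrite g01 !sum3 /= d0 d1 in e01.
rewrite g02 !sum3 /= d0 d2 in e02; rewrite g10 !sum3 /= d0 d1 in e10.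
rewrite g11 !sum3 /= d1 in e11; rewrite g12 !sum3 /= d1 d2 in e12.
rewrite g20 !sum3 /= d0 d2 in e20; rewrite g21 !sum3 /= d1 d2 in e21.
rewrite g22 !sum3 /= d2 in e22; clear E.
move=> i j; rewrite mxE; move: i j.
have h00 : G' 0 0 = 0 by lra.
rewrite h00 in e01 e02 e10 e20 e11 e12 e21 e22.
have h01 : G' 0 1 = 1 by lra.
have h02 : G' 0 2%:R = 0 by lra.
have h10 : G' 1 0 = 1 by lra.
have h20 : G' 2%:R 0 = 0 by lra.
rewrite h01 h02 h10 h20 in e11 e12 e21 e22.
have h22 : G' 2%:R 2%:R = 1 by lra.
have h12 : G' 1 2%:R = 0 by lra.
have h21 : G' 2%:R 1 = 0 by lra.
have h11 : G' 1 1 = F + e ^+ 2 - 2 * f by lra.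
by apply: all3; apply: all3.
Qed.

End Shears.

Section NormalFormCharts.
Variables (R : realType) (M : topologicalType) (S : smooth_structure R M).
Variables (g : chart R M -> tensor2 R) (V : chart R M -> vfield R).
Variables (h : M -> R) (L : R).
Hypotheses (lor : lorentz_metric S g) (pp : pp_field S g V).
Hypotheses (sh : smooth_function S h) (fe : field_equation S g h L).
Hypothesis (conn : connected [set: M]).
Hypothesis nf : exists q, nonflat_at S g q.
Hypothesis hpos : forall q, 0 < h q.
Implicit Types (c : chart R M) (q : M) (i j k : 'I_3) (x y : coords R).

Notation hl := (local_expr h).
Notation bchart := (bchart S g V).

Lemma shrink_bchart c q r r' : cubic_chart S c q r -> bchart c -> 0 < r' ->
  cube (cmap c q) r' `<=` cimg c ->
  exists c1, [/\ cubic_chart S c1 q r', bchart c1, cmap c1 q = cmap c q,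
    forall z, cdom c1 z -> cdom c z /\ cmap c1 z = cmap c z
    & forall x, cimg c1 x -> cimg c x /\ Fb g c1 x = Fb g c x].
Proof.
move=> [r0 Sc cq cE] [_ VE gE F0] r'0 sub.
have [c1 [cub1 sub1 e]] := shrink_chart Sc cq r'0 sub.
have [_ Sc1 c1q c1E] := cub1.
have same x : cimg c1 x -> V c1 x = V c x /\ g c1 x = g c x.
  by move=> /cimgP[z c1z ->]; exact: (same_chart lor pp).
have in1 x : cimg c1 x -> cimg c x by rewrite c1E e; exact: sub.
have eF x : cimg c1 x -> Fb g c1 x = Fb g c x.
  by move=> cx; rewrite /Fb; case: (same x cx) => _ ->.
exists c1; split => //.
- split=> // x cx; have [e1 e2] := same x cx.
  + by move=> k; rewrite e1; exact: VE (in1 x cx) k.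
  + by rewrite e2 (gE x (in1 x cx)) eF.
  + by rewrite (eq_partial 0 (@open_cimg _ _ c1) eF cx); exact: F0 (in1 x cx).
- by move=> z c1z; split; [exact: sub1 | exact: e].
- by move=> x cx; split; [exact: in1 | exact: eF].
Qed.

Lemma nonflat_bchart q : nonflat_at S g q -> exists c r,
  [/\ cubic_chart S c q r, bchart c
    & forall x, cimg c x -> partial 2%:R (partial 2%:R (Fb g c)) x != 0].
Proof.
move=> nq; have [c [r [cub bc]]] := bchart_exists lor pp q.
have [r0 Sc cq cE] := cub; have cx := cimg_cmap cq.
have F22 := nonflat_F22 lor bc cq nq.
have sF22 := smooth_partial 2%:R (smooth_partial 2%:R (Fb_smooth lor bc)).
have n1 : \forall y \near cmap c q, partial 2%:R (partial 2%:R (Fb g c)) y != 0.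
  exact: (cvgr_neq0 _ (smooth_cont sF22 cx) F22).
have n2 : nbhs (cmap c q) (cimg c) by rewrite cE; exact: nbhs_cube.
have [r' r'0 sub] := nbhs_sub_cube (filterI n1 n2).
have [c1 [cub1 bc1 e1 _ same]] := shrink_bchart cub bc r'0 (fun x cx => (sub x cx).2).
exists c1, r'; split; [exact: cub1 | exact: bc1 | move=> x c1x].
have oC1 := @open_cimg _ _ c1.
have eF y : cimg c1 y -> Fb g c1 y = Fb g c y by move=> /same[].
have e2 y : cimg c1 y -> partial 2%:R (Fb g c1) y = partial 2%:R (Fb g c) y.
  by move=> cy; exact: (eq_partial 2%:R oC1 eF cy).
rewrite (eq_partial 2%:R oC1 e2 c1x).
have [_ _ _ c1E] := cub1; rewrite c1E e1 in c1x.
by case: (sub x c1x).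
Qed.

Lemma spacelike_chart q : nonflat_at S g q ->
  (forall c, atlas S c -> cdom c q -> grad_norm2 g h c (cmap c q) != 0) ->
  exists c, [/\ atlas S c, cdom c q & spacelike_form g h c].
Proof.
move=> nq gn; have [c [r [cub bc F22]]] := nonflat_bchart nq.
have [r0 Sc cq cE] := cub; exists c; split => //.
have cx := cimg_cmap cq; have [_ VE gE F0] := bc.
set p := cmap c q in cx cE.
have gam0 : partial 2%:R (hl c) p != 0.
  have := gn c Sc cq; rewrite (grad_norm2_b lor pp sh fe conn nf bc cx).
  by rewrite expf_eq0.
have sH := h_smooth sh Sc; have sF := Fb_smooth lor bc.
rewrite cE in sH sF F0 F22 gE.
have [||||gamma0 [alpha [beta [s0 s1 s2 E]]]] :=
  @spacelike_normal_form R p r (hl c) (Fb g c) (partial 2%:R (hl c) p) sH sF F0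
    _ _ _ _ gam0 F22.
- by move=> x; rewrite -cE => cx'; exact: (hu0 lor pp sh fe conn nf bc cx').
- by move=> x; rewrite -cE => cx'; exact: (hx_const lor pp sh fe conn nf cub bc cx').
- by move=> x; rewrite -cE => -[z cz <-]; rewrite hlE.
- by move=> x; rewrite -cE => cx'; exact: (field_b0 lor pp sh fe conn nf bc cx').
exists (partial 2%:R (hl c) p), gamma0, alpha, beta; rewrite cE; split => //.
cbv zeta => y py; have [e1 e2 e3] := E y py; split; [exact: e1 | exact: e2 |].
by rewrite (gE y py) e3.
Qed.

(** When the gradient is lightlike, the (v,v)-component of the field equation
    expresses F_xx through h, which is a function of v alone. *)
Lemma lightlike_profile c q r : cubic_chart S c q r -> bchart c ->
  grad_norm2 g h c (cmap c q) = 0 ->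
  forall x, cimg c x -> let F22 := partial 2%:R (partial 2%:R (Fb g c)) in
  [/\ partial 2%:R (hl c) x = 0,
      partial 1 (partial 1 (hl c)) x = - (2^-1 * (hl c x * F22 x)),
      partial 0 F22 x = 0 & partial 2%:R F22 x = 0].
Proof.
move=> cub bc gn; have [r0 Sc cq cE] := cub.
have cp := cimg_cmap cq; have [_ VE gE F0] := bc.
set p := cmap c q in cp cE.
have hp : partial 2%:R (hl c) p = 0.
  have := gn; rewrite (grad_norm2_b lor pp sh fe conn nf bc cp) => /eqP.
  by rewrite expf_eq0 => /eqP.
pose H := hl c; pose F := Fb g c.
have sH : smooth_on (cube p r) H by rewrite -cE; exact: (h_smooth sh Sc).
have sF : smooth_on (cube p r) F by rewrite -cE; exact: (Fb_smooth lor bc).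
have H0 x : cube p r x -> partial 0 H x = 0.
  by rewrite -cE => cx'; exact: (hu0 lor pp sh fe conn nf bc cx').
have H2 x : cube p r x -> partial 2%:R H x = 0.
  rewrite -cE => cx'; rewrite /H (hx_const lor pp sh fe conn nf cub bc cx').
  exact: hp.
have Hpos x : cube p r x -> 0 < H x.
  by rewrite -cE => -[z cz <-]; rewrite /H hlE.
have F_0 x : cube p r x -> partial 0 F x = 0 by rewrite -cE; exact: F0.
pose H11 := partial 1 (partial 1 H); pose F2 := partial 2%:R F.
have sH11 : smooth_on (cube p r) H11 by exact/smooth_partial/smooth_partial.
have sF2 : smooth_on (cube p r) F2 by exact/smooth_partial.
have sFF : smooth_on (cube p r) (partial 2%:R F2) by exact/smooth_partial.
have HE x : cube p r x -> H11 x = - (2^-1 * (H x * partial 2%:R F2 x)).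
  move=> px; have := px; rewrite -cE => cx'.
  have := field_b0 lor pp sh fe conn nf bc cx'.
  by rewrite -/H (H2 x px) mulr0 addr0 -mulrA.
have dH11_0 x : cube p r x -> partial 0 H11 x = 0 by exact: (H11_v sH H0).
have dH11_2 x : cube p r x -> partial 2%:R H11 x = 0 by exact: (H11_v sH H2).
have F2_0 x : cube p r x -> partial 0 F2 x = 0 by exact: (F2_u sF F_0).
have F22_0 x : cube p r x -> partial 0 (partial 2%:R F2) x = 0.
  by exact: (F2_u sF2 F2_0).
have oC := @open_cube R p r.
have F22_2 x : cube p r x -> partial 2%:R (partial 2%:R F2) x = 0.
  move=> px; apply: (mulfI (lt0r_neq0 (Hpos x px))).
  have e y : cube p r y -> H y * partial 2%:R F2 y = - 2 * H11 y.
    by move=> py; rewrite (HE y py); move: (H y * _) => a; field.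
  have l := smooth_partialM 2%:R sH sFF px.
  have l' := etrans (esym l) (etrans (partial_ext_cube 2%:R e px)
    (etrans (smooth_partialZ (- 2) 2%:R sH11 px) (congr1 ( *%R (- 2)) (dH11_2 x px)))).
  rewrite (H2 x px) in l'; move: l' => {}l.
  move: (partial _ _ _) (H x) (partial _ _ _) l => a b d l.
  by lra.
move=> x; rewrite cE => px; cbv zeta.
split; [exact: H2 | exact: HE | exact: F22_0 | exact: F22_2].
Qed.

(** The metric function is a quadratic polynomial in x with leading coefficient
    [- alpha'' / alpha] by the field equation; the lower order terms are
    removed by a shear. *)
Lemma lightlike_chart q : nonflat_at S g q ->
  (forall c, atlas S c -> cdom c q -> grad_norm2 g h c (cmap c q) = 0) ->
  exists c, [/\ atlas S c, cdom c q & lightlike_form g h c].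
Proof.
move=> nq gn; have [c [r [cub bc F22]]] := nonflat_bchart nq.
have [r0 Sc cq cE] := cub.
have cp := cimg_cmap cq; have [_ VE gE F0] := bc.
set p := cmap c q in cp cE.
pose H := hl c; pose F := Fb g c.
have sH : smooth_on (cube p r) H by rewrite -cE; exact: (h_smooth sh Sc).
have sF : smooth_on (cube p r) F by rewrite -cE; exact: (Fb_smooth lor bc).
have H0 x : cube p r x -> partial 0 H x = 0.
  by rewrite -cE => cx'; exact: (hu0 lor pp sh fe conn nf bc cx').
have Hpos x : cube p r x -> 0 < H x.
  by rewrite -cE => -[z cz <-]; rewrite /H hlE.
have F_0 x : cube p r x -> partial 0 F x = 0 by rewrite -cE; exact: F0.
have F_22 x : cube p r x -> partial 2%:R (partial 2%:R F) x != 0.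
  by rewrite -cE; exact: F22.
have prof := lightlike_profile cub bc (gn c Sc cq); rewrite cE in prof.
pose H11 := partial 1 (partial 1 H); pose F2 := partial 2%:R F.
have sH11 : smooth_on (cube p r) H11 by exact/smooth_partial/smooth_partial.
have sF2 : smooth_on (cube p r) F2 by exact/smooth_partial.
have sFF : smooth_on (cube p r) (partial 2%:R F2) by exact/smooth_partial.
have H2 x : cube p r x -> partial 2%:R H x = 0.
  by move=> px; have [e _ _ _] := prof x px; exact: e.
have HE x : cube p r x -> H11 x = - (2^-1 * (H x * partial 2%:R F2 x)).
  by move=> px; have [_ e _ _] := prof x px; exact: e.
have F22_0 x : cube p r x -> partial 0 (partial 2%:R F2) x = 0.
  by move=> px; have [_ _ e _] := prof x px; exact: e.
have F22_2 x : cube p r x -> partial 2%:R (partial 2%:R F2) x = 0.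
  by move=> px; have [_ _ _ e] := prof x px; exact: e.
have dH11_0 x : cube p r x -> partial 0 H11 x = 0 by exact: (H11_v sH H0).
have dH11_2 x : cube p r x -> partial 2%:R H11 x = 0 by exact: (H11_v sH H2).
have F2_0 x : cube p r x -> partial 0 F2 x = 0 by exact: (F2_u sF F_0).
have oC := @open_cube R p r.
(* F = - K x^2 + P x + Q, where K, P and Q depend on v alone *)
pose K x := - 2^-1 * partial 2%:R F2 x.
have sK : smooth_on (cube p r) K by exact: (smoothZ _ oC sFF).
have K0 x : cube p r x -> partial 0 K x = 0.
  by move=> px; rewrite (smooth_partialZ _ 0 sFF px) (F22_0 x px) mulr0.
have K2 x : cube p r x -> partial 2%:R K x = 0.
  by move=> px; rewrite (smooth_partialZ _ 2%:R sFF px) (F22_2 x px) mulr0.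
have sx := @smooth_coord R (cube p r) 2%:R.
pose P x := F2 x + 2 * (K x * x 0 2%:R).
have sKx := smoothM oC sK sx.
have s2Kx := smoothZ 2 oC sKx.
have sP : smooth_on (cube p r) P by exact: (smoothD oC sF2 s2Kx).
have P0 x : cube p r x -> partial 0 P x = 0.
  move=> px; rewrite (smooth_partialD 0 sF2 s2Kx px) (smooth_partialZ 2 0 sKx px).
  rewrite (smooth_partialM 0 sK sx px) (K0 x px) (F2_0 x px) partial_coord.
  by move: (K x) (x 0 2%:R) => a b /=; ring.
have P2 x : cube p r x -> partial 2%:R P x = 0.
  move=> px; rewrite (smooth_partialD 2%:R sF2 s2Kx px) (smooth_partialZ 2 2%:R sKx px).
  rewrite (smooth_partialM 2%:R sK sx px) (K2 x px) partial_coord.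
  by rewrite /K mulr0 addr0 mulr1; move: (partial _ _ _) => a; field.
pose Q x := F x + (K x * x 0 2%:R) * x 0 2%:R - P x * x 0 2%:R.
have sKxx := smoothM oC sKx sx; have sPx := smoothM oC sP sx.
have sQ : smooth_on (cube p r) Q.
  exact: (smoothB oC (smoothD oC sF sKxx) sPx).
have Q0 x : cube p r x -> partial 0 Q x = 0.
  move=> px; rewrite (smooth_partialB 0 (smoothD oC sF sKxx) sPx px).
  rewrite (smooth_partialD 0 sF sKxx px) (smooth_partialM 0 sKx sx px).
  rewrite (smooth_partialM 0 sK sx px) (smooth_partialM 0 sP sx px).
  rewrite (K0 x px) (P0 x px) (F_0 x px) partial_coord.
  by move: (P x) (K x) (x 0 2%:R) => a b d /=; ring.
have Q2 x : cube p r x -> partial 2%:R Q x = 0.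
  move=> px; rewrite (smooth_partialB 2%:R (smoothD oC sF sKxx) sPx px).
  rewrite (smooth_partialD 2%:R sF sKxx px) (smooth_partialM 2%:R sKx sx px).
  rewrite (smooth_partialM 2%:R sK sx px) (smooth_partialM 2%:R sP sx px).
  rewrite (K2 x px) (P2 x px) partial_coord /P -/F2 /=.
  by move: (F2 x) (K x) (x 0 2%:R) => a b d; ring.
have [rho [xi [eta [mu [rhor sxi seta smu D]]]]] := shear_functions r0 sK sP sQ.
have /andP[rho0 rr] := rhor.
have [|c1 [cub1 bc1 e1 sub1 same1]] := @shrink_bchart c q r rho cub bc rho0.
  by rewrite cE; exact/subcube/ltW.
have [_ Sc1 c1q c1E] := cub1; rewrite e1 -/p in c1E.
have [_ _ g1E _] := bc1.
have in_strip x : cimg c1 x -> strip (p 0 1) rho x by rewrite c1E => px; exact: px.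
have oC1 := @open_cimg _ _ c1.
have scoord j U : smooth_on U (fun x : coords R => x 0 j) by exact: smooth_coord.
have sxi1 : smooth_on (cimg c1) (onv xi) by apply: smooth_sub sxi.
pose phi x := x 0 2%:R - onv xi x.
have sphi : smooth_on (cimg c1) phi by exact: (smoothB oC1 (scoord 2%:R _) sxi1).
have dphi i x : cimg c1 x ->
    partial i phi x = (i == 2%:R)%:R - eta (x 0 1) * (i == 1)%:R.
  move=> cx; rewrite (smooth_partialB i (scoord 2%:R _) sxi1 cx) partial_coord.
  by have [d _ _] := D _ (in_strip _ cx); rewrite (partial_val (is_derive_onv i d)).
have [|c2 [d2 [cub2 rp2]]] := replace_chart (i := 2%:R) cub1 sphi.
  by rewrite dphi ?mulr0 ?subr0 ?oner_eq0 //; exact: cimg_cmap.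
have [_ Sc2 _ _] := cub2; have [sub2 E2] := rp2.
have oC2 := @open_cimg _ _ c2.
have cm2 z : cdom c2 z -> cmap c2 z 0 1 = cmap c1 z 0 1 /\
    cmap c2 z 0 2%:R = phi (cmap c1 z).
  by move=> c2z; rewrite E2 // !setcE.
have in_strip2 x : cimg c2 x -> strip (p 0 1) rho x.
  move=> /cimgP[z c2z ->]; rewrite /strip /= (cm2 z c2z).1.
  exact: (in_strip _ (cimg_cmap (sub2 _ c2z))).
have seta2 : smooth_on (cimg c2) (onv eta) by apply: smooth_sub seta.
have smu2 : smooth_on (cimg c2) (onv mu) by apply: smooth_sub smu.
pose psi x := x 0 0 + onv eta x * x 0 2%:R - onv mu x.
have sex := smoothM oC2 seta2 (scoord 2%:R (cimg c2)).
have s0e := smoothD oC2 (scoord 0 (cimg c2)) sex.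
have spsi : smooth_on (cimg c2) psi by exact: (smoothB oC2 s0e smu2).
pose b' t := slice p P t / 2 - slice p K t * xi t.
pose m' t := 2^-1 * (slice p K t * (xi t * xi t)
              - slice p P t * xi t - slice p Q t - eta t * eta t).
have dpsi i x : cimg c2 x -> partial i psi x = (i == 0)%:R
    + (eta (x 0 1) * (i == 2%:R)%:R + x 0 2%:R * (b' (x 0 1) * (i == 1)%:R))
    - m' (x 0 1) * (i == 1)%:R.
  move=> cx; rewrite (smooth_partialB i s0e smu2 cx).
  rewrite (smooth_partialD i (scoord 0 (cimg c2)) sex cx).
  rewrite (smooth_partialM i seta2 (scoord 2%:R _) cx) !partial_coord.
  have [_ de dm] := D _ (in_strip2 _ cx).
  by rewrite (partial_val (is_derive_onv i de)) (partial_val (is_derive_onv i dm)).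
have [|c3 [d3 [cub3 rp3]]] := replace_chart (i := 0) cub2 spsi.
  rewrite dpsi; last by case: cub2 => _ _ c2q _; exact: cimg_cmap.
  by rewrite !mulr0 !addr0 subr0 oner_eq0.
have [_ Sc3 c3q _] := cub3; have [sub3 E3] := rp3.
exists c3; split => //; exists (slice p H).
have cm3 z : cdom c3 z -> cmap c3 z 0 1 = cmap c1 z 0 1 /\
    cmap c3 z 0 2%:R = phi (cmap c1 z).
  move=> c3z; have [h1 h2] := cm2 z (sub3 _ c3z).
  by rewrite E3 // !setcE /= h1 h2.
split.
  apply: (slice_smooth1 sH) => t [y /cimgP[z c3z ->] <-].
  rewrite /vc (cm3 z c3z).1; apply: lt_trans rr.
  exact: (in_strip _ (cimg_cmap (sub2 _ (sub3 _ c3z)))).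
cbv zeta => y /cimgP[z c3z ->].
have c2z := sub3 _ c3z; have c1z := sub2 _ c2z.
have [cz e1z] := sub1 z c1z.
have c1x := cimg_cmap c1z; set x := cmap c1 z in c1x e1z.
rewrite /vc /xc (cm3 z c3z).1 (cm3 z c3z).2 -/x.
have px : cube p r x by rewrite -cE e1z; exact: cimg_cmap.
have t_r := px 1; have t_rho : `|x 0 1 - p 0 1| < rho by exact: in_strip.
have ofv f : smooth_on (cube p r) f -> (forall x, cube p r x -> partial 0 f x = 0) ->
    (forall x, cube p r x -> partial 2%:R f x = 0) -> slice p f (x 0 1) = f x.
  by move=> sf f0 f2; exact: (function_of_v sf f0 f2 px).
have eH := ofv H sH H0 H2.
have [_ e2] := slice_derive1n 2 sH t_r.
have e11 : slice p H11 (x 0 1) = H11 x.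
  exact: (ofv _ sH11 dH11_0 dH11_2).
have eK := ofv K sK K0 K2; have eP := ofv P sP P0 P2; have eQ := ofv Q sQ Q0 Q2.
have eD : derive1n 2 (slice p H) (x 0 1) = H11 x := etrans e2 e11.
rewrite eD eH.
have Hn := lt0r_neq0 (Hpos x px).
have KE : H11 x / H x = K x.
  rewrite (HE x px) /K; move: (partial _ _ _) (H x) Hn => a b b0; field.
  by rewrite b0.
split.
- rewrite (HE x px) oppr_eq0; apply: mulf_neq0; first by rewrite invr_eq0 pnatr_eq0.
  by apply: mulf_neq0 Hn _; exact: F_22.
- have a1 : hl c3 (cmap c3 z) = h z by exact: hlE.
  have a2 : hl c (cmap c z) = h z by exact: hlE.
  exact: etrans a1 (esym (etrans (congr1 H e1z) a2)).
rewrite KE.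
set y2 := cmap c2 z; set y3 := cmap c3 z.
have c2x : cimg c2 y2 by exact: cimg_cmap.
have [y2v y2x] := cm2 z c2z; rewrite -/x -/y2 in y2v y2x.
have G2 := @shear_x _ (g c2 y2) (fun a => partial a phi x) (Fb g c1 x) (eta (x 0 1)).
have {}G2 := G2 (_ : partial 0 phi x = 0) (_ : partial 1 phi x = - eta (x 0 1))
  (_ : partial 2%:R phi x = 1).
have {}G2 := G2 _ _ _ _; have [||||g00 g01 g02 g12 g11] := G2.
- by rewrite (dphi 0 x c1x); move: (eta _) => a /=; ring.
- by rewrite (dphi 1 x c1x); move: (eta _) => a /=; ring.
- by rewrite (dphi 2%:R x c1x); move: (eta _) => a /=; ring.
- by move=> a b; rewrite -(g1E x c1x); exact: (g_replaced lor Sc1 Sc2 rp2 c2z).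
have G3 := @shear_u _ (g c2 y2) (g c3 y3) (fun a => partial a psi y2) (Fb g c1 x)
  (eta (x 0 1)) (phi x * b' (x 0 1) - m' (x 0 1)).
have {}G3 := G3 _ _ _ (And5 g00 g01 g02 g12 g11)
  (g_replaced lor Sc2 Sc3 rp3 c3z).
apply/matrixP => i j; rewrite G3.
- congr (brinkmann _ i j).
  rewrite /b' /m' eK eP eQ (same1 x c1x).2 /Q -/F /phi /onv.
  move: (F x) (K x) (P x) (x 0 2%:R) (xi _) (eta _) => fx k0 p1 x2 xi0 eta0.
  by field.
- rewrite (dpsi 0 y2 c2x); move: (eta _) (b' _) (m' _) (y2 0 2%:R) => a b d k /=; ring.
- rewrite (dpsi 1 y2 c2x) y2v y2x.
  move: (eta _) (b' _) (m' _) (phi x) => a b d k /=; ring.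
- rewrite (dpsi 2%:R y2 c2x) y2v.
  move: (eta _) (b' _) (m' _) (y2 0 2%:R) => a b d k /=; ring.
Qed.

End NormalFormCharts.
(** * Curvature identities in matrix form *)

Section MatrixCalculus.
Variable R : realType.
Implicit Types (U : set (coords R)) (x y : coords R) (i j k : 'I_3).

Lemma smooth_prods U (I : Type) (s : seq I) (F : I -> coords R -> R) : open U ->
  (forall a, smooth_on U (F a)) -> smooth_on U (fun x => \prod_(a <- s) F a x).
Proof.
move=> oU sF; elim: s => [|a s IH].
  rewrite (_ : (fun x => _) = fun=> 1); first exact: smooth_cst.
  by apply/funext => x; rewrite big_nil.
rewrite (_ : (fun x => _) = fun x => F a x * \prod_(b <- s) F b x).
  exact: (smoothM oU (sF a) IH).
by apply/funext => x; rewrite big_cons.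
Qed.

Lemma partial_sums U (I : Type) (s : seq I) (F : I -> coords R -> R) i x : open U ->
  (forall a, smooth_on U (F a)) -> U x ->
  partial i (fun y => \sum_(a <- s) F a y) x = \sum_(a <- s) partial i (F a) x.
Proof.
move=> oU sF Ux; elim: s => [|a s IH].
  rewrite big_nil (_ : (fun x => _) = fun=> 0); first exact: partial_cst.
  by apply/funext => y; rewrite big_nil.
rewrite big_cons -IH (_ : (fun x => _) = fun x => F a x + \sum_(b <- s) F b x).
  by rewrite (smooth_partialD i (sF a) (smooth_sum s oU sF) Ux).
by apply/funext => y; rewrite big_cons.
Qed.

Definition smx U m n (A : coords R -> 'M[R]_(m, n)) :=
  forall a b, smooth_on U (fun x => A x a b).

Definition dmx m n i (A : coords R -> 'M[R]_(m, n)) x : 'M[R]_(m, n) :=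
  \matrix_(a, b) partial i (fun y => A y a b) x.

Variable U : set (coords R).
Hypothesis oU : open U.

Lemma mulmx_entry m n q (A : coords R -> 'M[R]_(m, n)) (B : coords R -> 'M[R]_(n, q)) a b :
  (fun y => (A y *m B y) a b) = fun y => \sum_k A y a k * B y k b.
Proof. by apply/funext => y; rewrite mxE. Qed.

Lemma smxM m n q (A : coords R -> 'M[R]_(m, n)) (B : coords R -> 'M[R]_(n, q)) :
  smx U A -> smx U B -> smx U (fun y => A y *m B y).
Proof.
move=> sA sB a b; rewrite mulmx_entry; apply: (smooth_sum _ oU) => k.
exact: (smoothM oU (sA a k) (sB k b)).
Qed.

Lemma dmxM m n q (A : coords R -> 'M[R]_(m, n)) (B : coords R -> 'M[R]_(n, q)) i x :
  smx U A -> smx U B -> U x ->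
  dmx i (fun y => A y *m B y) x = dmx i A x *m B x + A x *m dmx i B x.
Proof.
move=> sA sB Ux; apply/matrixP => a b; rewrite !mxE mulmx_entry.
have sAB (k : 'I_n) : smooth_on U (fun y => A y a k * B y k b).
  exact: (smoothM oU (sA a k) (sB k b)).
rewrite (partial_sums _ i oU sAB Ux) -big_split /=; apply: eq_bigr => k _.
rewrite (smooth_partialM i (sA a k) (sB k b) Ux) !mxE addrC.
by congr (_ + _); exact: mulrC.
Qed.

Lemma smx_tr m n (A : coords R -> 'M[R]_(m, n)) : smx U A -> smx U (fun y => (A y)^T).
Proof.
move=> sA a b; rewrite (_ : (fun x => _) = fun x => A x b a); first exact: sA.
by apply/funext => x; rewrite mxE.
Qed.

Lemma dmx_tr m n (A : coords R -> 'M[R]_(m, n)) i x :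
  dmx i (fun y => (A y)^T) x = (dmx i A x)^T.
Proof.
apply/matrixP => a b; rewrite !mxE; congr (partial i _ x).
by apply/funext => y; rewrite mxE.
Qed.

Lemma smxN m n (A : coords R -> 'M[R]_(m, n)) : smx U A -> smx U (fun y => - A y).
Proof.
move=> sA a b; rewrite (_ : (fun x => _) = fun x => - A x a b).
  exact: (smoothN oU (sA a b)).
by apply/funext => x; rewrite mxE.
Qed.

Lemma dmxN m n (A : coords R -> 'M[R]_(m, n)) i x : smx U A -> U x ->
  dmx i (fun y => - A y) x = - dmx i A x.
Proof.
move=> sA Ux; apply/matrixP => a b; rewrite !mxE.
rewrite (_ : (fun x => _) = fun x => - A x a b).
  exact: partialN (smooth_derivable (sA a b) Ux).
by apply/funext => y; rewrite mxE.
Qed.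

Lemma smxD m n (A B : coords R -> 'M[R]_(m, n)) : smx U A -> smx U B ->
  smx U (fun y => A y + B y).
Proof.
move=> sA sB a b; rewrite (_ : (fun x => _) = fun x => A x a b + B x a b).
  exact: (smoothD oU (sA a b) (sB a b)).
by apply/funext => x; rewrite mxE.
Qed.

Lemma dmxD m n (A B : coords R -> 'M[R]_(m, n)) i x : smx U A -> smx U B -> U x ->
  dmx i (fun y => A y + B y) x = dmx i A x + dmx i B x.
Proof.
move=> sA sB Ux; apply/matrixP => a b; rewrite !mxE.
rewrite -(smooth_partialD i (sA a b) (sB a b) Ux); congr (partial i _ x).
by apply/funext => y; rewrite mxE.
Qed.

Lemma smxZ m n (f : coords R -> R) (A : coords R -> 'M[R]_(m, n)) :
  smooth_on U f -> smx U A -> smx U (fun y => f y *: A y).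
Proof.
move=> sf sA a b; rewrite (_ : (fun x => _) = fun x => f x * A x a b).
  exact: (smoothM oU sf (sA a b)).
by apply/funext => x; rewrite mxE.
Qed.

Lemma dmxZ m n (f : coords R -> R) (A : coords R -> 'M[R]_(m, n)) i x :
  smooth_on U f -> smx U A -> U x ->
  dmx i (fun y => f y *: A y) x = partial i f x *: A x + f x *: dmx i A x.
Proof.
move=> sf sA Ux; apply/matrixP => a b; rewrite !mxE.
rewrite (_ : (fun y => _) = fun y => f y * A y a b).
  rewrite (smooth_partialM i sf (sA a b) Ux) addrC.
  by congr (_ + _); exact: mulrC.
by apply/funext => y; rewrite mxE.
Qed.

Lemma smx_cst m n (A : 'M[R]_(m, n)) : smx U (fun=> A).
Proof. by move=> a b; exact: smooth_cst. Qed.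

Lemma dmx_cst m n (A : 'M[R]_(m, n)) i x : dmx i (fun=> A) x = 0.
Proof. by apply/matrixP => a b; rewrite !mxE; exact: partial_cst. Qed.

Lemma eq_dmx m n (A B : coords R -> 'M[R]_(m, n)) i x :
  (forall y, U y -> A y = B y) -> U x -> dmx i A x = dmx i B x.
Proof.
move=> AB Ux; apply/matrixP => a b; rewrite !mxE.
by apply: (eq_partial i oU _ Ux) => y Uy; rewrite AB.
Qed.

Lemma dmxC m n (A : coords R -> 'M[R]_(m, n)) i j x : smx U A -> U x ->
  dmx i (dmx j A) x = dmx j (dmx i A) x.
Proof.
move=> sA Ux; apply/matrixP => a b; rewrite [LHS]mxE [RHS]mxE.
have e k : (fun y => dmx k A y a b) = partial k (fun y => A y a b).
  by apply/funext => y; rewrite mxE.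
rewrite (e i) (e j); exact: (schwarz i j oU (smooth_ck 2 (sA a b)) Ux).
Qed.

Lemma smooth_det n (A : coords R -> 'M[R]_n) : smx U A ->
  smooth_on U (fun x => \det (A x)).
Proof.
move=> sA; apply: (smooth_sum _ oU) => s; apply: (smoothZ _ oU).
by apply: (smooth_prods _ oU) => a; exact: sA.
Qed.

Lemma smx_inv (A : coords R -> 'M[R]_3) : smx U A ->
  (forall x, U x -> A x \in unitmx) -> smx U (fun x => invmx (A x)).
Proof.
move=> sA Au a b.
have d0 x : U x -> \det (A x) != 0 by move=> /Au; rewrite unitmxE unitfE.
apply: (eq_smooth oU (f := fun x => (\det (A x))^-1 * cofactor (A x) b a)).
  by move=> x Ux; rewrite /invmx Au // !mxE.
apply: (smoothM oU (smoothV oU d0 (smooth_det sA))).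
apply: (smoothZ _ oU); apply: smooth_det => k l.
rewrite (_ : (fun x => _) = fun x => A x (lift b k) (lift a l)); first exact: sA.
by apply/funext => x; rewrite !mxE.
Qed.

End MatrixCalculus.

(** In the local frame the connection is a matrix of 1-forms: [Gam i] and
    [Rie i j] are the matrices of the connection and of the curvature, acting on
    the right of rows of components. *)
Section LeviCivita.
Variables (R : realType) (G : tensor2 R) (U : set (coords R)).
Hypotheses (oU : open U) (sG : smx U G).
Hypothesis GT : forall x, U x -> (G x)^T = G x.
Hypothesis Gu : forall x, U x -> G x \in unitmx.
Implicit Types (x y : coords R) (i j k l m : 'I_3).

Definition Gam i x : 'M[R]_3 := \matrix_(j, k) christoffel G k i j x.
Definition Rie i j x : 'M[R]_3 := \matrix_(k, l) riemann G l i j k x.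

Let sG' i j : smooth_on U (fun x => G x i j). Proof. exact: sG. Qed.

Lemma smooth_christoffel k i j : smooth_on U (christoffel G k i j).
Proof.
apply: (smoothZ _ oU); apply: (smooth_sum _ oU) => l.
apply: (smoothM oU (smx_inv oU sG Gu k l)).
apply: (smoothB oU); last exact: smooth_partial.
by apply: (smoothD oU); exact: smooth_partial.
Qed.

Lemma smx_Gam i : smx U (Gam i).
Proof.
move=> a b; rewrite (_ : (fun x => _) = christoffel G b i a).
  exact: smooth_christoffel.
by apply/funext => x; rewrite mxE.
Qed.

Lemma christoffel_sym k i j x : U x -> christoffel G k i j x = christoffel G k j i x.
Proof.
move=> Ux; rewrite /christoffel; congr (_ * _); apply: eq_bigr => l _.
congr (_ * _); rewrite (sym_partial oU GT l i j Ux); congr (_ - _).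
exact: addrC.
Qed.

Lemma RieE i j x : U x ->
  Rie i j x = dmx i (Gam j) x - dmx j (Gam i) x
              + Gam j x *m Gam i x - Gam i x *m Gam j x.
Proof.
move=> Ux; apply/matrixP => k l; rewrite !mxE /riemann.
have e a : (fun y => Gam a y k l) = christoffel G l a k.
  by apply/funext => y; rewrite mxE.
rewrite !e // -!addrA; congr (_ + (_ + _)).
rewrite -sumrB; apply: eq_bigr => m _; rewrite !mxE.
by congr (_ - _); exact: mulrC.
Qed.

Lemma Rie_skew i j x : Rie j i x = - Rie i j x.
Proof.
apply/matrixP => k l; rewrite !mxE /riemann opprD opprB; congr (_ + _).
rewrite -sumrN; apply: eq_bigr => m _; exact/esym/opprB.
Qed.

Lemma bianchi_sums (C : 'I_3 -> 'I_3 -> 'I_3 -> R) (p1 p2 p3 : R) i j k l :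
  (forall a b c, C a b c = C a c b) ->
  (p1 - p2 + \sum_m (C l i m * C m j k - C l j m * C m i k)) +
  (p2 - p3 + \sum_m (C l j m * C m k i - C l k m * C m j i)) +
  (p3 - p1 + \sum_m (C l k m * C m i j - C l i m * C m k j)) = 0.
Proof.
move=> Cs.
rewrite (addrACA (p1 - p2)) (addrACA (p1 - p2 + _)) -!big_split /= big1 => [|m _].
  by ring.
by rewrite (Cs m k i) (Cs m j i) (Cs m k j); ring.
Qed.

Lemma Rie_bianchi i j k l x : U x ->
  Rie i j x k l + Rie j k x i l + Rie k i x j l = 0.
Proof.
move=> Ux; rewrite 3!mxE /riemann.
have e a b c m : partial m (christoffel G a b c) x = partial m (christoffel G a c b) x.
  by apply: (eq_partial m oU _ Ux) => y; exact: christoffel_sym.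
rewrite (e l k i j) (e l j i k) (e l k j i).
apply: (@bianchi_sums (fun a b c => christoffel G a b c x)) => a b c.
exact: christoffel_sym.
Qed.

(** Metric compatibility: the defining formula of the Christoffel symbols, solved
    for the derivatives of g. *)
Lemma dmx_metric i x : U x -> dmx i G x = Gam i x *m G x + G x *m (Gam i x)^T.
Proof.
move=> Ux; apply/matrixP => j k; rewrite !mxE.
have e a b : \sum_m G x a m * christoffel G m i b x = christoffel1 G i b a x.
  exact: christoffel_lower (Gu Ux).
have e1 : \sum_m Gam i x j m * G x m k = christoffel1 G i j k x.
  rewrite -e; apply: eq_bigr => m _; rewrite mxE mulrC.
  by rewrite (sym_entry GT m k Ux).
have e2 : \sum_m G x j m * (Gam i x)^T m k = christoffel1 G i k j x.
  by rewrite -e; apply: eq_bigr => m _; rewrite !mxE.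
rewrite e1 e2 /christoffel1 (sym_partial oU GT i k j Ux).
by move: (partial _ _ _) (partial _ _ _) (partial _ _ _) => a b c; field.
Qed.

Lemma mx_ring_metric (A B g : 'M[R]_3) (P Q : 'M[R]_3) :
  (P *m g + A *m (B *m g + g *m B^T)) + ((B *m g + g *m B^T) *m A^T + g *m P^T)
  = (Q *m g + B *m (A *m g + g *m A^T)) + ((A *m g + g *m A^T) *m B^T + g *m Q^T) ->
  (Q - P + B *m A - A *m B) *m g + g *m (Q - P + B *m A - A *m B)^T = 0.
Proof.
have trB (X Y : 'M[R]_3) : (X - Y)^T = X^T - Y^T by exact: raddfB.
have trD (X Y : 'M[R]_3) : (X + Y)^T = X^T + Y^T by exact: raddfD.
rewrite trB trD trB !trmx_mul.
rewrite (mulmxBl _ _ g) (mulmxDl _ _ g) (mulmxBl _ _ g).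
rewrite (mulmxBr g) (mulmxDr g) (mulmxBr g).
rewrite !(mulmxDr A) !(mulmxDr B) !(mulmxDl _ _ A^T) !(mulmxDl _ _ B^T) !mulmxA.
move: (P *m g) (Q *m g) (A *m B *m g) (B *m A *m g) (A *m g *m B^T) (B *m g *m A^T)
  (g *m B^T *m A^T) (g *m A^T *m B^T) (g *m P^T) (g *m Q^T).
move=> m1 m2 m3 m4 m5 m6 m7 m8 m9 m10 /matrixP e.
by apply/matrixP => k l; move: (e k l); rewrite !mxE; lra.
Qed.

(** The second derivatives of the metric commute. *)
Lemma Rie_metric i j x : U x -> Rie i j x *m G x + G x *m (Rie i j x)^T = 0.
Proof.
move=> Ux; rewrite RieE //.
have sGam := smx_Gam.
have d a b : dmx b (dmx a G) x =
    (dmx b (Gam a) x *m G x + Gam a x *m (Gam b x *m G x + G x *m (Gam b x)^T)) +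
    ((Gam b x *m G x + G x *m (Gam b x)^T) *m (Gam a x)^T + G x *m (dmx b (Gam a) x)^T).
  rewrite (eq_dmx oU b (dmx_metric a) Ux).
  have s1 := smxM oU (sGam a) sG; have s2 := smxM oU sG (smx_tr (sGam a)).
  rewrite (dmxD b s1 s2 Ux) (dmxM oU b (sGam a) sG Ux).
  rewrite (dmxM oU b sG (smx_tr (sGam a)) Ux) dmx_tr.
  by rewrite (dmx_metric b Ux).
apply: (mx_ring_metric (P := dmx j (Gam i) x) (Q := dmx i (Gam j) x)).
exact: etrans (esym (d i j)) (etrans (dmxC oU j i sG Ux) (d j i)).
Qed.

Lemma mx_ring_parallel (v : 'rV[R]_3) (A B P Q : 'M[R]_3) :
  v *m A *m B - v *m Q = v *m B *m A - v *m P ->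
  v *m (Q - P + B *m A - A *m B) = 0.
Proof.
rewrite (mulmxBr v) (mulmxDr v) (mulmxBr v) !mulmxA.
move: (v *m Q) (v *m P) (v *m B *m A) (v *m A *m B) => m1 m2 m3 m4 /matrixP e.
by apply/matrixP => k l; move: (e k l); rewrite !mxE; lra.
Qed.

(** The second derivatives of X commute. *)
Lemma Rie_parallel (X : vfield R) i j x : smx U X ->
  (forall k y, U y -> dmx k X y = - (X y *m Gam k y)) -> U x ->
  X x *m Rie i j x = 0.
Proof.
move=> sX dX Ux; rewrite RieE //.
have d a b : dmx b (dmx a X) x = X x *m Gam b x *m Gam a x - X x *m dmx b (Gam a) x.
  rewrite (eq_dmx oU b (dX a) Ux).
  rewrite (dmxN b (smxM oU sX (smx_Gam a)) Ux) (dmxM oU b sX (smx_Gam a) Ux).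
  by rewrite (dX b x Ux) mulNmx opprD opprK.
apply: mx_ring_parallel; rewrite -(d j i) -(d i j).
exact: (dmxC oU).
Qed.

Lemma parallel_dmx (X : vfield R) k x : parallel_at G X x ->
  dmx k X x = - (X x *m Gam k x).
Proof.
move=> par; apply/matrixP => a l; rewrite ord1 !mxE.
apply/eqP; rewrite -addr_eq0; apply/eqP; rewrite -[RHS](par k l) /covd.
congr (_ + _); apply: eq_bigr => j _; rewrite mxE; exact: mulrC.
Qed.

End LeviCivita.
(** * Curvature determined by a null parallel field and the Ricci tensor *)

Section CurvatureAlgebra.
Variable R : realType.
Implicit Types (i j k l m : 'I_3).

(** The matrix of the cross product with v: it spans the skew matrices that
    annihilate v. *)
Definition eps (v : 'I_3 -> R) i j : R :=
  nth 0 (nth [::] [:: [:: 0; v 2%:R; - v 1]; [:: - v 2%:R; 0; v 0];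
                      [:: v 1; - v 0; 0]] i) j.

Lemma skew_kernel (v : 'I_3 -> R) (Om : 'I_3 -> 'I_3 -> R) :
  (exists a, v a != 0) -> (forall k l, Om k l = - Om l k) ->
  (forall l, \sum_k v k * Om k l = 0) ->
  exists s, forall k l, Om k l = s * eps v k l.
Proof.
move=> [a va] sk ker.
have diag k : Om k k = 0 by have := sk k k; lra.
have k0 := ker 0; have k1 := ker 1; have k2 := ker 2%:R; clear ker.
rewrite !sum3 (sk 1 0) (sk 2%:R 0) diag in k0.
rewrite !sum3 (sk 2%:R 1) diag in k1; rewrite !sum3 diag in k2.
suff [s [e01 e12 e02]] : exists s, [/\ Om 0 1 = s * v 2%:R, Om 1 2%:R = s * v 0
    & Om 0 2%:R = - (s * v 1)].
  exists s; apply: all3; apply: all3; rewrite /eps /= ?diag ?mulr0 //.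
  - by rewrite e02 mulrN.
  - by rewrite (sk 1 0) e01 mulrN.
  - by rewrite (sk 2%:R 0) e02 opprK.
  - by rewrite (sk 2%:R 1) e12 mulrN.
move: va k0 k1 k2; move: (Om 0 1) (Om 1 2%:R) (Om 0 2%:R) => p q r va k0 k1 k2.
move: va; move: a; apply: all3 => va.
- exists (q / v 0); split; last 1 first.
  + by apply: (mulfI va); transitivity (- (v 1 * q)); [lra | field].
  + by apply: (mulfI va); transitivity (v 2%:R * q); [lra | field].
  + by field.
- exists (- r / v 1); split.
  + by apply: (mulfI va); transitivity (- (v 2%:R * r)); [lra | field].
  + by apply: (mulfI va); transitivity (- (v 0 * r)); [lra | field].
  + by field.
- exists (p / v 2%:R); split.
  + by field.
  + by apply: (mulfI va); transitivity (v 0 * p); [lra | field].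
  + by apply: (mulfI va); transitivity (- (v 1 * p)); [lra | field].
Qed.

(** The determinant of a symmetric matrix. *)
Definition sdet (G : 'I_3 -> 'I_3 -> R) : R :=
  G 0 0 * (G 1 1 * G 2%:R 2%:R - G 1 2%:R * G 1 2%:R)
  - G 0 1 * (G 0 1 * G 2%:R 2%:R - G 1 2%:R * G 0 2%:R)
  + G 0 2%:R * (G 0 1 * G 1 2%:R - G 1 1 * G 0 2%:R).

(** The Gram determinant of (e_i, e_j, v) and (e_k, e_l, v), expanded along its last
    column; the corner g(v,v) vanishes. *)
Lemma gram_eps (G : 'I_3 -> 'I_3 -> R) (v t : 'I_3 -> R) i j k l :
  (forall a b, G a b = G b a) -> (forall a, t a = \sum_b G a b * v b) ->
  \sum_a t a * v a = 0 ->
  sdet G * (eps v i j * eps v k l) =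
  t i * (G j k * t l - G j l * t k) - t j * (G i k * t l - G i l * t k).
Proof.
move=> Gs tE n0.
transitivity (t i * (G j k * t l - G j l * t k) - t j * (G i k * t l - G i l * t k)
   + (\sum_a t a * v a) * (G i k * G j l - G i l * G j k)); last first.
  by rewrite n0 mul0r addr0.
rewrite sum3 !tE !sum3 /sdet.
have s10 := Gs 1 0; have s20 := Gs 2%:R 0; have s21 := Gs 2%:R 1.
move: k l; apply: all3; apply: all3;
  move: i j; apply: all3; apply: all3;
  rewrite /eps /= ?s10 ?s20 ?s21; ring.
Qed.

Variables (G : 'M[R]_3) (V : 'rV[R]_3).
Hypotheses (GT : G^T = G) (Gu : G \in unitmx) (V0 : V != 0).
Hypothesis nullV : (V *m G *m V^T) 0 0 = 0.

(** The 1-form dual to V, as a column. *)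
Definition tau : 'cV[R]_3 := G *m V^T.

(** The endomorphism [Z |-> theta(Z) d_i - g(Z, d_i) V], where theta is dual to V. *)
Definition simple_op i : 'M[R]_3 :=
  tau *m delta_mx 0 i - G *m (delta_mx 0 i : 'rV[R]_3)^T *m V.

(** In Brinkmann coordinates the curvature is [- F_xx / 2] times this tensor. *)
Definition wave_curv i j : 'M[R]_3 := tau j 0 *: simple_op i - tau i 0 *: simple_op j.

Let Gs a b : G a b = G b a. Proof. by rewrite -{1}GT mxE. Qed.

Lemma simple_opE i k l :
  simple_op i k l = tau k 0 * (i == l)%:R - G k i * V 0 l.
Proof.
have e1 : (tau *m (delta_mx 0 i : 'rV[R]_3)) k l = tau k 0 * (i == l)%:R.
  by rewrite mxE big_ord1 !mxE eqxx /= eq_sym.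
have e2 : (G *m (delta_mx 0 i : 'rV[R]_3)^T) k 0 = G k i.
  rewrite mxE (bigD1 i) //= !mxE !eqxx mulr1 big1 ?addr0 // => m mi.
  by rewrite !mxE (negbTE mi) andbF mulr0.
have e3 : (G *m (delta_mx 0 i : 'rV[R]_3)^T *m V) k l = G k i * V 0 l.
  by rewrite mxE big_ord1 e2.
by rewrite /simple_op !mxE in e1 e3 *; rewrite e1 e3.
Qed.

Let tauE a : tau a 0 = \sum_b G a b * V 0 b.
Proof. by rewrite mxE; apply: eq_bigr => b _; rewrite mxE. Qed.

Let tauV : \sum_a tau a 0 * V 0 a = 0.
Proof.
rewrite -[RHS]nullV mxE; apply: eq_bigr => a _; rewrite [_^T _ _]mxE; congr (_ * _).
by rewrite tauE mxE; apply: eq_bigr => b _; rewrite (Gs a b) mulrC.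
Qed.

Let V0' : exists a, V 0 a != 0.
Proof.
apply: contrapT => no; move/eqP: V0; apply; apply/rowP => a; rewrite [RHS]mxE.
by apply/eqP; apply: contrapT => /negP Va; apply: no; exists a.
Qed.

Lemma tau0 : exists a, tau a 0 != 0.
Proof.
apply: contrapT => no.
have t0 : tau = 0.
  apply/colP => a; rewrite [RHS]mxE; apply/eqP; apply: contrapT => /negP ta.
  by apply: no; exists a.
have : V^T = 0 by rewrite -(mulKmx Gu V^T) -/tau t0 mulmx0.
by move=> /(congr1 trmx); rewrite trmxK trmx0 => /eqP; rewrite (negbTE V0).
Qed.

Lemma wave_curvE i j k l : wave_curv i j k l =
  tau j 0 * (tau k 0 * (i == l)%:R - G k i * V 0 l)
  - tau i 0 * (tau k 0 * (j == l)%:R - G k j * V 0 l).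
Proof.
rewrite -!simple_opE /wave_curv.
by move: (tau j 0) (tau i 0) (simple_op i) (simple_op j) => a b A B; rewrite !mxE.
Qed.

Lemma wave_curv_lower i j k l : (wave_curv i j *m G) k l =
  tau i 0 * (G j k * tau l 0 - G j l * tau k 0)
  - tau j 0 * (G i k * tau l 0 - G i l * tau k 0).
Proof.
have d a : \sum_m (a == m)%:R * G m l = G a l.
  rewrite (bigD1 a) //= eqxx mul1r big1 ?addr0 // => m ma.
  by rewrite eq_sym (negbTE ma) mul0r.
have t : \sum_m V 0 m * G m l = tau l 0.
  by rewrite tauE; apply: eq_bigr => b _; rewrite (Gs l b) mulrC.
rewrite mxE.
transitivity (tau j 0 * (tau k 0 * (\sum_m (i == m)%:R * G m l)
    - G k i * \sum_m V 0 m * G m l)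
  - tau i 0 * (tau k 0 * (\sum_m (j == m)%:R * G m l)
    - G k j * \sum_m V 0 m * G m l)).
  rewrite !sum3 !wave_curvE; ring.
rewrite !d t (Gs k i) (Gs k j); ring.
Qed.

Lemma wave_curv_trace j k : \sum_i wave_curv i j k i = tau j 0 * tau k 0.
Proof.
have d : \sum_i tau i 0 * (j == i)%:R = tau j 0.
  rewrite (bigD1 j) //= eqxx mulr1 big1 ?addr0 // => m ma.
  by rewrite eq_sym (negbTE ma) mulr0.
have t : \sum_i G k i * V 0 i = tau k 0 by rewrite tauE.
transitivity (tau j 0 * (tau k 0 * 3 - \sum_i G k i * V 0 i)
  - (tau k 0 * (\sum_i tau i 0 * (j == i)%:R) - G k j * \sum_a tau a 0 * V 0 a)).
  under eq_bigr do rewrite wave_curvE eqxx.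
  rewrite !sum3 /=; ring.
rewrite d t tauV; ring.
Qed.

(** With an index lowered, K is skew in both pairs of indices and annihilates V, so
    that each pair contributes a multiple of [eps]; the Bianchi identity leaves a
    single coefficient.  By the Gram identity the square of [eps] is [wave_curv] up
    to a factor, and the trace identifies the coefficient. *)
Lemma curvature_of_ricci (K : 'I_3 -> 'I_3 -> 'M[R]_3) (f : R) :
  (forall i j, K j i = - K i j) ->
  (forall i j, K i j *m G + G *m (K i j)^T = 0) ->
  (forall i j, V *m K i j = 0) ->
  (forall i j k l, K i j k l + K j k i l + K k i j l = 0) ->
  (forall j k, \sum_i K i j k i = f * tau j 0 * tau k 0) ->
  forall i j, K i j = f *: wave_curv i j.
Proof.
move=> Ksk Kg KV Kb Kr.
pose v a := V 0 a.
pose Om i j := K i j *m G.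
have Om_skew i j k l : Om i j k l = - Om i j l k.
  have := Kg i j; rewrite -/(Om i j) => /eqP; rewrite addr_eq0 => /eqP e.
  have e' : (Om i j)^T = - Om i j by rewrite {2}e opprK /Om trmx_mul GT.
  by move: (Om i j) e' => A /matrixP/(_ l k); rewrite !mxE => ->.
have Om_ker i j l : \sum_k v k * Om i j k l = 0.
  have /matrixP/(_ 0 l) : V *m Om i j = 0 by rewrite /Om mulmxA KV mul0mx.
  by rewrite !mxE.
have ex i j : exists s, forall k l, Om i j k l = s * eps v k l.
  exact: skew_kernel V0' (Om_skew i j) (Om_ker i j).
have [s sP] : exists s : 'I_3 -> 'I_3 -> R, forall i j k l, Om i j k l = s i j * eps v k l.
  have ex' i : exists si : 'I_3 -> R, forall j k l, Om i j k l = si j * eps v k l.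
    by have [si siP] := choice (ex i); exists si.
  by have [s sP] := choice ex'; exists s.
have [a [b ab]] : exists a b, eps v a b != 0.
  have [d vd] := V0'; move: d vd; apply: all3 => vd.
  - by exists 1, 2%:R.
  - by exists 2%:R, 0.
  - by exists 0, 1.
have s_skew i j : s i j = - s j i.
  apply: (mulIf ab); rewrite mulNr -!sP /Om (Ksk j i) mulNmx.
  by move: (K j i *m G) => A; rewrite mxE.
have bian i j k l : s i j * eps v k l + s j k * eps v i l + s k i * eps v j l = 0.
  rewrite -!sP /Om !mxE -!big_split big1 // => m _ /=.
  by rewrite -!mulrDl Kb mul0r.
have s_ker l : \sum_k v k * s k l = 0.
  have b0 := bian 0 1 2%:R 0; have b1 := bian 0 1 2%:R 1; have b2 := bian 0 1 2%:R 2%:R.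
  rewrite /eps /= in b0 b1 b2.
  have s00 k : s k k = 0 by have := s_skew k k; lra.
  rewrite sum3; move: l; apply: all3; rewrite s00.
  - rewrite (s_skew 1 0); lra.
  - rewrite (s_skew 2%:R 1); lra.
  - rewrite (s_skew 0 2%:R); lra.
have [c cP'] := skew_kernel V0' s_skew s_ker.
have cP k l : s k l = c * eps v k l := cP' k l.
pose dt := sdet (fun a b => G a b).
have gram i j k l : dt * (eps v i j * eps v k l) = (wave_curv i j *m G) k l.
  rewrite wave_curv_lower.
  exact: (@gram_eps (fun a b => G a b) v (fun a => tau a 0) i j k l Gs tauE tauV).
have Ginj (A B : 'M[R]_3) : A *m G = B *m G -> A = B by exact: (can_inj (mulmxK Gu)).
have [t tn] := tau0.
have dt0 : dt != 0.
  apply/eqP => d0.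
  have w0 i j : wave_curv i j = 0.
    by apply: Ginj; rewrite mul0mx; apply/matrixP => k l; rewrite -gram d0 mul0r mxE.
  have := wave_curv_trace t t; rewrite big1 => [/esym/eqP|i _].
    by rewrite mulf_eq0 (negbTE tn).
  by rewrite w0 mxE.
have KE i j : K i j = (c / dt) *: wave_curv i j.
  apply: Ginj; rewrite -scalemxAl; apply/matrixP => k l.
  rewrite [RHS]mxE -gram -[LHS]/(Om i j k l) sP cP; move: (eps _ _ _) (eps _ _ _) => x y.
  by field.
have fE : f = c / dt.
  apply: (mulIf (mulf_neq0 tn tn)).
  rewrite mulrA -Kr -wave_curv_trace mulr_sumr; apply: eq_bigr => i _.
  by rewrite KE; move: (wave_curv _ _) => A; rewrite mxE.
by move=> i j; rewrite fE.
Qed.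

End CurvatureAlgebra.
(** * Parallel directions of the curvature: plane waves *)

Section NablaWave.
Variables (R : realType) (G : tensor2 R) (U : set (coords R)).
Hypotheses (oU : open U) (sG : smx U G).
Hypothesis GT : forall x, U x -> (G x)^T = G x.
Hypothesis Gu : forall x, U x -> G x \in unitmx.
Variables (X : vfield R) (f : coords R -> R).
Hypotheses (sX : smx U X) (sf : smooth_on U f).
Hypothesis par : forall x, U x -> parallel_at G X x.
Implicit Types (x y : coords R) (i j k l m : 'I_3).

Lemma nabla_riemannE m l i j k x : nabla_riemann G m l i j k x =
  (dmx m (Rie G i j) x) k l + (Rie G i j x *m Gam G m x) k l
  - (Gam G m x *m Rie G i j x) k l
  - \sum_a Gam G m x i a * Rie G a j x k l
  - \sum_a Gam G m x j a * Rie G i a x k l.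
Proof.
rewrite /nabla_riemann [in RHS]mxE.
have e : (fun y => Rie G i j y k l) = riemann G l i j k.
  by apply/funext => y; rewrite mxE.
rewrite e -!addrA; congr (_ + _).
have -> : (Rie G i j x *m Gam G m x) k l =
    \sum_a christoffel G l m a x * riemann G a i j k x.
  by rewrite mxE; apply: eq_bigr => a _; rewrite !mxE mulrC.
have -> : (Gam G m x *m Rie G i j x) k l =
    \sum_a christoffel G a m k x * riemann G l i j a x.
  by rewrite mxE; apply: eq_bigr => a _; rewrite !mxE.
have -> : \sum_a Gam G m x i a * Rie G a j x k l =
    \sum_a christoffel G a m i x * riemann G l a j k x.
  by apply: eq_bigr => a _; rewrite !mxE.
have -> : \sum_a Gam G m x j a * Rie G i a x k l =
    \sum_a christoffel G a m j x * riemann G l i a k x.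
  by apply: eq_bigr => a _; rewrite !mxE.
rewrite -!sumrN -!big_split; apply: eq_bigr => a _.
move: (christoffel G l m a x * _) (christoffel G a m i x * _)
  (christoffel G a m j x * _) (christoffel G a m k x * _) => t1 t2 t3 t4 /=; ring.
Qed.

Let T y : 'cV[R]_3 := tau (G y) (X y).
Let B i y : 'M[R]_3 := simple_op (G y) (X y) i.
Let dX m y : U y -> dmx m X y = - (X y *m Gam G m y).
Proof. by move=> Uy; apply: parallel_dmx; exact: par. Qed.

Lemma smx_tau : smx U T.
Proof. exact: (smxM oU sG (smx_tr sX)). Qed.

Lemma dmx_tau m x : U x -> dmx m T x = Gam G m x *m T x.
Proof.
move=> Ux; rewrite (dmxM oU m sG (smx_tr sX) Ux) dmx_tr (dX m Ux).
rewrite (dmx_metric oU GT Gu m Ux) raddfN /= trmx_mul mulmxN mulmxDl.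
by rewrite /T /tau !mulmxA addrK.
Qed.

Lemma smx_simple_op i : smx U (B i).
Proof.
have s1 := smxM oU smx_tau (smx_cst (delta_mx 0 i)).
have s2 := smxM oU (smxM oU sG (smx_cst (delta_mx 0 i : 'rV[R]_3)^T)) sX.
exact: (smxD oU s1 (smxN oU s2)).
Qed.

(** The tensor [simple_op] is parallel, being built from g and V. *)
Lemma dmx_simple_op m i k l x : U x ->
  (dmx m (B i) x) k l = (Gam G m x *m B i x) k l - (B i x *m Gam G m x) k l
    + \sum_a Gam G m x i a * B a x k l.
Proof.
move=> Ux; set C := Gam G m x; pose e : 'rV[R]_3 := delta_mx 0 i.
have s1 := smxM oU smx_tau (smx_cst e).
have s0 := smxM oU sG (smx_cst e^T).
have s2 := smxM oU s0 sX.
have -> : dmx m (B i) x = C *m T x *m e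
    - (C *m G x *m e^T *m X x + G x *m C^T *m e^T *m X x - G x *m e^T *m X x *m C).
  rewrite (dmxD m s1 (smxN oU s2) Ux) (dmxN m s2 Ux); congr (_ - _).
    rewrite (dmxM oU m smx_tau (smx_cst e) Ux) dmx_cst mulmx0 addr0.
    by rewrite dmx_tau.
  rewrite (dmxM oU m s0 sX Ux) (dmxM oU m sG (smx_cst e^T) Ux) dmx_cst mulmx0 addr0.
  rewrite (dX m Ux) (dmx_metric oU GT Gu m Ux) mulmxN !mulmxDl mulmxA.
  by [].
have -> : C *m B i x = C *m T x *m e - C *m G x *m e^T *m X x.
  by rewrite /B /simple_op mulmxBr !mulmxA.
have -> : B i x *m C = T x *m e *m C - G x *m e^T *m X x *m C.
  by rewrite /B /simple_op mulmxBl.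
have -> : \sum_a C i a * B a x k l = (T x *m e *m C) k l - (G x *m C^T *m e^T *m X x) k l.
  have e1 : e *m C = row i C by rewrite -rowE.
  have e2 : C^T *m e^T = (row i C)^T by rewrite -trmx_mul e1.
  rewrite -(mulmxA (T x)) e1 -(mulmxA (G x)) e2.
  have -> : (T x *m row i C) k l = T x k 0 * C i l.
    by rewrite mxE big_ord1; congr (_ * _); exact: mxE.
  have -> : (G x *m (row i C)^T *m X x) k l = (\sum_a G x k a * C i a) * X x 0 l.
    rewrite mxE big_ord1; congr (_ * _); rewrite mxE.
    by apply: eq_bigr => a _; rewrite !mxE.
  have -> : C i l = \sum_a C i a * (a == l)%:R.
    rewrite (bigD1 l) //= eqxx mulr1 big1 ?addr0 // => a al.
    by rewrite (negbTE al) mulr0.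
  rewrite mulr_sumr mulr_suml -sumrB; apply: eq_bigr => a _.
  by rewrite simple_opE; ring.
move: (C *m T x *m e) (C *m G x *m e^T *m X x) (G x *m C^T *m e^T *m X x)
  (G x *m e^T *m X x *m C) (T x *m e *m C) => m1 m2 m3 m4 m5.
by rewrite !mxE; ring.
Qed.

Hypothesis curv : forall x, U x ->
  forall i j, Rie G i j x = f x *: wave_curv (G x) (X x) i j.

(** Only the scalar factor of the curvature is not parallel. *)
Lemma nabla_wave m l i j k x : U x -> nabla_riemann G m l i j k x =
  partial m f x * wave_curv (G x) (X x) i j k l.
Proof.
move=> Ux; rewrite nabla_riemannE.
have t a y : T y a 0 = tau (G y) (X y) a 0 by [].
have sT a : smooth_on U (fun y => T y a 0) by exact: smx_tau.
have dT a : partial m (fun y => T y a 0) x = \sum_b Gam G m x a b * T x b 0.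
  have /matrixP/(_ a 0) := dmx_tau m Ux; rewrite mxE => ->.
  by rewrite mxE.
have dTB a b : dmx m (fun y => T y a 0 *: B b y) x =
    (\sum_c Gam G m x a c * T x c 0) *: B b x + T x a 0 *: dmx m (B b) x.
  by rewrite (dmxZ m (sT a) (smx_simple_op b) Ux) dT.
have sTB a b : smx U (fun y => T y a 0 *: B b y).
  exact: (smxZ oU (sT a) (smx_simple_op b)).
have dP : dmx m (Rie G i j) x = partial m f x *: wave_curv (G x) (X x) i j
    + f x *: (dmx m (fun y => T y j 0 *: B i y) x - dmx m (fun y => T y i 0 *: B j y) x).
  have sP := smxD oU (sTB j i) (smxN oU (sTB i j)).
  rewrite (eq_dmx oU (B := fun y => f y *: (T y j 0 *: B i y - T y i 0 *: B j y)) m _ Ux).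
    rewrite (dmxZ m sf sP Ux) (dmxD m (sTB j i) (smxN oU (sTB i j)) Ux).
    by rewrite (dmxN m (sTB i j) Ux).
  by move=> y Uy; rewrite (curv Uy).
rewrite dP !dTB.
have E1 := dmx_simple_op m i k l Ux; have E2 := dmx_simple_op m j k l Ux.
rewrite !(curv Ux) /wave_curv -/T -/(B i x) -/(B j x).
rewrite -!scalemxAl -!scalemxAr !(mulmxBl, mulmxBr) -!scalemxAl -!scalemxAr.
have S1 : \sum_a Gam G m x i a * Rie G a j x k l =
    f x * (T x j 0 * \sum_a Gam G m x i a * B a x k l
      - (\sum_a Gam G m x i a * T x a 0) * B j x k l).
  rewrite mulrBr mulr_suml !mulr_sumr -sumrB; apply: eq_bigr => a _.
  rewrite (curv Ux) /wave_curv -/(T x) -/(B a x) -/(B j x).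
  by move: (B a x) (B j x) (Gam _ _ _ _ _) (T x j 0) (T x a 0) => b1 b2 r1 r2 r3;
    rewrite !mxE; ring.
have S2 : \sum_a Gam G m x j a * Rie G i a x k l =
    f x * ((\sum_a Gam G m x j a * T x a 0) * B i x k l
      - T x i 0 * \sum_a Gam G m x j a * B a x k l).
  rewrite mulrBr mulr_suml !mulr_sumr -sumrB; apply: eq_bigr => a _.
  rewrite (curv Ux) /wave_curv -/(T x) -/(B a x) -/(B i x).
  by move: (B a x) (B i x) (Gam _ _ _ _ _) (T x i 0) (T x a 0) => b1 b2 r1 r2 r3;
    rewrite !mxE; ring.
rewrite S1 S2 -/(T x).
move: E1 E2.
move: (\sum_a _ * B a x k l) (\sum_a _ * B a x k l) (\sum_a _ * T x a 0)
  (\sum_a _ * T x a 0).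
move=> s1 s2 s3 s4.
move: (dmx m (B i) x) (dmx m (B j) x) (Gam G m x *m B i x) (Gam G m x *m B j x)
  (B i x *m Gam G m x) (B j x *m Gam G m x) (B i x) (B j x) (T x i 0) (T x j 0).
move=> d1 d2 p1 p2 q1 q2 b1 b2 t1 t2; rewrite !mxE => -> ->.
ring.
Qed.

End NablaWave.

Section PlaneWave.
Variables (R : realType) (M : topologicalType) (S : smooth_structure R M).
Variables (g : chart R M -> tensor2 R) (V : chart R M -> vfield R).
Variables (h : M -> R) (L : R).
Hypotheses (lor : lorentz_metric S g) (pp : pp_field S g V).
Hypotheses (sh : smooth_function S h) (fe : field_equation S g h L).
Hypothesis (conn : connected [set: M]).
Hypothesis nf : exists q, nonflat_at S g q.
Hypothesis hpos : forall q, 0 < h q.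
Hypothesis null_grad : forall c q, atlas S c -> cdom c q ->
  grad_norm2 g h c (cmap c q) = 0.
Implicit Types (c b : chart R M) (q z : M) (i j k : 'I_3) (x y : coords R).

Notation hl := (local_expr h).
Notation th := (th g V).
Notation bchart := (bchart S g V).

Lemma th_bchart b k x : bchart b -> cimg b x -> th b k x = (k == 1)%:R.
Proof.
move=> [Sb VE gE F0] bx; rewrite /th /lower sum3 !(VE x bx) (gE x bx) !mxE.
by move: k; apply: all3; rewrite /= ?mulr0 ?mulr1 ?addr0.
Qed.

(** The coordinate v of a Brinkmann chart is a primitive of the 1-form dual to V. *)
Lemma partial_pullback c b z phi i : atlas S c -> bchart b ->
  cdom c z -> cdom b z -> smooth_on (cimg b) phi ->
  partial 0 phi (cmap b z) = 0 -> partial 2%:R phi (cmap b z) = 0 ->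
  partial i (fun y => phi (transition c b y)) (cmap c z) =
  partial 1 phi (cmap b z) * th c i (cmap c z).
Proof.
move=> Sc bb cz bz sphi p0 p2; have [Sb VE gE F0] := bb.
have ov := overlap_cmap cz bz.
have bx := cimg_cmap bz.
have Ux : cimg b (transition c b (cmap c z)) by rewrite transition_cmap.
have dT j : derivable (fun y => transition c b y 0 j) (cmap c z) (delta_mx 0 i).
  exact: smooth_derivable (smooth_trans j Sc Sb) ov.
rewrite (partial_comp (@open_cimg _ _ b) (smooth_ck 1 sphi) Ux dT).
rewrite transition_cmap // (th_law lor pp i Sc Sb cz bz) !sum3 p0 p2.
rewrite !(th_bchart _ bb bx) /= !mulr0 !mulr1 !addr0 !add0r.
by rewrite mxE mulrC.
Qed.

Lemma smooth_pullback c b phi : atlas S c -> bchart b -> smooth_on (cimg b) phi ->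
  smooth_on (overlap c b) (fun y => phi (transition c b y)).
Proof.
move=> Sc [Sb _ _ _] sphi.
have := @smooth_comp R (cimg b) (overlap c b) phi (transition c b).
apply; [exact: open_cimg | exact: open_overlap | | | exact: sphi].
- by move=> y [z [cz bz] <-]; rewrite transition_cmap //; exact: cimg_cmap.
- by move=> j; exact: (smooth_trans j Sc Sb).
Qed.

(** The field equation gives the Ricci tensor: since grad h is a multiple of V, the
    Hessian of h is a multiple of the square of the 1-form dual to V, and has trace
    zero.  The factor f is the component [- F_xx / 2] of the Ricci tensor in a
    Brinkmann chart, which depends on v alone. *)
Lemma local_curvature c q : atlas S c -> cdom c q -> exists (O : set (coords R)) f,
  [/\ open O, O `<=` cimg c, O (cmap c q), smooth_on O f &
    (forall y, O y -> forall i j, Rie (g c) i j y = f y *: wave_curv (g c y) (V c y) i j)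
    /\ exists d, forall m, partial m f (cmap c q) = d * th c m (cmap c q)].
Proof.
move=> Sc cq; have [b [r [cub bb]]] := bchart_exists lor pp q.
have [r0 Sb bq bE] := cub; have [_ VE gE F0] := bb.
have prof := lightlike_profile lor pp sh fe conn nf hpos cub bb (null_grad Sb bq).
pose O := overlap c b; have oO : open O by exact: open_overlap.
have Oc : O `<=` cimg c by move=> y [z [cz bz] <-]; exact: cimg_cmap.
pose H := hl b; pose F22 := partial 2%:R (partial 2%:R (Fb g b)).
have sH : smooth_on (cimg b) H by exact: (h_smooth sh Sb).
have sH1 := smooth_partial 1 sH.
have sF22 : smooth_on (cimg b) F22.
  exact/smooth_partial/smooth_partial/(Fb_smooth lor bb).
pose phi x := - 2^-1 * F22 x.
have oB := @open_cimg _ _ b.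
have sphi : smooth_on (cimg b) phi by exact: (smoothZ _ oB sF22).
pose f y := phi (transition c b y); pose a y := partial 1 H (transition c b y).
have sf : smooth_on O f by exact: smooth_pullback.
have sa : smooth_on O a by exact: smooth_pullback.
have H0 x : cimg b x -> partial 0 H x = 0.
  by move=> bx; exact: (hu0 lor pp sh fe conn nf bb bx).
have H2 x : cimg b x -> partial 2%:R H x = 0.
  by move=> bx; have [e _ _ _] := prof x bx; exact: e.
have H1i i x : cimg b x -> i != 1 -> partial i (partial 1 H) x = 0.
  move=> bx i1; rewrite (schwarz i 1 oB (smooth_ck 2 sH) bx).
  have e y : cimg b y -> partial i H y = 0.
    by move: i i1; apply: all3 => // _; [exact: H0 | exact: H2].
  by rewrite (eq_partial 1 oB e bx) partial_cst.
have da z i : cdom c z -> cdom b z -> partial i a (cmap c z) =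
    partial 1 (partial 1 H) (cmap b z) * th c i (cmap c z).
  move=> cz bz; have bx := cimg_cmap bz.
  by apply: (partial_pullback i Sc bb cz bz sH1); exact: H1i.
have gradO y : O y -> grad (g c) (hl c) y = a y *: V c y.
  move=> [z [cz bz] <-]; have bx := cimg_cmap bz.
  have Ju := jac_unit lor Sc Sb cz bz.
  apply: (can_inj (mulmxK Ju)); rewrite -scalemxAl.
  rewrite -(V_law pp Sc Sb cz bz) -(grad_law lor sh Sc Sb cz bz).
  rewrite (gradE gE (hl b) bx) (H0 _ bx) (H2 _ bx) /a transition_cmap // mulr0 add0r.
  by apply/rowP; apply: all3; rewrite !mxE (VE _ bx) /= ?mulr0 ?mulr1.
have hessO z i j : cdom c z -> cdom b z -> hess (g c) (hl c) i j (cmap c z) =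
    partial 1 (partial 1 H) (cmap b z) * (th c i (cmap c z) * th c j (cmap c z)).
  move=> cz bz; have cx := cimg_cmap cz; have ov := overlap_cmap cz bz.
  set x := cmap c z in cx ov *.
  have cov k : covd (g c) (grad (g c) (hl c)) i k x = partial i a x * V c x 0 k.
    have sV : smooth_on O (fun y => V c y 0 k).
      exact: smooth_sub Oc (V_smooth pp k Sc).
    have e y : O y -> grad (g c) (hl c) y 0 k = a y * V c y 0 k.
      by move=> Oy; rewrite (gradO y Oy) mxE.
    rewrite /covd (eq_partial i oO e ov) (smooth_partialM i sa sV ov).
    have p := V_parallel pp Sc cx i k; rewrite /covd in p.
    have -> : \sum_l christoffel (g c) k i l x * grad (g c) (hl c) x 0 l =
        a x * \sum_l christoffel (g c) k i l x * V c x 0 l.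
      rewrite mulr_sumr; apply: eq_bigr => l _.
      by rewrite (gradO x ov) mxE mulrCA.
    move: p; move: (\sum_l _) (partial i _ x) (partial i _ x) (a x) (V c x 0 k).
    move=> s1 s2 s3 s4 s5 p; rewrite -[RHS]addr0 -(mulr0 s4) -p; ring.
  rewrite /hess; under eq_bigr do rewrite cov.
  transitivity (partial i a x * th c j x).
    have -> : th c j x = \sum_k g c x j k * V c x 0 k by [].
    rewrite mulr_sumr; apply: eq_bigr => k _; rewrite (g_symE lor k j Sc cx).
    by rewrite -mulrA; congr (_ * _); exact: mulrC.
  by rewrite [partial i a x](da z i cz bz) mulrA.
have lapO z : cdom c z -> cdom b z -> laplacian (g c) (hl c) (cmap c z) = 0.
  move=> cz bz; have cx := cimg_cmap cz; set x := cmap c z in cx *.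
  have Vth k : \sum_j invmx (g c x) k j * th c j x = V c x 0 k.
    have -> : V c x 0 k = (invmx (g c x) *m (g c x *m (V c x)^T)) k 0.
      by rewrite (mulKmx (g_unit lor Sc cx)) mxE.
    by rewrite mxE; apply: eq_bigr => j _; rewrite lowerE.
  rewrite /laplacian.
  transitivity (partial 1 (partial 1 H) (cmap b z) * \sum_i th c i x * V c x 0 i).
    rewrite mulr_sumr; apply: eq_bigr => i _.
    rewrite -Vth !mulr_sumr; apply: eq_bigr => j _.
    rewrite (hessO z i j cz bz) -/x.
    by move: (partial _ _ _) (th c i x) (th c j x) (invmx _ _ _) => *; ring.
  by rewrite (th_V lor pp Sc cx) mulr0.
have ricO y j k : O y -> ricci (g c) j k y = f y * th c j y * th c k y.
  move=> [z [cz bz] <-]; have cx := cimg_cmap cz; have bx := cimg_cmap bz.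
  have := field_at fe j k Sc cx.
  rewrite (lapO z cz bz) (hessO z j k cz bz) (Lambda0 lor pp sh fe nf) addr0 mul0r addr0.
  have [_ -> _ _] := prof _ bx.
  rewrite -/(F22 _) /f transition_cmap // /phi.
  rewrite !hlE //; have hn := lt0r_neq0 (hpos z).
  move: (ricci _ _ _ _) (h z) (F22 _) (th c j _) (th c k _) hn => r1 a1 a2 a3 a4 hn e.
  by apply: (mulfI hn); apply/eqP; rewrite -subr_eq0 -[X in _ == X]e; apply/eqP; field.
have sgO : smx O (g c).
  by move=> i j; exact: smooth_sub Oc (g_smooth lor i j Sc).
have sVO : smx O (V c).
  by move=> i j; rewrite (ord1 i); exact: smooth_sub Oc (V_smooth pp j Sc).
have gTO y : O y -> (g c y)^T = g c y by move=> /Oc; exact: (g_sym lor Sc).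
have guO y : O y -> g c y \in unitmx by move=> /Oc; exact: (g_unit lor Sc).
have parO y : O y -> parallel_at (g c) (V c) y by move=> /Oc; exact: (V_parallel pp Sc).
exists O, f; split => //; first exact: overlap_cmap.
split.
  move=> y Oy; have cy := Oc _ Oy.
  apply: (curvature_of_ricci (gTO y Oy) (guO y Oy) (V_neq0 pp Sc cy) (V_null pp Sc cy)).
  - by move=> i j; exact: Rie_skew.
  - by move=> i j; exact: (Rie_metric oO sgO gTO guO).
  - move=> i j; apply: (Rie_parallel oO sgO guO i j sVO _ Oy).
    by move=> k w Ow; apply: parallel_dmx; exact: parO.
  - by move=> i j k l; exact: (Rie_bianchi oO gTO).
  - move=> j k; rewrite -/(th c j y) -lowerE.
    rewrite /tau -!lowerE -ricO // /ricci; apply: eq_bigr => i _.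
    by rewrite mxE.
have bx := cimg_cmap bq; have [_ _ e0 e2] := prof _ bx.
exists (partial 1 phi (cmap b q)) => m; apply: (partial_pullback m Sc bb cq bq sphi).
  by rewrite (smooth_partialZ _ 0 sF22 bx) e0 mulr0.
by rewrite (smooth_partialZ _ 2%:R sF22 bx) e2 mulr0.
Qed.

(** The scalar f varies only transversally to the leaves orthogonal to V. *)
Lemma plane_wave_curv c q W X Y Z : atlas S c -> cdom c q ->
  orth g V c (cmap c q) W -> nabla_curv_at (g c) (cmap c q) W X Y Z = 0.
Proof.
move=> Sc cq oW; have cx := cimg_cmap cq; set x := cmap c q in cx oW *.
have [ O [f [oO Oc Oq sf [curvO [d df]]]]] := local_curvature Sc cq.
have sgO : smx O (g c).
  by move=> i j; exact: smooth_sub Oc (g_smooth lor i j Sc).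
have sVO : smx O (V c).
  by move=> i j; rewrite (ord1 i); exact: smooth_sub Oc (V_smooth pp j Sc).
have gTO y : O y -> (g c y)^T = g c y by move=> /Oc; exact: (g_sym lor Sc).
have guO y : O y -> g c y \in unitmx by move=> /Oc; exact: (g_unit lor Sc).
have parO y : O y -> parallel_at (g c) (V c) y by move=> /Oc; exact: (V_parallel pp Sc).
apply/rowP => l; rewrite !mxE.
pose w i j k := wave_curv (g c x) (V c x) i j k l.
transitivity (\sum_m th c m x * W 0 m *
    (d * \sum_i \sum_j \sum_k w i j k * X 0 i * Y 0 j * Z 0 k)).
  apply: eq_bigr => m _; rewrite !mulr_sumr; apply: eq_bigr => i _.
  rewrite !mulr_sumr; apply: eq_bigr => j _.
  rewrite !mulr_sumr; apply: eq_bigr => k _.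
  rewrite (nabla_wave oO sgO gTO guO sVO sf parO curvO m l i j k Oq) df -/x -/(w i j k).
  by move: (th _ _ _) (w _ _ _) => *; ring.
by rewrite -mulr_suml -(inner_lower V lor _ Sc cx) oW mul0r.
Qed.

End PlaneWave.
Theorem theorem4p1 (R : realType) (M : topologicalType)
    (S : smooth_structure R M) (g : chart R M -> 'rV[R]_3 -> 'M[R]_3)
    (h : M -> R) (Lambda : R) :
  pp_wave S g ->
  smooth_function S h ->
  (forall p : M, 0 < h p) ->
  nowhere_locally_constant h ->
  field_equation S g h Lambda ->
  (exists p : M, nonflat_at S g p) ->
  Lambda = 0 /\
  ([/\ lightlike_grad S g h,
       plane_wave S g
     & forall p : M, nonflat_at S g p ->
         exists c : chart R M,
           [/\ atlas S c, cdom c p & lightlike_form g h c]]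
   \/
   (spacelike_grad S g h /\
    forall p : M, nonflat_at S g p ->
      exists c : chart R M,
        [/\ atlas S c, cdom c p & spacelike_form g h c])).
Proof.
move=> [[hM sc conn lor] [V pp]] sh hpos _ fe nf.
split; first exact: (Lambda0 lor pp sh fe nf).
have [q0 nq0] := nf; have [c0 Sc0 c0q] := atlas_cover S q0.
pose N := grad_norm2 g h c0 (cmap c0 q0).
have NE c q : atlas S c -> cdom c q -> grad_norm2 g h c (cmap c q) = N.
  by move=> Sc cq; exact: (grad_norm2_const lor pp sh fe conn nf Sc Sc0 cq c0q).
have [N0|N0] := eqVneq N 0.
  have gn c q : atlas S c -> cdom c q -> grad_norm2 g h c (cmap c q) = 0.
    by move=> Sc cq; rewrite (NE c q Sc cq).
  left; split.
  - by move=> q c Sc cq _; exact: gn.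
  - split; first by split.
    exists V; first exact: pp.
    move=> q c Sc cq W X Y Z oW.
    exact: (plane_wave_curv lor pp sh fe conn nf hpos gn X Y Z Sc cq oW).
  - move=> q nq; apply: (lightlike_chart lor pp sh fe conn nf hpos nq) => c Sc cq.
    exact: gn.
right; split.
- move=> q c Sc cq _; rewrite (NE c q Sc cq) lt0r N0 /=.
  have [b [r [cub bb]]] := bchart_exists lor pp q; have [_ Sb bq _] := cub.
  rewrite -(NE b q Sb bq) (grad_norm2_b lor pp sh fe conn nf bb (cimg_cmap bq)).
  exact: sqr_ge0.
- move=> q nq; apply: (spacelike_chart lor pp sh fe conn nf hpos nq) => c Sc cq.
  by rewrite (NE c q Sc cq).
Qed.
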